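(* Let $\mu_0=(m,m)^\top\in\mathbb{R}^2$ and let $X_1,X_2,\ldots$ be i.i.d. random vectors in $\mathbb{R}^2$ with mean $\mu_0$ such that: (i) $\Sigma=\operatorname{Var}(X_i)$ is positive definite; (ii) $\mathbb{E}\|X_i-\mu_0\|^3<\infty$; (iii) for every fixed $M<\infty$, $$\mathbb{P}\big[\mu_0+n^{-1/2}\{h\in\mathbb{R}^2:\|h\|\le M\}\subset\operatorname{int}\operatorname{conv}(X_1,\ldots,X_n)\big]\to1\quad(n\to\infty).$$ Let $\Theta=\{\mu=(\mu_1,\mu_2)^\top\in\mathbb{R}^2:\mu_1\le\mu_2\}$. Then, as $n\to\infty$, $$\ell_{\Theta,n}(\mu_0)\ \xrightarrow{d}\ \overline{\chi}^{\,2}_{1,2},$$ where $\overline{\chi}^{\,2}_{1,2}$ denotes the mixture distribution with cdf $$\mathbb{P}(\overline{\chi}^{\,2}_{1,2}\le x)=\tfrac12\mathbb{P}(\chi^2_1\le x)+\tfrac12\mathbb{P}(\chi^2_2\le x),\qquad x\ge0.$$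
   Context: For $\mu\in\mathbb{R}^2$ the normalized empirical likelihood based on $X_1,\ldots,X_n$ is $$L_n(\mu)=\sup\Big\{\prod_{i=1}^n(np_i):\ p_i\ge0,\ \sum_{i=1}^np_i=1,\ \sum_{i=1}^np_i(X_i-\mu)=0\Big\},$$ where the supremum over the empty set is $0$. Put $\ell_n(\mu)=-2\log L_n(\mu)$, with value $+\infty$ if $L_n(\mu)=0$. Let $\mathcal{D}_{\Theta,n}$ be the event $\{\sup_{\nu\in\Theta}L_n(\nu)>0\}$. For $\mu\in\Theta$, on $\mathcal{D}_{\Theta,n}$ the constrained empirical log-likelihood ratio is $$\ell_{\Theta,n}(\mu)=-2\log\frac{L_n(\mu)}{\sup_{\nu\in\Theta}L_n(\nu)}=\ell_n(\mu)-\inf_{\nu\in\Theta}\ell_n(\nu),$$ and by convention $\ell_{\Theta,n}(\mu)=0$ on the complement of $\mathcal{D}_{\Theta,n}$. Here $\operatorname{conv}$ is the convex hull, $\operatorname{int}$ the interior, $\chi^2_k$ the chi-square distribution with $k$ degrees of freedom, and $\xrightarrow{d}$ convergence in distribution. *)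

(* Defs.v *)
From HB Require Import structures.
From mathcomp Require Import all_boot all_order all_algebra finmap.
From mathcomp Require Import all_classical all_reals all_analysis.
From mathcomp Require Import measurable_realfun lra.

Set Implicit Arguments.
Unset Strict Implicit.
Unset Printing Implicit Defensive.

Import Order.TTheory GRing.Theory Num.Theory.
Import numFieldNormedType.Exports.

Local Open Scope classical_set_scope.
Local Open Scope ring_scope.

(* The plane is R * R, which carries the product topology, the product
   sigma-algebra and the coordinatewise vector space structure.  Its library
   norm is the max norm, hence the separate Euclidean norm. *)
Section plane.
Context {R : realType}.

Definition coord (j : 'I_2) (x : R * R) : R := if j == ord0 then x.1 else x.2.

Definition enorm (x : R * R) : R := Num.sqrt (x.1 ^+ 2 + x.2 ^+ 2).

Definition conv_hull (A : set (R * R)) : set (R * R) :=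
  smallest (@convex_set R (R * R)%type) A.

Definition posdefmx n (A : 'M[R]_n) : Prop :=
  A^T = A /\ forall v : 'rV[R]_n, v != 0 -> 0 < (v *m A *m v^T) ord0 ord0.

End plane.

Section empirical_likelihood.
Context {R : realType}.
Implicit Types (n : nat) (x : nat -> R * R) (mu : R * R) (Theta : set (R * R)).

(* The sample of size n is x 0, ..., x n.-1. *)
Definition EL_weights n x mu : set ('I_n -> R) :=
  [set p | [/\ forall i, 0 <= p i, \sum_(i < n) p i = 1 &
               \sum_(i < n) p i *: (x i - mu) = 0]].

(* The supremum is over a set bounded above (EL_has_ubound) and the library's
   real sup maps the empty set to 0 (sup0). *)
Definition EL n x mu : R :=
  sup [set \prod_(i < n) (n%:R * p i) | p in @EL_weights n x mu].

(* lne 0 = -oo, so that ell n x mu = +oo when EL n x mu = 0. *)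
Definition ell n x mu : \bar R := (- (2%:E * lne (EL n x mu)%:E))%E.

Definition EL_sup n x Theta : R := sup [set EL n x nu | nu in Theta].

Definition ell_constr Theta n x mu : \bar R :=
  if 0 < EL_sup n x Theta
  then (- (2%:E * lne (EL n x mu / EL_sup n x Theta)%:E))%E
  else 0%E.

Lemma EL_ub n x mu p : @EL_weights n x mu p ->
  \prod_(i < n) (n%:R * p i) <= n%:R ^+ n.
Proof.
move=> [p0 p1 _]; rewrite -[leRHS](_ : \prod_(i < n) n%:R = _); last first.
  by rewrite prodr_const card_ord.
apply: ler_prod => i _; rewrite mulr_ge0//= ler_piMr//.
by rewrite -p1 (bigD1 i)//= lerDl sumr_ge0.
Qed.

Lemma EL_has_ubound n x mu :
  has_ubound [set \prod_(i < n) (n%:R * p i) | p in @EL_weights n x mu].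
Proof. by exists (n%:R ^+ n) => _ [p /EL_ub ? <-]. Qed.

Lemma EL_ge0 n x mu : 0 <= EL n x mu.
Proof.
rewrite /EL; have [->|/set0P[y Ey]] := eqVneq
  [set \prod_(i < n) (n%:R * p i) | p in @EL_weights n x mu] set0; first by rewrite sup0.
apply: (@le_trans _ _ y); last first.
  by apply: ub_le_sup => //; exact: EL_has_ubound.
by case: Ey => p [p0 _ _] <-; apply: prodr_ge0 => i _; rewrite mulr_ge0.
Qed.

Lemma EL_le n x mu : EL n x mu <= n%:R ^+ n.
Proof.
rewrite /EL; have [->|/set0P Ene] := eqVneq
  [set \prod_(i < n) (n%:R * p i) | p in @EL_weights n x mu] set0.
  by rewrite sup0 exprn_ge0.
by apply: ge_sup => // _ [p /EL_ub ? <-].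
Qed.

Lemma EL_sup_has_ubound n x Theta : has_ubound [set EL n x nu | nu in Theta].
Proof. by exists (n%:R ^+ n) => _ [nu _ <-]; exact: EL_le. Qed.

Lemma ell_constrE Theta n x mu : 0 < EL_sup n x Theta ->
  ell_constr Theta n x mu =
  (ell n x mu - ereal_inf [set ell n x nu | nu in Theta])%E.
Proof.
set S := EL_sup n x Theta => S0.
have ellS nu : 0 < EL n x nu -> ell n x nu = (- (2 * ln (EL n x nu)))%:E.
  by move=> L0; rewrite /ell lne_EFin.
have ell0 nu : EL n x nu = 0 -> ell n x nu = +oo%E.
  by move=> L0; rewrite /ell L0 le0_lneNy// mulrNy gtr0_sg// mul1e.
have -> : ereal_inf [set ell n x nu | nu in Theta] = (- (2 * ln S))%:E.
  apply/eqP; rewrite eq_le; apply/andP; split; last first.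
    apply: le_ereal_inf_tmp => _ [nu Tnu <-].
    have := EL_ge0 n x nu; rewrite [X in is_true X -> _]le_eqVlt => /orP[/eqP/esym/ell0 ->|L0].
      by rewrite leey.
    rewrite ellS// lee_fin lerN2 ler_pM2l// ler_ln ?posrE//.
    by apply: ub_le_sup; [exact: EL_sup_has_ubound|exists nu].
  rewrite leNgt; apply/negP => Sinf.
  have [r Sr rinf] : exists2 r, - (2 * ln S) < r &
      (r%:E <= ereal_inf [set ell n x nu | nu in Theta])%E.
    move: Sinf; case: ereal_inf => [r|_|//]; first by exists r.
    by exists (- (2 * ln S) + 1); rewrite ?ltrDl// leey.
  have : expR (- r / 2) < S.
    rewrite -[ltRHS]lnK ?posrE// ltr_expR; lra.
  move=> /sup_gt[|_ [nu Tnu <-] rL].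
    apply/set0P; apply: contraTN S0 => /eqP Te.
    by rewrite /S /EL_sup Te sup0 ltxx.
  have L0 : 0 < EL n x nu by exact: lt_trans (expR_gt0 _) rL.
  have : (r%:E <= ell n x nu)%E.
    by apply: le_trans rinf _; apply: ereal_inf_lbound; exists nu.
  rewrite ellS// lee_fin leNgt => /negP; apply.
  have : - r / 2 < ln (EL n x nu) by rewrite -ltr_expR lnK ?posrE.
  lra.
rewrite /ell_constr -/S S0 -EFinN opprK.
have := EL_ge0 n x mu; rewrite [X in is_true X -> _]le_eqVlt => /orP[/eqP/esym L0|L0].
  by rewrite ell0// L0 mul0r le0_lneNy// mulrNy gtr0_sg// mul1e.
rewrite ellS// lne_EFin ?divr_gt0// ln_div ?posrE// -EFinM -EFinN -EFinD.
congr EFin; lra.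
Qed.

End empirical_likelihood.

Section probability.
Local Open Scope ereal_scope.
Context d d' (T : measurableType d) (T' : measurableType d') (R : realType).
Variable P : probability T R.

Definition mutually_independent (X : nat -> {RV P >-> T'}) : Prop :=
  forall (J : {fset nat}) (A : nat -> set T'), (forall i, measurable (A i)) ->
  P (\bigcap_(i in [set` J]) (X i @^-1` A i)) =
  \prod_(i <- J) P (X i @^-1` A i).

Definition identically_distributed (X : nat -> {RV P >-> T'}) : Prop :=
  forall i j A, measurable A -> distribution P (X i) A = distribution P (X j) A.

(* Convergence of the cdfs at every continuity point of the limit cdf.  The
   Y n may take infinite values. *)
Definition cvg_in_distribution (Y : nat -> T -> \bar R)
    (Q : {measure set R -> \bar R}) : Prop :=
  forall t : R, {for t, continuous (fun s : R => Q `]-oo, s]%classic)} ->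
  P [set w | Y n w <= t%:E] @[n --> \oo] --> Q `]-oo, t]%classic.

Definition covariance_mx (X : {RV P >-> (R * R)%type}) : 'M[R]_2 :=
  \matrix_(i, j) fine (covariance P (coord i \o X) (coord j \o X)).

End probability.

Section chi_square.
Context {R : realType}.

(* The library's normal distribution lives on measurableTypeR R, which is R with
   a differently displayed copy of the same sigma-algebra. *)
Definition add_sqr (z : measurableTypeR R * R) : R := (z.1 : R) ^+ 2 + z.2.

Lemma measurable_add_sqr : measurable_fun setT add_sqr.
Proof.
apply: measurable_funD; last exact: measurable_snd.
by apply: measurable_funX; exact: measurable_fst.
Qed.

HB.instance Definition _ :=
  isMeasurableFun.Build _ _ _ _ add_sqr measurable_add_sqr.

(* The law of the sum of the squares of k independent standard normals. *)
Fixpoint chi2 (k : nat) : probability R R :=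
  if k is k'.+1
  then distribution (normal_prob 0 1 \x chi2 k')%E add_sqr
  else dirac (0 : R).

Definition chi2bar12 : set R -> \bar R :=
  measure_add (mscale (2^-1)%:nng (chi2 1)) (mscale (2^-1)%:nng (chi2 2)).

HB.instance Definition _ := Measure.on chi2bar12.

Lemma chi2bar12E A : chi2bar12 A = (2^-1%:E * chi2 1 A + 2^-1%:E * chi2 2 A)%E.
Proof. by rewrite /chi2bar12 measure_addE. Qed.

Lemma chi2bar12_setT : chi2bar12 setT = 1%E.
Proof.
by rewrite chi2bar12E !probability_setT !mule1 -EFinD -[X in X + X]mul1r -splitr.
Qed.

HB.instance Definition _ :=
  Measure_isProbability.Build _ _ _ chi2bar12 chi2bar12_setT.

End chi_square.

(* Main.v *)
(* In coordinates that standardize the observations and whose first axis is normal to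
   the boundary of Theta, let Z = (Z1, Z2) be the normalized sum of the sample.  Off an
   event of small probability, a Lagrangian upper bound and explicit weights as lower
   bound show that - 2 log of the likelihood is |Z|^2 + o(1) at mu0 and
   min(Z1, 0)^2 + o(1) for the supremum over Theta, so that the statistic is
   max(Z1, 0)^2 + Z2^2 + o(1).  For a standard normal Z, the symmetry in Z1 identifies
   the law of max(Z1, 0)^2 + Z2^2 as the mixture of chi-squares.  The convergence in
   law of max(Z1, 0)^2 + Z2^2 is obtained from that of its Laplace transform, by
   approximating indicator functions by polynomials in an exponential; the Laplace
   transform is the mean of a product of functions of Z1 and Z2 which, once smoothed,
   is handled by Lindeberg's replacement method. *)
Require Import Defs.
From HB Require Import structures.
From mathcomp Require Import all_boot all_order all_algebra finmap.
From mathcomp Require Import all_classical all_reals all_analysis.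
From mathcomp Require Import measurable_realfun ring lra.

Set Implicit Arguments.
Unset Strict Implicit.
Unset Printing Implicit Defensive.

Import Order.TTheory GRing.Theory Num.Theory.
Import numFieldNormedType.Exports.

Local Open Scope classical_set_scope.
Local Open Scope ring_scope.

(** * Convolution operators and sums of independent vectors *)

Section convolution.
Context {R : realType}.
Local Open Scope ereal_scope.
Implicit Types (mu nu : probability (R * R)%type R) (g h : R * R -> \bar R).

(** Squares of the observations have only a moment of order 3/2, so Chebyshev's inequality does not
    give the law of large numbers for the Gram matrix of the sample; the drift of a smooth convex
    surrogate of the absolute value takes its place. The replacement method, tightness and this law
    of large numbers share one device: the law of a summand acts as an operator on nonnegative
    measurable functions, where Tonelli's theorem needs no integrability, and a one-step inequality
    valid at every starting point is iterated n times. For the likelihood, the upper and the lower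
    bound are built from the same vector y: the sum Z itself at mu0, and for Theta the shortest y
    such that Z - y lies in the half-plane. Membership of the weighted mean in Theta is a single
    linear inequality on the weights, so the supremum over Theta is one program in the weights.
    Probabilities are compared on measurable events only; since the suprema range over uncountable
    sets, measurability of the statistic rests on compactness of the set of weights. *)

Definition convol mu g : R * R -> \bar R := fun x => \int[mu]_y g (x + y)%R.

Lemma measurable_plane_add :
  measurable_fun [set: (R * R) * (R * R)] (fun z => z.1 + z.2)%R.
Proof.
apply/measurable_fun_pairP; split => /=.
- apply: measurable_funD; apply: measurableT_comp => //.
- apply: measurable_funD; apply: measurableT_comp => //.
Qed.

Lemma measurable_plane_translate (x : R * R) :
  measurable_fun [set: R * R] (fun y => x + y)%R.
Proof.
apply/measurable_fun_pairP; split => /=; exact: measurable_funD.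
Qed.

Let measurable_shift g : measurable_fun setT g ->
  measurable_fun setT (fun z : (R * R) * (R * R) => g (z.1 + z.2)%R).
Proof. by move=> mg; apply: measurableT_comp => //; exact: measurable_plane_add. Qed.

Lemma convol_ge0 mu g : (forall x, 0 <= g x) -> forall x, 0 <= convol mu g x.
Proof. by move=> g0 x; exact: integral_ge0. Qed.

Lemma measurable_convol mu g : measurable_fun setT g -> (forall x, 0 <= g x) ->
  measurable_fun setT (convol mu g).
Proof.
move=> mg g0.
exact: (measurable_fun_fubini_tonelli_F
  (fun z : (R * R) * (R * R) => g (z.1 + z.2)%R) (measurable_shift mg)).
Qed.

Lemma convol_le mu g h : measurable_fun setT g -> measurable_fun setT h ->
  (forall x, 0 <= g x) -> (forall x, g x <= h x) ->
  forall x, convol mu g x <= convol mu h x.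
Proof.
move=> mg mh g0 gh x; apply: ge0_le_integral => //.
- by apply: measurableT_comp => //; exact: measurable_plane_translate.
- by apply: measurableT_comp => //; exact: measurable_plane_translate.
Qed.

Lemma convolD_cst mu g (k : R) : measurable_fun setT g -> (forall x, 0 <= g x) ->
  (0 <= k)%R -> forall x, convol mu (fun x => g x + k%:E) x = convol mu g x + k%:E.
Proof.
move=> mg g0 k0 x; rewrite /convol ge0_integralD//; first last.
  by apply: measurableT_comp => //; exact: measurable_plane_translate.
by rewrite integral_cst// [X in _ * X]probability_setT mule1.
Qed.

(** Tonelli's theorem and commutativity of addition. The replacement method rests on it. *)
Lemma convolC mu nu g : measurable_fun setT g -> (forall x, 0 <= g x) ->
  convol mu (convol nu g) = convol nu (convol mu g).
Proof.
move=> mg g0; apply/funext => x; rewrite /convol.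
pose F (z : (R * R) * (R * R)) := g (x + z.1 + z.2)%R.
rewrite (fubini_tonelli F); first last.
  by move=> z; exact: g0.
  apply: (measurableT_comp mg).
  rewrite [X in measurable_fun _ X](_ : _ =
  (fun y => x + y)%R \o (fun z : (R * R) * (R * R) => z.1 + z.2)%R); last first.
  by apply/funext => z/=; rewrite addrA.
  apply: measurableT_comp; first exact: measurable_plane_translate.
  exact: measurable_plane_add.
by apply: eq_integral => y _; apply: eq_integral => z _; rewrite /F/= addrAC.
Qed.

Lemma measurable_iter_convol mu g k : measurable_fun setT g ->
  (forall x, 0 <= g x) ->
  measurable_fun setT (iter k (convol mu) g) /\
  (forall x, 0 <= iter k (convol mu) g x).
Proof.
move=> mg g0; elim: k => [//|k [mk k0]]; rewrite iterS.
by split; [exact: measurable_convol|exact: convol_ge0].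
Qed.

(** The operator of a probability measure leaves constants unchanged, so the one-step drifts add up.
    It yields bounds on the mean of g at a sum from the value of g at the start. *)
Lemma iter_convol_le mu g (k : R) n : measurable_fun setT g ->
  (forall x, 0 <= g x) -> (0 <= k)%R ->
  (forall x, convol mu g x <= g x + k%:E) ->
  forall x, iter n (convol mu) g x <= g x + (n%:R * k)%:E.
Proof.
move=> mg g0 k0 gk; elim: n => [|n IH] x; first by rewrite /= mul0r adde0.
rewrite iterS; have [mn n0] := measurable_iter_convol mu n mg g0.
have nk0 : (0 <= n%:R * k)%R by rewrite mulr_ge0.
apply: (le_trans (convol_le _ mn _ n0 IH x)); first exact: emeasurable_funD.
rewrite convolD_cst//; apply: (le_trans (leeD2r _ (gk x))).
by rewrite -addeA -EFinD mulr_natl -mulrS mulr_natl.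
Qed.

(* The operators of mu and nu commute, so replacing mu by nu one step at a time
   accumulates the one-step error. *)
Lemma iter_convol_swap mu nu g (k : R) n : measurable_fun setT g ->
  (forall x, 0 <= g x) -> (0 <= k)%R ->
  (forall x, convol mu g x <= convol nu g x + k%:E) ->
  forall x, iter n (convol mu) g x <= iter n (convol nu) g x + (n%:R * k)%:E.
Proof.
move=> mg g0 k0 gk; elim: n => [|n IH] x; first by rewrite /= mul0r adde0.
have [mn n0] := measurable_iter_convol mu n mg g0.
have [nn nn0] := measurable_iter_convol nu n mg g0.
have nk0 : (0 <= n%:R * k)%R by rewrite mulr_ge0.
rewrite iterS; apply: (le_trans (convol_le _ mn _ n0 IH x)).
  exact: emeasurable_funD.
rewrite convolD_cst//.
have -> : convol mu (iter n (convol nu) g) = iter n (convol nu) (convol mu g).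
  elim: (n) => [//|j IHj]; rewrite !iterS convolC ?IHj//;
    by have [] := measurable_iter_convol nu j mg g0.
have : iter n (convol nu) (convol mu g) x <= iter n (convol nu) (convol nu g) x + k%:E.
  have [mm mm0] : measurable_fun setT (convol mu g) /\ (forall x, 0 <= convol mu g x).
    by split; [exact: measurable_convol|exact: convol_ge0].
  have [mv mv0] : measurable_fun setT (convol nu g) /\ (forall x, 0 <= convol nu g x).
    by split; [exact: measurable_convol|exact: convol_ge0].
  elim: (n) x => [|j IHj] x; first exact: gk.
  rewrite !iterS.
  have [mj j0] := measurable_iter_convol nu j mm mm0.
  have [mj' j0'] := measurable_iter_convol nu j mv mv0.
  apply: (le_trans (convol_le _ mj _ j0 IHj x)); first exact: emeasurable_funD.
  by rewrite convolD_cst.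
move=> /(leeD2r (n%:R * k)%:E) /le_trans; apply.
by rewrite -iterSr iterS -addeA -EFinD mulr_natl -mulrS mulr_natl.
Qed.

End convolution.

Section mfun_of.
Context d d' {T : measurableType d} {T' : measurableType d'} {f : T -> T'}.

Definition mfun_of (mf : measurable_fun setT f) : {mfun T >-> T'} :=
  mfun_Sub (mem_set mf : f \in mfun).

End mfun_of.

Section iid_comp.
Context d d1 d2 (T : measurableType d) (T1 : measurableType d1)
  (T2 : measurableType d2) (R : realType) (P : probability T R).
Variables (X : nat -> {RV P >-> T1}) (G : T1 -> T2).
Hypothesis mG : measurable_fun setT G.

Definition comp_rv i : {RV P >-> T2} :=
  mfun_of (measurableT_comp mG (measurable_funPT (X i))).

Lemma mutually_independent_comp :
  mutually_independent X -> mutually_independent comp_rv.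
Proof.
move=> iX J A mA; apply: (iX J (fun i => G @^-1` A i)) => i.
by rewrite -[X in measurable X]setTI; exact: mG.
Qed.

Lemma identically_distributed_comp :
  identically_distributed X -> identically_distributed comp_rv.
Proof.
move=> iX i j A mA; apply: (iX i j (G @^-1` A)).
by rewrite -[X in measurable X]setTI; exact: mG.
Qed.

End iid_comp.

Section iid_sum.
Local Open Scope ereal_scope.
Context d (T : measurableType d) (R : realType) (P : probability T R).
Variable Y : nat -> {RV P >-> (R * R)%type}.
Hypothesis iY : mutually_independent Y.
Hypothesis dY : identically_distributed Y.

Definition rv_sum n (w : T) : R * R := (\sum_(i < n) Y i w)%R.

Lemma rv_sumS n w : rv_sum n.+1 w = (rv_sum n w + Y n w)%R.
Proof. by rewrite /rv_sum big_ord_recr. Qed.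

Lemma measurable_rv_sum n : measurable_fun setT (rv_sum n).
Proof.
elim: n => [|n IH].
  by rewrite (_ : rv_sum 0 = cst 0%R)//; apply/funext => w; rewrite /rv_sum big_ord0.
rewrite (_ : rv_sum n.+1 =
    (fun z => z.1 + z.2)%R \o (fun w => (rv_sum n w, Y n w))); last first.
  by apply/funext => w; rewrite rv_sumS.
apply: measurableT_comp; first exact: measurable_plane_add.
by apply: measurable_fun_pair => //; exact: measurable_funPT.
Qed.

Definition indep_event (J : {fset nat}) (A : nat -> set (R * R)) : set T :=
  \bigcap_(i in [set` J]) (Y i @^-1` A i).

Lemma measurable_indep_event J A : (forall i, measurable (A i)) ->
  measurable (indep_event J A).
Proof.
move=> mA; apply: fin_bigcap_measurable => [|i _]; first exact: finite_fset.
by rewrite -[X in measurable X]setTI; exact: measurable_funPT.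
Qed.

Let joint_mfun n : {mfun T >-> ((R * R) * (R * R))%type} :=
  mfun_of (measurable_fun_pair (measurable_rv_sum n) (measurable_funPT (Y n))).

Let sum_mfun n : {mfun T >-> (R * R)%type} := mfun_of (measurable_rv_sum n).

(** The induction carries arbitrary finite families of later indices, because adding [Y n] to the
    sum takes the index [n] out of the family. *)
Let indep_sum_upto n := forall (B : set (R * R)) (J : {fset nat}) A,
  measurable B -> (forall i, measurable (A i)) ->
  (forall i, i \in J -> (n <= i)%N) ->
  P ((rv_sum n @^-1` B) `&` indep_event J A) =
  P (rv_sum n @^-1` B) * P (indep_event J A).

(** On rectangles the event on [Y n] can be moved into the indexed family, where the hypothesis
    applies; uniqueness of the product measure then covers all measurable sets. *)
Let indep_joint n : indep_sum_upto n ->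
  forall (C : set ((R * R) * (R * R))) (J : {fset nat}) A,
  measurable C -> (forall i, measurable (A i)) ->
  (forall i, i \in J -> (n < i)%N) ->
  P ((joint_mfun n @^-1` C) `&` indep_event J A) =
    P (joint_mfun n @^-1` C) * P (indep_event J A) /\
  P (joint_mfun n @^-1` C) =
    (distribution P (sum_mfun n) \x distribution P (Y n)) C.
Proof.
move=> In C J A mC mA nJ.
have IY B J' A' : measurable B -> (forall i, measurable (A' i)) ->
    (forall i, i \in J' -> (n < i)%N) ->
    P (Y n @^-1` B `&` indep_event J' A') =
    P (Y n @^-1` B) * P (indep_event J' A').
  move=> mB mA' nJ'; have nJn : n \notin J'.
    by apply/negP => /nJ'; rewrite ltnn.
  pose A1 i := if i == n then B else A' i.
  have mA1 i : measurable (A1 i) by rewrite /A1; case: ifP.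
  have JA1 : indep_event J' A' = indep_event J' A1.
    apply: eq_bigcapr => i /= iJ; rewrite /A1 ifN//.
    by apply: contraNN nJn => /eqP <-.
  rewrite JA1 /indep_event iY//.
  transitivity (P (\bigcap_(i in [set` (n |` J')%fset]) (Y i @^-1` A1 i))).
    congr (P _); rewrite set_fsetU set_fset1 bigcap_setU bigcap_set1.
    by rewrite /A1 eqxx.
  by rewrite iY// big_fsetU1//= /A1 eqxx.
have rect J' A' : (forall i, measurable (A' i)) ->
    (forall i, i \in J' -> (n < i)%N) ->
    forall B1 B2, measurable B1 -> measurable B2 ->
    P ((joint_mfun n @^-1` (B1 `*` B2)) `&` indep_event J' A') =
    P (rv_sum n @^-1` B1) * (P (Y n @^-1` B2) * P (indep_event J' A')).
  move=> mA' nJ' B1 B2 mB1 mB2; rewrite -IY//.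
  have nJn : n \notin J' by apply/negP => /nJ'; rewrite ltnn.
  pose A1 i := if i == n then B2 else A' i.
  have mA1 i : measurable (A1 i) by rewrite /A1; case: ifP.
  have E : Y n @^-1` B2 `&` indep_event J' A' = indep_event (n |` J')%fset A1.
    rewrite /indep_event set_fsetU set_fset1 bigcap_setU bigcap_set1.
    rewrite /A1 eqxx; congr (_ `&` _); apply: eq_bigcapr => i /= iJ; rewrite ifN//.
    by apply: contraNN nJn => /eqP <-.
  rewrite E -In//; last first.
    by move=> i; rewrite !inE => /orP[/eqP->//|/nJ'/ltnW].
  by rewrite -E setIA; congr (P (_ `&` _)).
have mH : measurable (indep_event J A) by exact: measurable_indep_event.
have e0 : indep_event fset0 A = setT.
  by rewrite /indep_event set_fset0 bigcap_set0.
have rect0 B1 B2 : measurable B1 -> measurable B2 ->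
    P (joint_mfun n @^-1` (B1 `*` B2)) =
    P (rv_sum n @^-1` B1) * P (Y n @^-1` B2).
  move=> mB1 mB2; have := @rect fset0 A mA _ _ _ mB1 mB2.
  rewrite e0 setIT probability_setT mule1; apply => i.
  by rewrite inE.
(* [m1] restricts the joint law to [indep_event J A], and [m2] scales it by the probability of that
   event. Both take the same product values on rectangles, hence agree. Scaling instead of
   conditioning allows this probability to be zero. *)
have pfin : P (indep_event J A) \is a fin_num by exact: fin_num_measure.
pose p : {nonneg R} := NngNum (fine_ge0 (measure_ge0 P (indep_event J A))).
have pE : (p%:num)%:E = P (indep_event J A) by rewrite /= fineK.
pose m1_of := [the {measure set _ -> \bar R} of
  pushforward (mrestr P mH) (joint_mfun n)].
pose m1 := m1_of (measurable_funPT (joint_mfun n)).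
have m1E B1 B2 : measurable B1 -> measurable B2 -> m1 (B1 `*` B2) =
    distribution P (sum_mfun n) B1 * mscale p (distribution P (Y n)) B2.
  move=> mB1 mB2; rewrite /m1 /m1_of/= /pushforward /mrestr rect// /mscale pE.
  by congr (_ * _); exact: muleC.
pose m2 := [the {measure set _ -> \bar R} of
  mscale p (distribution P (joint_mfun n))].
have m2E B1 B2 : measurable B1 -> measurable B2 -> m2 (B1 `*` B2) =
    distribution P (sum_mfun n) B1 * mscale p (distribution P (Y n)) B2.
  move=> mB1 mB2.
  transitivity ((p%:num)%:E * P (joint_mfun n @^-1` (B1 `*` B2))); first by [].
  by rewrite rect0// muleCA.
split; last first.
  exact/esym/(product_measure_unique (m' := distribution P (joint_mfun n))).
have := product_measure_unique m1E mC.
rewrite (product_measure_unique m2E mC) => E.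
transitivity (m1 C); first by [].
rewrite -E; transitivity ((p%:num)%:E * P (joint_mfun n @^-1` C)); first by [].
by rewrite pE muleC.
Qed.

Let indep_sumP n : indep_sum_upto n.
Proof.
elim: n => [|n IH] B J A mB mA nJ.
  rewrite (_ : rv_sum 0 = cst 0%R); last first.
    by apply/funext => w; rewrite /rv_sum big_ord0.
  rewrite preimage_cst; case: ifPn => _.
    by rewrite setTI probability_setT mul1e.
  by rewrite set0I measure0 mul0e.
pose C := [set z : (R * R) * (R * R) | B (z.1 + z.2)%R].
have mC : measurable C.
  by rewrite -[X in measurable X]setTI; exact: measurable_plane_add.
have -> : rv_sum n.+1 @^-1` B = joint_mfun n @^-1` C.
  by apply/seteqP; split => w; rewrite /= rv_sumS.
by have [-> _] := indep_joint IH mC mA nJ.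
Qed.

(** Independence and Tonelli integrate out the last summand, whose law is that of [Y 0]. The
    induction hypothesis is then applied to the smoothed function, which is why [h] varies in the
    induction. *)
Lemma integral_rv_sum n (h : R * R -> \bar R) x : measurable_fun setT h ->
  (forall x, 0 <= h x) ->
  \int[P]_w h (x + rv_sum n w)%R = iter n (convol (distribution P (Y 0%N))) h x.
Proof.
elim: n h => [h mh h0|n IH h mh h0].
  rewrite /= (eq_integral (cst (h x))) => [|w _].
    by rewrite integral_cst// [X in _ * X]probability_setT mule1.
  by rewrite /rv_sum big_ord0 addr0.
rewrite iterSr -IH; [|exact: measurable_convol|exact: convol_ge0].
have mhx : measurable_fun setT (fun z : (R * R) * (R * R) => h (x + z.1 + z.2)%R).
  apply: (measurableT_comp mh).
  rewrite [X in measurable_fun _ X](_ : _ =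
      (fun y => x + y)%R \o (fun z : (R * R) * (R * R) => z.1 + z.2)%R); last first.
    by apply/funext => z/=; rewrite addrA.
  apply: measurableT_comp; first exact: measurable_plane_translate.
  exact: measurable_plane_add.
transitivity (\int[P]_w (fun z => h (x + z.1 + z.2)%R) (joint_mfun n w)).
  by apply: eq_integral => w _; rewrite rv_sumS/= addrA.
rewrite -(ge0_integral_distribution _ mhx)//.
transitivity (\int[distribution P (sum_mfun n) \x distribution P (Y n)]_z
    h (x + z.1 + z.2)%R).
  apply: eq_measure_integral => C mC _.
  have nJ i : i \in (fset0 : {fset nat}) -> (n < i)%N by rewrite inE.
  have mA : forall i : nat, measurable ((fun=> setT) i : set (R * R)).
    by move=> i; exact: measurableT.
  by have [_ E] := indep_joint (@indep_sumP n) mC mA nJ.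
rewrite (fubini_tonelli1 _ mhx)//.
set F := fubini_F _ _; have F0 y : 0 <= F y by exact: integral_ge0.
have mF : measurable_fun setT F by exact: measurable_fun_fubini_tonelli_F.
transitivity (\int[P]_w F (rv_sum n w)).
  exact: (ge0_integral_distribution (sum_mfun n) mF F0).
apply: eq_integral => w _; rewrite /F /fubini_F/= /convol.
apply: eq_measure_integral => A mA _.
exact: dY.
Qed.

End iid_sum.

(** * Normal distribution *)

Section integral_density.
Local Open Scope ereal_scope.
Import HBNNSimple.

(** Indicator functions, then simple functions by linearity, then monotone convergence. *)
Lemma ge0_integral_density d (T : measurableType d) (R : realType)
    (mu nu : {measure set T -> \bar R}) (phi : T -> R) (g : T -> \bar R) :
  measurable_fun setT phi -> (forall x, 0 <= phi x)%R ->
  (forall A, measurable A -> nu A = \int[mu]_(x in A) (phi x)%:E) ->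
  measurable_fun setT g -> (forall x, 0 <= g x) ->
  \int[nu]_x g x = \int[mu]_x (g x * (phi x)%:E).
Proof.
move=> mphi phi0 nuE mg g0.
pose h := nnsfun_approx measurableT mg.
have gE x : g x = limn (fun n => (h n x)%:E).
  by apply/esym/cvg_lim => //; exact: cvg_nnsfun_approx.
have mphiE : measurable_fun setT (fun x => (phi x)%:E) by exact/measurable_EFinP.
have step n : \int[nu]_x (h n x)%:E = \int[mu]_x ((h n x)%:E * (phi x)%:E).
  have indE r x : (h n @^-1` [set r]) x -> h n x = r by [].
  transitivity (\int[nu]_x
      (\sum_(y \in range (h n)) (y * \1_(h n @^-1` [set y]) x)%:E)).
    by apply: eq_integral => t _; rewrite fimfunE -fsumEFin.
  rewrite ge0_integral_fsum//; last 2 first.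
  - by move=> y; exact/measurable_EFinP/measurable_funM.
  - by move=> y x _; exact: nnfun_muleindic_ge0.
  transitivity (\int[mu]_x (\sum_(y \in range (h n))
      (y * \1_(h n @^-1` [set y]) x)%:E * (phi x)%:E)); last first.
    apply: eq_integral => x _; rewrite -ge0_mule_fsuml => [|y]; last first.
      exact: nnfun_muleindic_ge0.
    by rewrite fsumEFin// -fimfunE.
  rewrite ge0_integral_fsum//; last 2 first.
  - by move=> y; apply: emeasurable_funM => //; exact/measurable_EFinP/measurable_funM.
  - by move=> y x _; rewrite mule_ge0 ?lee_fin//; exact: nnfun_muleindic_ge0.
  apply: eq_fsbigr => r /[!inE]/= -[x0 _ <-].
  have mA : measurable (h n @^-1` [set h n x0]) by exact: measurable_sfunP.
  rewrite integralZl_indic_nnsfun// integral_indic// setIT nuE//.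
  rewrite -ge0_integralZl//; first last.
  - by rewrite lee_fin.
  - by move=> x _; rewrite lee_fin.
  - exact: measurable_funTS.
  rewrite integral_mkcond; apply: eq_integral => x _.
  rewrite /patch indicE; case: ifPn => _; first by rewrite mulr1.
  by rewrite mulr0 [RHS]mul0e.
transitivity (limn (fun n => \int[nu]_x (h n x)%:E)).
  rewrite -monotone_convergence//.
  - by apply: eq_integral => x _.
  - by move=> n; exact/measurable_EFinP.
  - by move=> n x _; rewrite lee_fin.
  - by move=> x _ a b ab; rewrite lee_fin; exact/lefP/nd_nnsfun_approx.
transitivity (limn (fun n => \int[mu]_x ((h n x)%:E * (phi x)%:E))).
  by congr (limn _); apply/funext.
rewrite -monotone_convergence//.
- apply: eq_integral => x _; apply/cvg_lim => //; apply: cvgeZr => //.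
  exact: cvg_nnsfun_approx.
- by move=> n; apply: emeasurable_funM => //; exact/measurable_EFinP.
- by move=> n x _; rewrite mule_ge0// lee_fin.
- move=> x _ a b ab; apply: lee_wpmul2r; rewrite lee_fin//.
  exact/lefP/nd_nnsfun_approx.
Qed.

End integral_density.

Section lebesgue_affine.
Local Open Scope ereal_scope.
Context {R : realType}.
Local Notation lambda := (@lebesgue_measure R).

(** The image of Lebesgue measure under x |-> a x + b, scaled by a, has the right value on half-open
    intervals, and these determine the measure. *)
Lemma ge0_integral_lebesgue_affine (a b : R) (g : R -> \bar R) : (0 < a)%R ->
  measurable_fun setT g -> (forall x, 0 <= g x) ->
  \int[lambda]_x g x = a%:E * \int[lambda]_x g (a * x + b)%R.
Proof.
move=> a0 mg g0.
pose f : measurableTypeR R -> measurableTypeR R := fun x => (a * x + b)%R.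
have mf : measurable_fun setT f.
  by apply: measurable_funD => //; exact: measurable_funM.
pose an : {nonneg R} := NngNum (ltW a0).
pose m0_of := [the {measure set _ -> \bar R} of pushforward lambda f].
pose m0 := m0_of mf.
pose m1 := [the {measure set _ -> \bar R} of mscale an m0].
have lE A : measurable A -> lambda A = m1 A.
  apply: lebesgue_measure_unique => _ [[x y]] _ <-.
  transitivity (a%:E * lambda `]((x - b) / a)%R, ((y - b) / a)%R]%classic); last first.
    congr (_ * lambda _); apply/seteqP; rewrite /f.
    by split=> z /=; rewrite !in_itv/= ltr_pdivrMr// ler_pdivlMr//
      ltrBlDr lerBrDr mulrC.
  rewrite !lebesgue_measure_itv/= !lte_fin ltr_pM2r ?invr_gt0// ltrD2r.
  case: ifPn => _; last by rewrite mule0.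
  by rewrite -!EFinB -EFinM; congr EFin; field; rewrite gt_eqF.
transitivity (\int[m1]_x g x); first by apply: eq_measure_integral => A mA _; exact: lE.
rewrite ge0_integral_mscale//; congr (_ * _).
by rewrite ge0_integral_pushforward.
Qed.

Lemma ge0_integral_lebesgueN (g : R -> \bar R) :
  measurable_fun setT g -> (forall x, 0 <= g x) ->
  \int[lambda]_x g (- x)%R = \int[lambda]_x g x.
Proof.
move=> mg g0; have mN : measurable_fun setT (-%R : measurableTypeR R -> measurableTypeR R).
  by [].
transitivity (\int[pushforward lambda (-%R : _ -> measurableTypeR R)]_x g x).
  by rewrite ge0_integral_pushforward.
by apply: eq_measure_integral => A mA _; exact: lebesgue_measureN.
Qed.

End lebesgue_affine.

Section gauss.
Local Open Scope ereal_scope.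
Context {R : realType}.
Local Notation lambda := (@lebesgue_measure R).
Local Notation phi := (normal_pdf (0 : R) 1).

Lemma normal_pdf01E (x : R) : (phi x = normal_peak 1 * expR (- (x ^+ 2 / 2)))%R.
Proof. by rewrite normal_pdfE ?oner_neq0// /normal_fun subr0 expr1n mulNr. Qed.

Lemma measurable_phi : measurable_fun [set: R] phi.
Proof. exact: measurable_normal_pdf. Qed.
Hint Resolve measurable_phi : core.

Lemma normal_pdf01N (x : R) : (phi (- x) = phi x)%R.
Proof. by rewrite !normal_pdf01E sqrrN. Qed.

Let id_mfun : {mfun measurableTypeR R >-> R} :=
  mfun_of (@measurable_id _ _ setT : measurable_fun setT (id : measurableTypeR R -> R)).

(** The standard normal law transported by the identity to [R] with its usual display, so that it
    can enter product measures on [R * R]. *)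
Definition gauss : probability R R := distribution (normal_prob 0 1) id_mfun.

Lemma ge0_integral_normal01 (g : R -> \bar R) :
  measurable_fun setT g -> (forall x, 0 <= g x) ->
  \int[normal_prob 0 1]_x g x = \int[lambda]_x (g x * (phi x)%:E).
Proof.
move=> mg g0; apply: (ge0_integral_density (mu := lambda)) => // x.
exact: normal_pdf_ge0.
Qed.

Lemma ge0_integral_gauss_normal (g : R -> \bar R) :
  measurable_fun setT g -> (forall x, 0 <= g x) ->
  \int[gauss]_x g x = \int[normal_prob 0 1]_x g x.
Proof.
by move=> mg g0; rewrite (@ge0_integral_distribution _ _ _ _ _ _ id_mfun).
Qed.

Lemma ge0_integral_gauss (g : R -> \bar R) :
  measurable_fun setT g -> (forall x, 0 <= g x) ->
  \int[gauss]_x g x = \int[lambda]_x (g x * (phi x)%:E).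
Proof. by move=> mg g0; rewrite ge0_integral_gauss_normal// ge0_integral_normal01. Qed.

Lemma ge0_integral_gaussN (g : R -> \bar R) :
  measurable_fun setT g -> (forall x, 0 <= g x) ->
  \int[gauss]_x g (- x)%R = \int[gauss]_x g x.
Proof.
move=> mg g0; have mgN : measurable_fun setT (g \o -%R : R -> \bar R).
  by apply: measurableT_comp.
rewrite !ge0_integral_gauss// -[RHS]ge0_integral_lebesgueN.
- by apply: eq_integral => x _; rewrite normal_pdf01N.
- by apply: emeasurable_funM => //; exact/measurable_EFinP.
- by move=> x; rewrite mule_ge0// lee_fin normal_pdf_ge0.
Qed.

(* Rotating (x, y) by the angle with cosine a/c and sine b/c preserves the
   standard normal density of the plane and sends a x + b y to c z. *)
Lemma ge0_integral_gaussD (a b c : R) (g : R -> \bar R) :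
  (0 < a)%R -> (0 < b)%R -> (0 < c)%R -> (c ^+ 2 = a ^+ 2 + b ^+ 2)%R ->
  measurable_fun setT g -> (forall x, 0 <= g x) ->
  \int[gauss]_x \int[gauss]_y g (a * x + b * y)%R = \int[gauss]_z g (c * z)%R.
Proof.
move=> a0 b0 c0 abc mg g0.
have phi0 x : 0 <= (phi x)%:E by rewrite lee_fin normal_pdf_ge0.
have mphiE : measurable_fun setT (fun x => (phi x)%:E) by exact/measurable_EFinP.
have maff u v : measurable_fun [set: R] (fun x : R => u * x + v)%R.
  by apply: measurable_funD => //; exact: measurable_funM.
have mphiaff u v : measurable_fun [set: R] (fun x : R => phi (u * x + v)%R).
  exact: (measurableT_comp measurable_phi (maff u v)).
have mlin2 u v : measurable_fun [set: R * R] (fun z : R * R => u * z.1 + v * z.2)%R.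
  by apply: measurable_funD; apply: measurable_funM.
(* For fixed x, the variable y is replaced by z with a x + b y = c z; [k z x] is the joint density
   of (z, x). *)
pose k z x := ((c / b * phi (c / b * z - a / b * x)) * phi x)%R.
have inner x : \int[gauss]_y g (a * x + b * y)%R * (phi x)%:E =
    \int[lambda]_z (g (c * z)%R * (k z x)%:E).
  have mgx : measurable_fun setT (fun y => g (a * x + b * y)%R).
    apply: measurableT_comp => //; rewrite (_ : (fun y => _) = (fun y => b * y + a * x)%R)//.
    by apply/funext => y; rewrite addrC.
  pose h y := (g (a * x + b * y)%R * (phi y)%:E).
  have mh : measurable_fun setT h by apply: emeasurable_funM.
  have h0 y : 0 <= h y by rewrite mule_ge0.
  have mhz : measurable_fun [set: R] (fun z => h (c / b * z - a / b * x)%R).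
    exact: (measurableT_comp mh (maff _ _)).
  have cb0 : 0 <= (c / b)%:E by rewrite lee_fin divr_ge0// ltW.
  rewrite ge0_integral_gauss// (@ge0_integral_lebesgue_affine _ (c / b) (- (a / b * x)) h)//; last first.
    by rewrite divr_gt0.
  rewrite -ge0_integralZl//.
  rewrite -ge0_integralZr//; last 2 first.
  - exact: measurable_funeM.
  - by move=> z _; rewrite mule_ge0.
  apply: eq_integral => z _; rewrite /k /h.
  rewrite (_ : a * x + b * (c / b * z - a / b * x) = c * z)%R; last first.
    by field; rewrite gt_eqF.
  set q := (c / b)%R; set r := phi _; set t := phi x.
  by rewrite (EFinM (q * r)) (EFinM q) -!muleA [LHS]muleCA.
pose F (xz : measurableTypeR R * measurableTypeR R) := g (c * xz.2)%R * (k xz.2 xz.1)%:E.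
have mF : measurable_fun setT F.
  apply: emeasurable_funM.
    by apply: (measurableT_comp mg); exact: measurable_funM.
  apply/measurable_EFinP; apply: measurable_funM.
    apply: measurable_funM => //; apply: measurableT_comp => //.
    rewrite (_ : (fun _ => _) =
      (fun z : measurableTypeR R * measurableTypeR R => - (a / b) * (z.1 : R) + (c / b) * z.2)%R).
      by apply: measurable_funD; apply: measurable_funM.
    by apply/funext => z; rewrite addrC mulNr.
  by apply: measurableT_comp.
have k0 z x : (0 <= k z x)%R.
  by rewrite !mulr_ge0 ?invr_ge0 ?normal_pdf_ge0// ltW.
have F0 z : 0 <= F z by rewrite mule_ge0// lee_fin.
(* Completing the square: since c^2 = a^2 + b^2, (c z - a x)^2 / b^2 + x^2 = z^2 + (c x - a z)^2 /
   b^2, so the marginal density of z is standard normal. *)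
have kint z : \int[lambda]_x (k z x)%:E = (phi z)%:E.
  have kE x : k z x = (phi z * (c / b * phi (c / b * x + - (a / b * z))))%R.
    rewrite /k !normal_pdf01E; set p := normal_peak 1.
    set e1 := expR _; set e2 := expR _; set e3 := expR _; set e4 := expR _.
    suff ee : (e1 * e2 = e3 * e4)%R.
      transitivity (c / b * p ^+ 2 * (e1 * e2))%R; first by ring.
      by rewrite ee; ring.
    rewrite /e1 /e2 /e3 /e4 -!expRD; congr expR.
    apply/eqP; rewrite -subr_eq0; apply/eqP.
    transitivity ((c ^+ 2 - (a ^+ 2 + b ^+ 2)) * (x ^+ 2 - z ^+ 2) / (2 * b ^+ 2))%R.
      by field; rewrite gt_eqF.
    by rewrite abc subrr !mul0r.
  under eq_integral do rewrite kE EFinM.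
  rewrite ge0_integralZl//; last 2 first.
  - by apply/measurable_EFinP; apply: measurable_funM => //; exact: mphiaff.
  - by move=> x _; rewrite lee_fin !mulr_ge0 ?invr_ge0 ?normal_pdf_ge0// ltW.
  under eq_integral do rewrite EFinM.
  rewrite ge0_integralZl//; last 2 first.
  - by apply/measurable_EFinP; exact: mphiaff.
  - by rewrite lee_fin divr_ge0// ltW.
  rewrite -(@ge0_integral_lebesgue_affine _ (c / b) (- (a / b * z)) (fun x => (phi x)%:E))//.
    by rewrite integral_normal_pdf mule1.
  by rewrite divr_gt0.
rewrite ge0_integral_gauss//; last 2 first.
- apply: (measurable_fun_fubini_tonelli_F (fun z : R * R => g (a * z.1 + b * z.2)%R)) => //.
  exact: measurableT_comp.
- by move=> x; exact: integral_ge0.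
under eq_integral do rewrite inner.
transitivity (\int[lambda]_x \int[lambda]_z F (x, z)); first by [].
rewrite (fubini_tonelli F)//= ge0_integral_gauss//; last first.
  by apply: measurableT_comp => //; exact: measurable_funM.
apply: eq_integral => z _; rewrite /F/= ge0_integralZl//.
- by rewrite kint.
- apply/measurable_EFinP; apply: measurable_funM => //; apply: measurable_funM => //.
  rewrite (_ : (fun _ => _) = (fun x : R => phi (- (a / b) * x + c / b * z)%R))//.
    exact: mphiaff.
  by apply/funext => x; rewrite addrC mulNr.
- by move=> x _; rewrite lee_fin.
Qed.

End gauss.

Lemma is_derive_expR_sqr (R : realType) (c x : R) :
  is_derive x 1 (fun y => expR (- (c * y ^+ 2))) (- (2 * c * x) * expR (- (c * x ^+ 2))).
Proof.
have H : is_derive x 1 (fun y : R => - (c * y ^+ 2)) (- (2 * c * x)).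
  rewrite (_ : (fun y => _) = (- (c *: (fun y : R => y ^+ 2)))); last first.
    by apply/funext.
  apply: is_derive_eq; rewrite /= /GRing.scale/=; ring.
have := @is_derive1_comp _ expR (fun y : R => - (c * y ^+ 2)) x _ _ (is_derive_expR _) H.
by rewrite mulrC.
Qed.

Lemma cvg_expR_sqr (R : realType) (c : R) : 0 < c ->
  x * expR (- (c * x ^+ 2)) @[x --> +oo] --> (0 : R).
Proof.
move=> c0; apply: (@squeeze_cvgr _ _ _ _ (cst 0) (fun x => c^-1 * x^-1)).
- near=> x; have x0 : 0 < x by near: x; exact: nbhs_pinfty_gt.
  apply/andP; split => /=; first by rewrite mulr_ge0 ?expR_ge0// ltW.
  rewrite expRN ler_pdivrMr ?expR_gt0// -invfM mulrC ler_pdivlMr ?mulr_gt0//.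
  by apply: (le_trans _ (expR_ge1Dx _)); rewrite mulrCA -expr2 lerDr.
- exact: cvg_cst.
- rewrite -[X in _ --> X](mulr0 c^-1); apply: cvgM; first exact: cvg_cst.
  apply/gtr0_cvgV0 => //; near=> x; near: x; exact: nbhs_pinfty_gt.
Unshelve. all: by end_near. Qed.

Section gauss_moments.
Local Open Scope ereal_scope.
Context {R : realType}.
Local Notation lambda := (@lebesgue_measure R).
Local Notation phi := (normal_pdf (0 : R) 1).

Lemma normal_pdf01_continuous : continuous phi.
Proof. by apply: continuous_normal_pdf; rewrite oner_neq0. Qed.

Lemma sqr_le_expR (y : R) : (0 <= y)%R -> (y ^+ 2 / 4 <= expR y)%R.
Proof.
move=> y0; rewrite {2}(splitr y) expRD -expr2.
rewrite (_ : y ^+ 2 / 4 = (y / 2) ^+ 2)%R; last by field.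
rewrite ler_pXn2r ?nnegrE ?divr_ge0 ?expR_ge0//.
by rewrite (le_trans _ (expR_ge1Dx _))// lerDr.
Qed.

(** 65 = 1 + 64: |x|^3 <= 1 + x^4, where x^4 <= 64 exp(x^2 / 4) by [sqr_le_expR] and 1 <= exp(x^2 /
    4). *)
Lemma cube_expR_le (x : R) :
  (`|x| ^+ 3 * expR (- (x ^+ 2 / 2)) <= 65 * expR (- (x ^+ 2 / 4)))%R.
Proof.
rewrite (_ : - (x ^+ 2 / 2) = - (x ^+ 2 / 4) + - (x ^+ 2 / 4))%R; last by field.
rewrite expRD mulrA ler_pM2r ?expR_gt0// expRN ler_pdivrMr ?expR_gt0//.
have := @sqr_le_expR (x ^+ 2 / 4); rewrite divr_ge0 ?sqr_ge0// => /(_ isT) e4.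
have e1 : (1 <= expR (x ^+ 2 / 4))%R.
  by rewrite -expR0 ler_expR divr_ge0// sqr_ge0.
have : (`|x| ^+ 3 <= 1 + `|x| ^+ 4)%R.
  have [x1|x1] := lerP `|x|%R 1%R.
    by apply: ler_wpDr; rewrite ?exprn_ge0// exprn_ile1.
  by apply: ler_wpDl => //; rewrite ler_eXn2l// ltW.
have -> : (`|x| ^+ 4 = (x ^+ 2) ^+ 2)%R.
  by rewrite (_ : 4 = 2 * 2)%N// exprM real_normK// num_real.
move=> h; apply: (le_trans h); move: e4 e1; set E := expR _.
rewrite (_ : (x ^+ 2 / 4) ^+ 2 / 4 = (x ^+ 2) ^+ 2 / 64)%R; last by field.
by move=> e4 e1; lra.
Qed.

Lemma gauss_moment3 : \int[@gauss R]_x (`|x| ^+ 3)%:E < +oo.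
Proof.
have m3 : measurable_fun [set: R] (fun x : R => `|x| ^+ 3)%R.
  by apply: measurable_funX; exact: normr_measurable.
have s20 : (Num.sqrt 2 : R)%R != 0%R by rewrite gt_eqF// sqrtr_gt0.
(* The factor exp(- x^2 / 4) left by [cube_expR_le] is, up to its peak value, the normal density of
   variance 2, whose total mass is 1. *)
pose C : R := (65 * normal_peak 1 / normal_peak (Num.sqrt 2))%R.
have C0 : (0 <= C)%R by rewrite !mulr_ge0 ?invr_ge0 ?normal_peak_ge0.
have pk : normal_peak (Num.sqrt 2 : R)%R != 0%R by rewrite gt_eqF// normal_peak_gt0.
rewrite ge0_integral_gauss//; last exact/measurable_EFinP.
apply: (@le_lt_trans _ _ (\int[lambda]_x (C%:E * (normal_pdf 0 (Num.sqrt 2) x)%:E))).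
  apply: ge0_le_integral => //.
  - by move=> x _; rewrite -EFinM lee_fin mulr_ge0 ?normal_pdf_ge0// exprn_ge0.
  - by apply/measurable_EFinP; apply: measurable_funM => //; exact: measurable_normal_pdf.
  - by apply/measurable_EFinP; apply: measurable_funM => //; exact: measurable_normal_pdf.
  - move=> x _; rewrite -!EFinM lee_fin normal_pdf01E normal_pdfE// /normal_fun.
    rewrite subr0 sqr_sqrtr//; have := cube_expR_le x; set p := `|x|%R.
    rewrite (_ : - x ^+ 2 / (2 *+ 2) = - (x ^+ 2 / 4))%R; last by field.
    set e1 := expR _; set e2 := expR _ => h.
    rewrite [leRHS](_ : _ = normal_peak 1 * (65 * e2))%R; last by rewrite /C; field.
    by rewrite mulrCA ler_pM2l// normal_peak_gt0// oner_neq0.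
rewrite ge0_integralZl//.
- by rewrite integral_normal_pdf mule1 ltry.
- by apply/measurable_EFinP; exact: measurable_normal_pdf.
- by move=> x _; rewrite lee_fin normal_pdf_ge0.
Qed.

(** A primitive of (x^2 - 1) phi x that vanishes at 0 and at infinity, so that the second moment
    equals the total mass. *)
Let F (x : R) : R := (- (x * phi x))%R.

Let is_derive_F (x : R) : is_derive x 1%R F ((x ^+ 2 - 1) * phi x)%R.
Proof.
have phiE : phi = (fun y => normal_peak 1 * expR (- (2^-1 * y ^+ 2)))%R.
  by apply/funext => y; rewrite normal_pdf01E (mulrC _ 2^-1)%R.
have H := @is_derive_expR_sqr R 2^-1 x.
rewrite phiE (_ : F = (- (normal_peak 1 *:
    ((fun y => y) * (fun y => expR (- (2^-1 * y ^+ 2))))))%R); last first.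
  by apply/funext => y; rewrite /F phiE /= /GRing.scale/= mulrCA.
by apply: is_derive_eq; rewrite /= /GRing.scale/=; field.
Qed.

Let F_cvg (x : R) : F x @[x --> x] --> F x.
Proof.
apply: differentiable_continuous; apply/derivable1_diffP.
exact: (@ex_derive _ _ _ _ _ _ _ (is_derive_F x)).
Qed.

Let F_derivable (x : R) : derivable F x 1%R.
Proof. exact: (@ex_derive _ _ _ _ _ _ _ (is_derive_F x)). Qed.

Let F_derive1 (x : R) : F^`()%classic x = ((x ^+ 2 - 1) * phi x)%R.
Proof. by rewrite derive1E; exact: (@derive_val _ _ _ _ _ _ _ (is_derive_F x)). Qed.

Let F_cvgy : F x @[x --> +oo%R] --> (0 : R)%R.
Proof.
rewrite -oppr0; apply: cvgN; rewrite -[X in _ --> X](mulr0 (normal_peak 1)).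
rewrite (_ : (fun x => _) = (fun x => normal_peak 1 * (x * expR (- (2^-1 * x ^+ 2))))%R).
  by apply: cvgM; [exact: cvg_cst|exact: cvg_expR_sqr].
by apply/funext => x; rewrite normal_pdf01E mulrCA (mulrC _ 2^-1)%R.
Qed.

Let cf : continuous (fun x : R => (x ^+ 2 - 1) * phi x)%R.
Proof.
move=> x; apply: cvgM; last exact: normal_pdf01_continuous.
by apply: cvgB; [exact: exprn_continuous|exact: cvg_cst].
Qed.

Let mphi : measurable_fun [set: R] phi := measurable_normal_pdf 0 1.

Let phi0 (x : R) : (0 <= phi x)%R := normal_pdf_ge0 0 1 x.

Let msq : measurable_fun [set: R] (fun x : R => x ^+ 2 * phi x)%R.
Proof. by apply: measurable_funM => //; exact: measurable_funX. Qed.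

Let half : \int[lambda]_(x in `[0%R, +oo[) (x ^+ 2 * phi x)%:E =
  \int[lambda]_(x in `[0%R, +oo[) (phi x)%:E.
Proof.
(* The half-line is cut at 1, where x^2 - 1 changes sign, so that all integrands are nonnegative;
   both pieces equal phi 1. *)
have I1 : \int[lambda]_(x in `[1%R, +oo[) ((x ^+ 2 - 1) * phi x)%:E = (phi 1)%:E.
  rewrite (@ge0_continuous_FTC2y _ _ F 1%R 0%R)//.
  - by rewrite -EFinB /F; congr EFin; ring.
  - move=> x x1; rewrite mulr_ge0// subr_ge0.
    exact: exprn_ege1.
  - by apply: continuous_subspaceT => x; exact: cf.
  - by apply: cvg_at_right_filter; exact: F_cvg.
have I0 : \int[lambda]_(x in `[0%R, 1%R]) ((1 - x ^+ 2) * phi x)%:E = (phi 1)%:E.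
  rewrite (@continuous_FTC2 _ _ (\- F)%R 0%R 1%R)//.
  - by rewrite -EFinB /= /F; congr EFin; ring.
  - apply: continuous_subspaceT => x.
    rewrite (_ : (fun x => _) = \- (fun x : R => (x ^+ 2 - 1) * phi x))%R; last first.
      by apply/funext => y /=; ring.
    by apply: cvgN; exact: cf.
  - split => [x _||].
    + exact: derivableN.
    + by apply: cvg_at_right_filter; apply: cvgN; exact: F_cvg.
    + by apply: cvg_at_left_filter; apply: cvgN; exact: F_cvg.
  - by move=> x _; rewrite derive1N// F_derive1; ring.
have -> : (`[0%R, +oo[ = `[0%R, 1%R] `|` `]1%R, +oo[ :> set R)%classic.
  by rewrite -itv_bndbnd_setU// bnd_simp.
have disj : [disjoint `[0%R, 1%R]%classic & `]1%R, +oo[%classic : set R].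
  rewrite disj_set2E; apply/eqP; rewrite -subset0 => x [] /=.
  by rewrite !in_itv/= andbT => /andP[_ x1]; rewrite ltNge x1.
rewrite !ge0_integral_setU//=; first last.
- by move=> x _; rewrite lee_fin mulr_ge0// sqr_ge0.
- by apply/measurable_EFinP; exact: measurable_funTS.
- by move=> x _; rewrite lee_fin.
- by apply/measurable_EFinP; exact: measurable_funTS.
rewrite !(integral_itv_obnd_cbnd (r := 1%R)); last 2 first.
- by apply/measurable_EFinP; exact: measurable_funTS.
- by apply/measurable_EFinP; exact: measurable_funTS.
have -> : \int[lambda]_(x in `[1%R, +oo[) (x ^+ 2 * phi x)%:E =
    (phi 1)%:E + \int[lambda]_(x in `[1%R, +oo[) (phi x)%:E.
  rewrite -I1 -ge0_integralD//.
  - by apply: eq_integral => x _; rewrite -EFinD; congr EFin; ring.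
  - move=> x /=; rewrite in_itv/= andbT => x1; rewrite lee_fin mulr_ge0// subr_ge0.
    exact: exprn_ege1.
  - apply/measurable_EFinP; apply: measurable_funTS.
    exact: continuous_measurable_fun cf.
  - by move=> x _; rewrite lee_fin.
  - by apply/measurable_EFinP; exact: measurable_funTS.
have -> : \int[lambda]_(x in `[0%R, 1%R]) (phi x)%:E =
    (phi 1)%:E + \int[lambda]_(x in `[0%R, 1%R]) (x ^+ 2 * phi x)%:E.
  rewrite -I0 -ge0_integralD//.
  - by apply: eq_integral => x _; rewrite -EFinD; congr EFin; ring.
  - move=> x /=; rewrite in_itv/= => /andP[x0 x1]; rewrite lee_fin mulr_ge0// subr_ge0.
    by rewrite expr_le1.
  - apply/measurable_EFinP; apply: measurable_funTS.
    rewrite (_ : (fun x => _) = \- (fun x : R => (x ^+ 2 - 1) * phi x))%R; last first.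
      by apply/funext => y /=; ring.
    by apply: measurable_funN; exact: continuous_measurable_fun cf.
  - by move=> x _; rewrite lee_fin mulr_ge0// sqr_ge0.
  - by apply/measurable_EFinP; exact: measurable_funTS.
by rewrite addeCA addeA.
Qed.

Lemma gauss_moment2 : \int[@gauss R]_x (x ^+ 2)%:E = 1.
Proof.
rewrite ge0_integral_gauss//; last 2 first.
- by apply/measurable_EFinP; exact: measurable_funX.
- by move=> x; rewrite lee_fin sqr_ge0.
transitivity (\int[lambda]_x (x ^+ 2 * phi x)%:E); first by [].
rewrite ge0_symfun_integralT; first last.
- by move=> x /=; rewrite sqrrN normal_pdf01N.
- move=> x; apply: cvgM; last exact: normal_pdf01_continuous.
  exact: exprn_continuous.
- by move=> x; rewrite mulr_ge0// sqr_ge0.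
rewrite -set_itvcy half -[RHS](@integral_normal_pdf R 0 1).
rewrite [RHS]ge0_symfun_integralT ?set_itvcy//.
- exact: normal_pdf01_continuous.
- by move=> x /=; rewrite normal_pdf01N.
Qed.

End gauss_moments.

(** * Third moments, normal distribution of the plane *)

Lemma integral_cst_probability d (T : measurableType d) (R : realType)
  (mu : probability T R) (c : \bar R) : (\int[mu]_x c = c)%E.
Proof. by rewrite integral_cst// [X in (_ * X)%E]probability_setT mule1. Qed.

Section plane_moments.
Context {R : realType}.
Implicit Types mu : probability (R * R)%type R.

Definition plane_scale (a : R) (z : R * R) : R * R := (a * z.1, a * z.2).

Lemma measurable_plane_scale a : measurable_fun setT (plane_scale a).
Proof. by apply: measurable_fun_pair; exact: measurable_funM. Qed.

Definition scaled mu a : probability (R * R)%type R :=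
  distribution mu (mfun_of (measurable_plane_scale a)).

Definition norm1 (z : R * R) : R := `|z.1| + `|z.2|.

Lemma norm1_ge0 z : 0 <= norm1 z. Proof. by rewrite addr_ge0. Qed.

Lemma measurable_norm1 : measurable_fun setT norm1.
Proof. by apply: measurable_funD; apply: measurableT_comp. Qed.

(** A bound on the third moment alone thus makes all monomials of degree at most two integrable. *)
Lemma moment_bounds z : [/\ `|z.1| <= 1 + norm1 z ^+ 3,
  `|z.2| <= 1 + norm1 z ^+ 3, `|z.1 ^+ 2| <= 1 + norm1 z ^+ 3,
  `|z.1 * z.2| <= 1 + norm1 z ^+ 3 & `|z.2 ^+ 2| <= 1 + norm1 z ^+ 3].
Proof.
have le1 (x y r : R) : 0 <= r -> `|x| <= r -> `|y| <= r ->
    [/\ `|x| <= 1 + r ^+ 3, `|x ^+ 2| <= 1 + r ^+ 3 & `|x * y| <= 1 + r ^+ 3].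
  move=> r0 xr yr; have rr : r <= 1 + r ^+ 3 /\ r ^+ 2 <= 1 + r ^+ 3.
    have [r1|/ltW r1] := lerP r 1.
      split; rewrite ler_wpDr ?exprn_ge0//; first by exact: exprn_ile1.
    have r2 : 1 <= r ^+ 2 by exact: exprn_ege1.
    split; apply: ler_wpDl => //.
      by rewrite exprS ler_peMr.
    by rewrite ler_weXn2l.
  split; first by rewrite (le_trans xr)// rr.1.
  - by rewrite (le_trans _ rr.2)// normrX lerXn2r// nnegrE.
  - by rewrite (le_trans _ rr.2)// normrM expr2 ler_pM.
have l1 : `|z.1| <= norm1 z by rewrite lerDl.
have l2 : `|z.2| <= norm1 z by rewrite lerDr.
have [? ? ?] := le1 _ _ _ (norm1_ge0 z) l1 l2.
by have [? ? ?] := le1 _ _ _ (norm1_ge0 z) l2 l1.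
Qed.

(** Mean zero and covariance s times the identity. The bound on the third moment also ensures
    integrability, so none of the real integrals takes its default value. *)
Definition std_moments mu (s rho : R) : Prop :=
  [/\ (\int[mu]_y (norm1 y ^+ 3)%:E <= rho%:E)%E,
      \int[mu]_y y.1 = 0 /\ \int[mu]_y y.2 = 0 &
      [/\ \int[mu]_y (y.1 ^+ 2) = s, \int[mu]_y (y.1 * y.2) = 0 &
          \int[mu]_y (y.2 ^+ 2) = s]].

Lemma integrable_moment3 mu rho (f : R * R -> R) (C : R) :
  (\int[mu]_y (norm1 y ^+ 3)%:E <= rho%:E)%E -> measurable_fun setT f ->
  (forall y, `|f y| <= C * (1 + norm1 y ^+ 3)) ->
  mu.-integrable setT (EFin \o f).
Proof.
move=> m3 mf fC; apply/integrableP; split; first exact/measurable_EFinP.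
have m3f : measurable_fun setT (fun y => norm1 y ^+ 3).
  by apply: measurable_funX; exact: measurable_norm1.
have C0 : 0 <= C.
  have := le_trans (normr_ge0 _) (fC 0); rewrite /norm1 /= normr0 addr0 expr0n/=.
  by rewrite addr0 mulr1.
have p0 y : 0 <= 1 + norm1 y ^+ 3 by rewrite addr_ge0// exprn_ge0// norm1_ge0.
apply: (@le_lt_trans _ _ (\int[mu]_y (C%:E * (1%:E + (norm1 y ^+ 3)%:E)))%E).
  apply: ge0_le_integral => //.
  - by do 2 apply: measurableT_comp => //.
  - by apply: measurable_funeM; apply: emeasurable_funD => //; exact/measurable_EFinP.
  - by move=> y _ /=; rewrite -EFinD -EFinM lee_fin.
rewrite ge0_integralZl//; last 2 first.
- by apply: emeasurable_funD => //; exact/measurable_EFinP.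
- by move=> y _; rewrite -EFinD lee_fin.
rewrite ge0_integralD//; first last.
- exact/measurable_EFinP.
- by move=> y _; rewrite lee_fin exprn_ge0// norm1_ge0.
rewrite integral_cst// mul1e [X in (X + _)%E]probability_setT.
apply: (@le_lt_trans _ _ (C%:E * (1%:E + rho%:E)))%E.
  by rewrite lee_wpmul2l ?lee_fin// leeD2l.
by rewrite -EFinD -EFinM ltry.
Qed.

Lemma scaled_moments mu s rho a : 0 <= a ->
  std_moments mu s rho -> std_moments (scaled mu a) (a ^+ 2 * s) (a ^+ 3 * rho).
Proof.
move=> a0 H; have [m3 [m1 m2] [m11 m12 m22]] := H.
have m3f : measurable_fun setT (fun y => norm1 y ^+ 3).
  by apply: measurable_funX; exact: measurable_norm1.
have intE (f : R * R -> R) : measurable_fun setT f ->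
    (exists C, forall y, `|f (plane_scale a y)| <= C * (1 + norm1 y ^+ 3)) ->
    \int[scaled mu a]_y f y = \int[mu]_y f (plane_scale a y).
  move=> mf [C fC]; rewrite /Rintegral; congr fine.
  rewrite integral_distribution//; first exact/measurable_EFinP.
  apply: (integrable_moment3 m3 (C := C)) => //.
  by apply: measurableT_comp => //; exact: measurable_plane_scale.
have int (f : R * R -> R) : measurable_fun setT f ->
    (forall y, `|f y| <= 1 + norm1 y ^+ 3) -> mu.-integrable setT (EFin \o f).
  by move=> mf fC; apply: (integrable_moment3 m3 (C := 1)) => // y; rewrite mul1r.
have b1 := moment_bounds.
split.
- rewrite [leLHS](_ : _ = (a ^+ 3)%:E * \int[mu]_y (norm1 y ^+ 3)%:E)%E.
    by rewrite (EFinM (a ^+ 3)) lee_wpmul2l// lee_fin exprn_ge0.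
  rewrite ge0_integral_distribution//; last 2 first.
  + exact/measurable_EFinP.
  + by move=> y; rewrite lee_fin exprn_ge0// norm1_ge0.
  rewrite -ge0_integralZl//; last 3 first.
  + exact/measurable_EFinP.
  + by move=> y _; rewrite lee_fin exprn_ge0// norm1_ge0.
  + by rewrite lee_fin exprn_ge0.
  apply: eq_integral => y _; rewrite -EFinM; congr EFin.
  by rewrite /= /norm1 /plane_scale /= !normrM (ger0_norm a0) -mulrDr exprMn.
- split.
  + rewrite intE//; last by exists a => y; rewrite /= normrM ger0_norm// ler_wpM2l//; have [] := b1 y.
    rewrite /= RintegralZl//; first by rewrite m1 mulr0.
    by apply: int => // y; have [] := b1 y.
  + rewrite intE//; last by exists a => y; rewrite /= normrM ger0_norm// ler_wpM2l//; have [] := b1 y.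
    rewrite /= RintegralZl//; first by rewrite m2 mulr0.
    by apply: int => // y; have [] := b1 y.
- have m1f : measurable_fun setT (fun y : R * R => y.1 ^+ 2) by exact: measurable_funX.
  have m2f : measurable_fun setT (fun y : R * R => y.2 ^+ 2) by exact: measurable_funX.
  have m12f : measurable_fun setT (fun y : R * R => y.1 * y.2) by exact: measurable_funM.
  have a20 : 0 <= a ^+ 2 by exact: sqr_ge0.
  split.
  + rewrite intE//; last first.
      exists (a ^+ 2) => y; rewrite /= exprMn normrM ger0_norm// ler_wpM2l//.
      by have [] := b1 y.
    rewrite /=; under eq_Rintegral do rewrite exprMn.
    rewrite RintegralZl//; first by rewrite m11.
    by apply: int => // y; have [] := b1 y.
  + rewrite intE//; last first.
      exists (a ^+ 2) => y; rewrite /= mulrACA -expr2 normrM ger0_norm// ler_wpM2l//.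
      by have [] := b1 y.
    rewrite /=; under eq_Rintegral do rewrite mulrACA -expr2.
    rewrite RintegralZl//; first by rewrite m12 mulr0.
    by apply: int => // y; have [] := b1 y.
  + rewrite intE//; last first.
      exists (a ^+ 2) => y; rewrite /= exprMn normrM ger0_norm// ler_wpM2l//.
      by have [] := b1 y.
    rewrite /=; under eq_Rintegral do rewrite exprMn.
    rewrite RintegralZl//; first by rewrite m22.
    by apply: int => // y; have [] := b1 y.
Qed.

End plane_moments.

Section gauss_plane.
Local Open Scope ereal_scope.
Context {R : realType}.

Definition gaussp : probability (R * R)%type R := (@gauss R \x @gauss R).

Lemma ge0_integral_gaussp (g : R * R -> \bar R) :
  measurable_fun setT g -> (forall x, 0 <= g x) ->
  \int[gaussp]_z g z = \int[@gauss R]_x \int[@gauss R]_y g (x, y).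
Proof. by move=> mg g0; rewrite (fubini_tonelli1 g). Qed.

Lemma ge0_integral_scaled (mu : probability (R * R)%type R) a (g : R * R -> \bar R) :
  measurable_fun setT g -> (forall x, 0 <= g x) ->
  \int[scaled mu a]_z g z = \int[mu]_z g (plane_scale a z).
Proof.
by move=> mg g0; exact: (ge0_integral_distribution (mfun_of (measurable_plane_scale a)) mg g0).
Qed.

Lemma ge0_integral_scaled_gaussp a (g : R * R -> \bar R) :
  measurable_fun setT g -> (forall x, 0 <= g x) ->
  \int[scaled gaussp a]_z g z =
  \int[@gauss R]_x \int[@gauss R]_y g (a * x, a * y)%R.
Proof.
move=> mg g0; rewrite ge0_integral_scaled// ge0_integral_gaussp//.
by apply: measurableT_comp => //; exact: measurable_plane_scale.
Qed.

Lemma convol_gaussp (a b c : R) (g : R * R -> \bar R) :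
  (0 < a)%R -> (0 < b)%R -> (0 < c)%R -> (c ^+ 2 = a ^+ 2 + b ^+ 2)%R ->
  measurable_fun setT g -> (forall x, 0 <= g x) ->
  convol (scaled gaussp a) (convol (scaled gaussp b) g) = convol (scaled gaussp c) g.
Proof.
move=> a0 b0 c0 abc mg g0; apply/funext => t.
set h := convol (scaled gaussp b) g.
have mh : measurable_fun setT h by exact: measurable_convol.
have h0 x : 0 <= h x by exact: convol_ge0.
have mht : measurable_fun setT (fun z => h (t + z)%R).
  exact: (measurableT_comp mh (measurable_plane_translate t)).
have mgt (u : R * R) : measurable_fun setT (fun z => g (u + z)%R).
  exact: (measurableT_comp mg (measurable_plane_translate u)).
rewrite {1}/convol (ge0_integral_scaled_gaussp a mht)// /convol.
have E := ge0_integral_scaled_gaussp c (mgt t) (fun z => g0 (t + z)%R).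
apply: etrans (esym E).
have mg4 : measurable_fun [set: (R * R) * (R * R)]
    (fun z => g (t + (a * z.1.1, a * z.1.2) + (b * z.2.1, b * z.2.2))%R).
  apply: (measurableT_comp mg); apply/measurable_fun_pairP; split => /=.
    apply: measurable_funD; last by apply: measurable_funM => //; apply: measurableT_comp.
    apply: measurable_funD => //; apply: measurable_funM => //; exact: measurableT_comp.
  apply: measurable_funD; last by apply: measurable_funM => //; apply: measurableT_comp.
  apply: measurable_funD => //; apply: measurable_funM => //; exact: measurableT_comp.
pose G x1 x2 y1 y2 := g (t + (a * x1, a * x2) + (b * y1, b * y2))%R.
transitivity (\int[@gauss R]_x1 \int[@gauss R]_x2
    \int[@gauss R]_y1 \int[@gauss R]_y2 G x1 x2 y1 y2).
  apply: eq_integral => x1 _; apply: eq_integral => x2 _.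
  exact: (ge0_integral_scaled_gaussp b (mgt _) (fun z => g0 (_ + z)%R)).
(* Exchanging the middle integrals pairs the first coordinates with each other and the second
   coordinates with each other, so that one-dimensional stability applies twice. *)
have swap x1 : \int[@gauss R]_x2 \int[@gauss R]_y1 \int[@gauss R]_y2 G x1 x2 y1 y2 =
    \int[@gauss R]_y1 \int[@gauss R]_x2 \int[@gauss R]_y2 G x1 x2 y1 y2.
  apply: (fubini_tonelli (fun z => \int[@gauss R]_y2 G x1 z.1 z.2 y2)); last first.
    by move=> z; apply: integral_ge0 => y _; exact: g0.
  apply: (measurable_fun_fubini_tonelli_F (fun z : (R * R) * R => G x1 z.1.1 z.1.2 z.2)); last first.
    by move=> z; exact: g0.
  apply: (measurableT_comp mg4
    (g := fun z : (R * R) * R => ((x1, z.1.1), (z.1.2, z.2)))).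
  apply: measurable_fun_pair => /=; apply: measurable_fun_pair => //=;
    exact: measurableT_comp.
under eq_integral do rewrite swap.
have inner x1 y1 : \int[@gauss R]_x2 \int[@gauss R]_y2 G x1 x2 y1 y2 =
    \int[@gauss R]_z g (t + (a * x1 + b * y1, c * z))%R.
  have mgs : measurable_fun [set: R] (fun s => g (t + (a * x1 + b * y1, s))%R).
    apply: (measurableT_comp mg); apply: (measurableT_comp (measurable_plane_translate t)).
    exact: measurable_fun_pair.
  have E1 := @ge0_integral_gaussD _ a b c (fun s => g (t + (a * x1 + b * y1, s))%R)
    a0 b0 c0 abc mgs (fun=> g0 _).
  apply: etrans E1.
  apply: eq_integral => x2 _; apply: eq_integral => y2 _; rewrite /G.
  by congr g; rewrite -addrA; congr (t + _)%R.
under eq_integral do under eq_integral do rewrite inner.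
rewrite (@ge0_integral_gaussD _ a b c
  (fun s => \int[@gauss R]_z g (t + (s, c * z))%R))//.
- apply: (measurable_fun_fubini_tonelli_F (fun z : R * R => g (t + (z.1, c * z.2))%R)) => //.
  apply: (measurableT_comp mg); apply: (measurableT_comp (measurable_plane_translate t)).
  by apply: measurable_fun_pair => //; exact: measurable_funM.
- by move=> s; exact: integral_ge0.
Qed.

(** Variances add up under convolution. The count starts at one because [convol_gaussp] works with
    positive scales. *)
Lemma iter_convol_gaussp (s : R) n (g : R * R -> \bar R) : (0 < s)%R ->
  measurable_fun setT g -> (forall x, 0 <= g x) ->
  iter n.+1 (convol (scaled gaussp s)) g =
  convol (scaled gaussp (Num.sqrt n.+1%:R * s)%R) g.
Proof.
move=> s0 mg g0; elim: n => [|n IH]; first by rewrite sqrtr1 mul1r.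
have c0 k : (0 < Num.sqrt k.+1%:R * s)%R by rewrite mulr_gt0// sqrtr_gt0.
apply: (etrans (congr1 (convol (scaled gaussp s)) IH)).
apply: (convol_gaussp s0 (c0 n) (c0 n.+1) _ mg g0).
rewrite !exprMn !(sqr_sqrtr (ler0n _ _)); set x := (s ^+ 2)%R.
by rewrite -[X in (_ = X + _)%R]mul1r -mulrDl addrC natr1.
Qed.

(** The symmetry exchanges positive and negative part, so their integrals agree and, being finite,
    cancel. Invariance is asked for nonnegative functions, where Tonelli's theorem provides it. *)
Lemma Rintegral_odd d (T : measurableType d) (mu : {measure set T -> \bar R})
    (f : T -> R) (tau : T -> T) : mu.-integrable setT (EFin \o f) ->
  (forall g : T -> \bar R, measurable_fun setT g -> (forall x, 0 <= g x) ->
    \int[mu]_x g (tau x) = \int[mu]_x g x) ->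
  (forall x, f (tau x) = - f x)%R -> (\int[mu]_x f x = 0)%R.
Proof.
move=> intf inv odd; rewrite /Rintegral integralE.
have mf := measurable_int _ intf.
have -> : \int[mu]_x ((EFin \o f)^\- x) = \int[mu]_x ((EFin \o f)^\+ x).
  rewrite -(inv (EFin \o f)^\-)//; last exact: measurable_funeneg.
  apply: eq_integral => x _; rewrite funeposE funenegE /= odd.
  by rewrite opprK.
rewrite subee//; apply: integrable_pos_fin_num => //.
Qed.

Lemma gaussp_moments : exists rho : R, std_moments gaussp 1 rho.
Proof.
have m3 : measurable_fun [set: R * R] (fun y => norm1 y ^+ 3)%R.
  by apply: measurable_funX; exact: measurable_norm1.
have mc : measurable_fun [set: R] (fun x : R => `|x| ^+ 3)%R.
  by apply: measurable_funX; exact: normr_measurable.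
have cube0 (x : R) : (0 <= `|x| ^+ 3)%R by rewrite exprn_ge0.
pose K := (fine (\int[@gauss R]_x (`|x| ^+ 3)%:E))%R.
have KE : \int[@gauss R]_x (`|x| ^+ 3)%:E = K%:E.
  rewrite /K fineK// ge0_fin_numE; first exact: gauss_moment3.
  by apply: integral_ge0 => x _; rewrite lee_fin.
have H3 : \int[gaussp]_y (norm1 y ^+ 3)%:E <= (4 * K + 4 * K)%:E.
  rewrite ge0_integral_gaussp//; last 2 first.
  - exact/measurable_EFinP.
  - by move=> y; rewrite lee_fin exprn_ge0// norm1_ge0.
  pose F (x : R) := (4 * `|x| ^+ 3)%:E.
  have mF : measurable_fun [set: R] F.
    by apply/measurable_EFinP; exact: measurable_funM.
  have F0 x : 0 <= F x by rewrite lee_fin mulr_ge0.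
  have FE : \int[@gauss R]_x F x = (4 * K)%:E.
    rewrite EFinM -KE -ge0_integralZl//; last exact/measurable_EFinP.
  (* 4 (p^3 + q^3) - (p + q)^3 = 3 (p + q) (p - q)^2. *)
  have ub (x y : R) : (norm1 (x, y) ^+ 3)%:E <= F x + F y.
    rewrite -EFinD lee_fin /norm1 /=; move: (normr_ge0 x) (normr_ge0 y).
    move: `|x|%R `|y|%R => p q p0 q0; rewrite -subr_ge0.
    rewrite (_ : _ - _ = 3 * (p + q) * (p - q) ^+ 2)%R; last by ring.
    by rewrite mulr_ge0 ?sqr_ge0// mulr_ge0// addr_ge0.
  have m3x x : measurable_fun [set: R] (fun y => (norm1 (x, y) ^+ 3)%:E).
    apply/measurable_EFinP; apply: (measurableT_comp m3).
    exact: measurable_fun_pair.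
  apply: (@le_trans _ _ (\int[@gauss R]_x (F x + (4 * K)%:E))).
    apply: ge0_le_integral => //.
    - by move=> x _; apply: integral_ge0 => y _; rewrite lee_fin exprn_ge0// norm1_ge0.
    - apply: (measurable_fun_fubini_tonelli_F (fun y => (norm1 y ^+ 3)%:E)).
        exact/measurable_EFinP.
      by move=> y; rewrite lee_fin exprn_ge0// norm1_ge0.
    - exact: emeasurable_funD.
    - move=> x _; apply: (@le_trans _ _ (\int[@gauss R]_y (F x + F y))).
        apply: ge0_le_integral => //.
        - by move=> y _; rewrite lee_fin exprn_ge0// norm1_ge0.
        - exact: emeasurable_funD.
      rewrite ge0_integralD//= FE.
      by rewrite integral_cst// [X in (_ * X)]probability_setT mule1.
  rewrite ge0_integralD//; last first.
    by move=> x _; rewrite -FE; exact: integral_ge0.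
  by rewrite FE integral_cst// [X in (_ * X)]probability_setT mule1 -EFinD.
set rho := (4 * K + 4 * K)%R in H3 *.
have integ (f : R * R -> R) : measurable_fun setT f ->
    (forall y, `|f y| <= 1 + norm1 y ^+ 3)%R -> gaussp.-integrable setT (EFin \o f).
  by move=> mf fC; apply: (integrable_moment3 (C := 1%R) H3) => // y; rewrite mul1r.
have b := @moment_bounds R.
have invx (g : R * R -> \bar R) : measurable_fun setT g -> (forall x, 0 <= g x) ->
    \int[gaussp]_z g (- z.1, z.2)%R = \int[gaussp]_z g z.
  move=> mg g0.
  have mgN : measurable_fun setT (fun z : R * R => g (- z.1, z.2)%R).
    apply: (measurableT_comp mg); apply: measurable_fun_pair => //.
    exact: measurableT_comp.
  rewrite (ge0_integral_gaussp mgN)// (ge0_integral_gaussp mg)//=.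
  apply: (@ge0_integral_gaussN _ (fun x => \int[@gauss R]_y g (x, y))).
    exact: measurable_fun_fubini_tonelli_F.
  by move=> x; exact: integral_ge0.
have invy (g : R * R -> \bar R) : measurable_fun setT g -> (forall x, 0 <= g x) ->
    \int[gaussp]_z g (z.1, - z.2)%R = \int[gaussp]_z g z.
  move=> mg g0.
  have mgN : measurable_fun setT (fun z : R * R => g (z.1, - z.2)%R).
    apply: (measurableT_comp mg); apply: measurable_fun_pair => //.
    exact: measurableT_comp.
  rewrite (ge0_integral_gaussp mgN)// (ge0_integral_gaussp mg)//=.
  apply: eq_integral => x _; apply: (@ge0_integral_gaussN _ (fun y => g (x, y))) => //.
  by apply: (measurableT_comp mg); exact: measurable_fun_pair.
have m1f : measurable_fun [set: R * R] (fun y : R * R => y.1 ^+ 2)%R by exact: measurable_funX.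
have m2f : measurable_fun [set: R * R] (fun y : R * R => y.2 ^+ 2)%R by exact: measurable_funX.
exists rho; split; [exact: H3|split|split].
- apply: (Rintegral_odd (tau := fun z : R * R => (- z.1, z.2)%R) _ invx) => //.
  by apply: integ => // y; have [] := b y.
- apply: (Rintegral_odd (tau := fun z : R * R => (z.1, - z.2)%R) _ invy) => //.
  by apply: integ => // y; have [] := b y.
- rewrite /Rintegral; suff -> : \int[gaussp]_y (y.1 ^+ 2)%:E = 1 by [].
  rewrite ge0_integral_gaussp; [|exact/measurable_EFinP|]; last first.
    by move=> y; rewrite lee_fin sqr_ge0.
  rewrite -(@gauss_moment2 R); apply: eq_integral => x _.
  exact: (integral_cst_probability (@gauss R) (x ^+ 2)%:E).
- apply: (Rintegral_odd (tau := fun z : R * R => (- z.1, z.2)%R) _ invx) => [|y]; last first.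
    by rewrite /= mulNr.
  apply: integ => [|y]; first exact: measurable_funM.
  by have [] := b y.
- rewrite /Rintegral; suff -> : \int[gaussp]_y (y.2 ^+ 2)%:E = 1 by [].
  rewrite ge0_integral_gaussp; [|exact/measurable_EFinP|]; last first.
    by move=> y; rewrite lee_fin sqr_ge0.
  rewrite -[RHS](@integral_cst_probability _ _ _ (@gauss R)).
  by apply: eq_integral => x _; exact: gauss_moment2.
Qed.

End gauss_plane.

(** * The limit law *)

(** The mean of [I] and [K] is read off from an identity of sums without subtraction, which infinite
    values would forbid. *)
Lemma half_sum (R : realType) (I K J JN : \bar R) : (I + K = JN + J)%E -> JN = J ->
  (0 <= I)%E -> (0 <= K)%E -> (2^-1%:E * K + 2^-1%:E * I = J)%E.
Proof.
move=> E JE I0 K0; rewrite JE in E; have h0 : (0 <= 2^-1 :> R)%R by [].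
rewrite -ge0_muleDr// addeC E; case: J {E JE} => [r| |].
- by rewrite -EFinD -EFinM; congr EFin; field.
- by rewrite addey// gt0_muley// lte_fin.
- by rewrite addeNy gt0_muleNy// lte_fin.
Qed.

Section chi2bar12_cdf.
Local Open Scope ereal_scope.
Context {R : realType}.

Definition chi_stat (z : R * R) : R := (Num.max z.1 0 ^+ 2 + z.2 ^+ 2)%R.

Lemma measurable_chi_stat : measurable_fun setT chi_stat.
Proof.
apply: measurable_funD; apply: measurable_funX => //.
by apply: measurable_maxr.
Qed.

(** The probability that r plus the square of a standard normal is at most s. The cdfs below are
    values of [G s] or its means over a random r. *)
Let G (s r : R) : \bar R := @gauss R [set y | (r + y ^+ 2 <= s)%R].

Let measurable_sublevel (s : R) : measurable [set z : R * R | (z.1 + z.2 ^+ 2 <= s)%R].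
Proof.
rewrite -[X in measurable X]setTI.
rewrite (_ : [set z | _] = (fun z : R * R => z.1 + z.2 ^+ 2)%R @^-1` `]-oo, s]); last first.
  by apply/seteqP; split=> z; rewrite /= in_itv.
by apply: measurable_funD => //; exact: measurable_funX.
Qed.

Let GE (s r : R) : G s r = @gauss R (xsection [set z : R * R | (z.1 + z.2 ^+ 2 <= s)%R] r).
Proof. by congr (gauss _); apply/seteqP; split => y; rewrite /xsection/= inE. Qed.

Let measurable_G (s : R) : measurable_fun setT (G s).
Proof.
rewrite (_ : G s = gauss \o xsection [set z : R * R | (z.1 + z.2 ^+ 2 <= s)%R]); last first.
  by apply/funext => r; exact: GE.
exact: measurable_fun_xsection.
Qed.

Let G0 (s r : R) : 0 <= G s r. Proof. exact: measure_ge0. Qed.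

Let msq : measurable_fun setT (fun x : R => x ^+ 2)%R.
Proof. exact: measurable_funX. Qed.

Let measurable_shift_le (s r : R) : measurable [set y : R | (r + y <= s)%R].
Proof.
rewrite (_ : [set y : R | (r + y <= s)%R] = `]-oo, (s - r)%R]%classic)//.
by apply/seteqP; split => y; rewrite /= in_itv/= lerBrDl.
Qed.

Let chi2_1 (s r : R) : chi2 1 [set y : R | (r + y <= s)%R] = G s r.
Proof.
pose A := [set y : R | (r + y <= s)%R].
have mA : measurable A by exact: measurable_shift_le.
have mind : measurable_fun setT (fun x : R => (\1_A (x ^+ 2)%R : R)%:E).
  by apply/measurable_EFinP; apply: (measurableT_comp _ msq); exact: measurable_indic.
transitivity (\int[normal_prob 0 1]_x (\1_A (x ^+ 2)%R : R)%:E).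
  apply: eq_integral => x _; rewrite /= /dirac !indicE.
  rewrite (_ : (_ \in xsection _ _) = (x ^+ 2 \in A)%R)//.
  by apply/idP/idP; rewrite /xsection !inE/= inE/= /add_sqr/= addr0.
rewrite -ge0_integral_gauss_normal; [|exact: mind|]; last first.
  by move=> x; rewrite lee_fin.
transitivity (\int[gauss]_x (\1_[set y : R | (r + y ^+ 2 <= s)%R] x : R)%:E).
  by apply: eq_integral => x _; rewrite !indicE.
rewrite integral_indic// ?setIT//.
by have := msq measurableT mA; rewrite setTI.
Qed.

Let chi2_2 (s : R) : chi2 2 [set y : R | (y <= s)%R] =
  \int[gauss]_x G s (x ^+ 2).
Proof.
transitivity (\int[normal_prob 0 1]_x G s (x ^+ 2)).
  apply: eq_integral => x _; rewrite -chi2_1.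
  congr (chi2 1 _); apply/seteqP.
  by split => y; rewrite /xsection/= inE.
rewrite -ge0_integral_gauss_normal; last by move=> x; exact: G0.
  by [].
exact: (measurableT_comp (measurable_G s) msq).
Qed.

Let gaussp_stat (s : R) : gaussp [set z | (chi_stat z <= s)%R] =
  \int[gauss]_x G s (Num.max x 0 ^+ 2)%R.
Proof.
apply: eq_integral => x _; congr (gauss _); apply/seteqP.
by split => y; rewrite /xsection/= inE.
Qed.

(** For every x the numbers max(x, 0)^2 and max(- x, 0)^2 are x^2 and 0 in some order, so [G s] has
    the same sum over both pairs. The two terms of the first pair have equal means by symmetry of
    the normal law, and each is therefore the average of the chi-square cdfs. *)
Lemma chi2bar12_cdf (s : R) :
  chi2bar12 `]-oo, s]%classic = gaussp [set z | (chi_stat z <= s)%R].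
Proof.
have -> : `]-oo, s]%classic = [set y : R | (y <= s)%R].
  by apply/seteqP; split => y; rewrite /= in_itv.
have mmax : measurable_fun [set: R] (fun x : R => Num.max x 0 ^+ 2)%R.
  by apply: measurable_funX; exact: measurable_maxr.
have mmaxN : measurable_fun [set: R] (fun x : R => Num.max (- x) 0 ^+ 2)%R.
  by apply: measurable_funX; apply: measurable_maxr => //; exact: measurableT_comp.
have mGmax := measurableT_comp (measurable_G s) mmax.
have mGmaxN := measurableT_comp (measurable_G s) mmaxN.
have mGsq := measurableT_comp (measurable_G s) msq.
rewrite chi2bar12E chi2_2 gaussp_stat.
have -> : chi2 1 [set y : R | (y <= s)%R] = G s 0.
  by rewrite -chi2_1; congr (chi2 1 _); apply/seteqP; split => y; rewrite /= add0r.
set I := \int[gauss]_x _.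
set J := \int[gauss]_x _.
have EN : \int[gauss]_x G s (Num.max (- x) 0 ^+ 2)%R = J.
  exact: (ge0_integral_gaussN mGmax (fun x => G0 s _)).
have EC : \int[gauss]_x G s 0 = G s 0 by exact: (integral_cst_probability gauss).
have D1 : \int[gauss]_x (G s (x ^+ 2) + G s 0)%E = I + \int[gauss]_x G s 0.
  exact: (ge0_integralD gauss measurableT (fun x _ => G0 s _) mGsq
    (fun x _ => G0 s 0) (@measurable_cst _ _ R _ setT (G s 0))).
have D2 : \int[gauss]_x (G s (Num.max (- x) 0 ^+ 2)%R + G s (Num.max x 0 ^+ 2)%R) =
    \int[gauss]_x G s (Num.max (- x) 0 ^+ 2)%R + J.
  exact: (ge0_integralD gauss measurableT (fun x _ => G0 s _) mGmaxN
    (fun x _ => G0 s _) mGmax).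
have pw (x : R) : G s (x ^+ 2)%R + G s 0 =
    G s (Num.max (- x) 0 ^+ 2)%R + G s (Num.max x 0 ^+ 2)%R.
  clear -x; have e0 : (0 ^+ 2 = 0 :> R)%R by rewrite expr0n.
  move: (G s) => F; have [x0|/ltW x0] := lerP 0%R x.
    by rewrite max_r ?oppr_le0// e0 addeC.
  by rewrite max_l ?oppr_ge0// sqrrN e0.
have D12 : \int[gauss]_x (G s (x ^+ 2) + G s 0)%E =
    \int[gauss]_x (G s (Num.max (- x) 0 ^+ 2)%R + G s (Num.max x 0 ^+ 2)%R).
  by apply: eq_integral => x _; exact: pw.
have I0 : 0 <= I by apply: integral_ge0 => x _; exact: G0.
rewrite EC in D1.
exact: (half_sum (etrans (esym D1) (etrans D12 D2)) EN I0 (G0 s 0)).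
Qed.

End chi2bar12_cdf.

(** * Lindeberg's method *)

Section smooth3.
Context {R : realType}.
Implicit Types f g : R -> R.

(** By the mean value theorem, a bound of order k on the derivative becomes one of order k + 1 on
    the function. Iterated, it gives Taylor remainders without factorials in the constant. *)
Lemma growth_from_deriv f (f1 : R -> R) (K : R) k :
  f 0 = 0 -> (forall x : R, is_derive x 1 f (f1 x)) -> (forall x, `|f1 x| <= K * `|x| ^+ k) ->
  forall h, `|f h| <= K * `|h| ^+ k.+1.
Proof.
move=> f0 df f1K h.
have cf x : {for x, continuous f}.
  apply: differentiable_continuous; apply/derivable1_diffP.
  exact: (@ex_derive _ _ _ _ _ _ _ (df x)).
have K0 : 0 <= K.
  have := le_trans (normr_ge0 _) (f1K 1).
  by rewrite normr1 expr1n mulr1.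
have bd c : `|c| <= `|h| -> `|f1 c * h| <= K * `|h| ^+ k.+1.
  move=> ch; rewrite normrM exprSr mulrA ler_wpM2r//.
  by apply: (le_trans (f1K c)); rewrite ler_wpM2l// lerXn2r ?nnegrE.
have [h0|h0] := leP 0 h.
  have [c + E] := @MVT_segment R f f1 0 h h0 (fun x _ => df x)
    (continuous_subspaceT (fun x => cf x)).
  rewrite in_itv/= => /andP[c0 ch]; move: E; rewrite f0 !subr0 => ->.
  by apply: bd; rewrite !ger0_norm.
have [c + E] := @MVT_segment R f f1 h 0 (ltW h0) (fun x _ => df x)
  (continuous_subspaceT (fun x => cf x)).
rewrite in_itv/= => /andP[hc c0]; move: E; rewrite f0 !sub0r mulrN => /oppr_inj ->.
by apply: bd; rewrite !ler0_norm ?lerN2// ltW.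
Qed.

(** The derivatives are explicit arguments, so that those of products and complements are given by
    formulas; one constant bounds them all. *)
Definition smooth3 f (f1 f2 f3 : R -> R) (K : R) : Prop :=
  [/\ (forall x : R, is_derive x 1 f (f1 x)), (forall x : R, is_derive x 1 f1 (f2 x)),
      (forall x : R, is_derive x 1 f2 (f3 x)) &
      forall x, [/\ `|f x| <= K, `|f1 x| <= K, `|f2 x| <= K & `|f3 x| <= K]].

Lemma is_derive_shift_fun f (df x h : R) :
  is_derive (x + h) 1 f df -> is_derive h 1 (fun t => f (x + t)) df.
Proof.
move=> H; have S : is_derive h 1 (fun t : R => x + t) 1.
  rewrite (_ : (fun t : R => x + t) = (cst x + id)); last by apply/funext.
  by apply: is_derive_eq; rewrite add0r.
have := @is_derive1_comp _ f (fun t => x + t) h _ _ H S.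
by rewrite mulr1.
Qed.

Lemma smooth3_taylor f f1 f2 f3 K : smooth3 f f1 f2 f3 K -> forall x h,
  [/\ `|f (x + h) - f x| <= K * `|h|,
      `|f (x + h) - f x - f1 x * h| <= K * `|h| ^+ 2 &
      `|f (x + h) - f x - f1 x * h - f2 x / 2 * h ^+ 2| <= K * `|h| ^+ 3].
Proof.
move=> [d1 d2 d3 bd] x.
have T1 (g g1 : R -> R) : (forall x : R, is_derive x 1 g (g1 x)) ->
    (forall x, `|g1 x| <= K) -> forall h, `|g (x + h) - g x| <= K * `|h|.
  move=> dg g1K h; have := @growth_from_deriv (fun t => g (x + t) - g x)
    (fun t => g1 (x + t)) K 0 _ _ _ h; rewrite expr1; apply.
  - by rewrite addr0 subrr.
  - move=> t; have := is_derive_shift_fun (dg (x + t)) => H.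
    by apply: is_derive_eq; rewrite subr0.
  - by move=> t; rewrite expr0 mulr1.
have T2 (g g1 g2 : R -> R) : (forall x : R, is_derive x 1 g (g1 x)) ->
    (forall x : R, is_derive x 1 g1 (g2 x)) ->
    (forall x, `|g2 x| <= K) -> forall h, `|g (x + h) - g x - g1 x * h| <= K * `|h| ^+ 2.
  move=> dg dg1 g2K h; apply: (@growth_from_deriv
    (fun t => g (x + t) - g x - g1 x * t) (fun t => g1 (x + t) - g1 x) K 1).
  - by rewrite addr0 subrr mulr0 subrr.
  - move=> t; have := is_derive_shift_fun (dg (x + t)) => H.
    apply: is_derive_eq; rewrite /GRing.scale/=; ring.
  - by move=> t; rewrite expr1; apply: T1.
move=> h; split.
- by apply: T1 => // y; have [] := bd y.
- by apply: T2 => // y; have [] := bd y.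
- apply: (@growth_from_deriv
    (fun t => f (x + t) - f x - f1 x * t - f2 x / 2 * t ^+ 2)
    (fun t => f1 (x + t) - f1 x - f2 x * t) K 2).
  + by rewrite addr0 subrr mulr0 expr0n/= mulr0 !subr0.
  + move=> t; have := is_derive_shift_fun (d1 (x + t)) => H.
    by apply: is_derive_eq; rewrite /GRing.scale/=; field.
  + by move=> t; apply: (T2 f1 f2 f3) => // y; have [] := bd y.
Qed.

Lemma smooth3_continuous f f1 f2 f3 K : smooth3 f f1 f2 f3 K -> continuous f.
Proof.
move=> [d1 _ _ _] x; apply: differentiable_continuous; apply/derivable1_diffP.
exact: (@ex_derive _ _ _ _ _ _ _ (d1 x)).
Qed.

Lemma smooth3M f f1 f2 f3 K g g1 g2 g3 L :
  smooth3 f f1 f2 f3 K -> smooth3 g g1 g2 g3 L ->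
  smooth3 (fun x => f x * g x) (fun x => f1 x * g x + f x * g1 x)
    (fun x => f2 x * g x + 2 * (f1 x * g1 x) + f x * g2 x)
    (fun x => f3 x * g x + 3 * (f2 x * g1 x) + 3 * (f1 x * g2 x) + f x * g3 x)
    (8 * (K * L)).
Proof.
move=> [a1 a2 a3 ab] [b1 b2 b3 bb]; split.
- by move=> x; apply: is_derive_eq; rewrite /GRing.scale/=; ring.
- by move=> x; apply: is_derive_eq; rewrite /GRing.scale/=; ring.
- by move=> x; apply: is_derive_eq; rewrite /GRing.scale/=; ring.
move=> x; have [p0 p1 p2 p3] := ab x; have [q0 q1 q2 q3] := bb x.
have pq (a b : R) : `|a| <= K -> `|b| <= L -> `|a * b| <= K * L.
  by move=> aK bL; rewrite normrM ler_pM.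
have KL0 : 0 <= K * L by apply: le_trans (pq _ _ p0 q0).
have := pq _ _ p0 q0; have := pq _ _ p1 q0; have := pq _ _ p0 q1.
have := pq _ _ p2 q0; have := pq _ _ p1 q1; have := pq _ _ p0 q2.
have := pq _ _ p3 q0; have := pq _ _ p2 q1; have := pq _ _ p1 q2; have := pq _ _ p0 q3.
by rewrite !ler_norml => ? ? ? ? ? ? ? ? ? ?; split; lra.
Qed.

Lemma smooth3_onem f f1 f2 f3 K : smooth3 f f1 f2 f3 K ->
  smooth3 (fun x => 1 - f x) (fun x => - f1 x) (fun x => - f2 x) (fun x => - f3 x) (1 + K).
Proof.
move=> [a1 a2 a3 ab]; split.
- move=> x; rewrite (_ : (fun x => 1 - f x) = (cst 1 - f)); last exact/funext.
  by apply: is_derive_eq; rewrite sub0r.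
- by move=> x; exact: is_deriveN.
- by move=> x; exact: is_deriveN.
move=> x; have [p0 p1 p2 p3] := ab x; split.
- by rewrite (le_trans (ler_normB _ _))// normr1 lerD2l.
- by rewrite normrN ler_wpDl.
- by rewrite normrN ler_wpDl.
- by rewrite normrN ler_wpDl.
Qed.

Lemma smooth3_gauss (c : R) : 0 < c -> exists f1 f2 f3 K,
  smooth3 (fun x => expR (- (c * x ^+ 2))) f1 f2 f3 K.
Proof.
move=> c0; pose E x : R := expR (- (c * x ^+ 2)).
have dE (x : R) : is_derive x 1 E (- (2 * c * x) * E x) by exact: is_derive_expR_sqr.
have E1 x : E x <= 1.
  by rewrite -expR0 ler_expR oppr_le0 mulr_ge0 ?sqr_ge0// ltW.
have E0 x : 0 <= E x by exact: expR_ge0.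
(* The derivatives below are combinations of x^k E x with k <= 3. [C] bounds all these terms: x^4 E
   x <= 4 / c^2 by [sqr_le_expR], and |x|^3 <= 1 + x^4. *)
pose C := 1 + 4 / c ^+ 2.
have C1 : 1 <= C by rewrite lerDl divr_ge0// sqr_ge0.
have x3E x : `|x| ^+ 3 * E x <= C.
  have x4E : `|x| ^+ 4 * E x <= 4 / c ^+ 2.
    rewrite /E expRN ler_pdivrMr ?expR_gt0//.
    have := @sqr_le_expR R (c * x ^+ 2); rewrite (mulr_ge0 (ltW c0) (sqr_ge0 x)) => /(_ isT) H.
    have -> : `|x| ^+ 4 = (x ^+ 2) ^+ 2.
      by rewrite (_ : 4 = 2 * 2)%N// exprM real_normK ?num_real.
    rewrite mulrAC ler_pdivlMr ?exprn_gt0//.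
    rewrite [leLHS](_ : _ = 4 * ((c * x ^+ 2) ^+ 2 / 4)); last by field.
    by rewrite ler_pM2l.
  apply: (@le_trans _ _ ((1 + `|x| ^+ 4) * E x)).
    rewrite ler_wpM2r//; have [x1|x1] := lerP `|x| 1.
      by apply: ler_wpDr; rewrite ?exprn_ge0// exprn_ile1.
    by apply: ler_wpDl => //; rewrite ler_eXn2l// ltW.
  by rewrite mulrDl mul1r lerD.
have xE x k : (k <= 3)%N -> `|x| ^+ k * E x <= C.
  move=> k3; have [x1|/ltW x1] := lerP `|x| 1.
    rewrite (le_trans _ C1)// -[leRHS]mulr1 ler_pM// ?exprn_ge0//.
    by rewrite exprn_ile1.
  by apply: le_trans (x3E x); rewrite ler_wpM2r// ler_weXn2l.
exists (fun x => - (2 * c * x) * E x),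
  (fun x => (4 * c ^+ 2 * x ^+ 2 - 2 * c) * E x),
  (fun x => (12 * c ^+ 2 * x - 8 * c ^+ 3 * x ^+ 3) * E x),
  (C * (1 + 2 * c + 16 * c ^+ 2 + 8 * c ^+ 3)); split.
- by [].
- by move=> x; apply: is_derive_eq; rewrite /GRing.scale/=; ring.
- by move=> x; apply: is_derive_eq; rewrite /GRing.scale/=; ring.
move=> x.
have bd (a : R) k : `|a * x ^+ k * E x| = `|a| * (`|x| ^+ k * E x).
  by rewrite !normrM normrX (ger0_norm (E0 x)) mulrA.
have c2 : 0 <= c ^+ 2 by rewrite sqr_ge0.
have c3 : 0 <= c ^+ 3 by rewrite exprn_ge0// ltW.
have C0 : 0 <= C by rewrite (le_trans ler01 C1).
have Cc : 0 <= C * c := mulr_ge0 C0 (ltW c0).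
have Cc2 : 0 <= C * c ^+ 2 by rewrite mulr_ge0.
have Cc3 : 0 <= C * c ^+ 3 by rewrite mulr_ge0.
have B (a M : R) k : `|a| = M -> (k <= 3)%N -> `|a * x ^+ k * E x| <= M * C.
  by move=> aM k3; rewrite bd aM ler_wpM2l ?xE// -aM.
split.
- have := @B 1 1 0%N (normr1 _) isT; rewrite expr0 !mul1r -/(E x) => h.
  by apply: (le_trans h); lra.
- have := @B (2 * c) (2 * c) 1%N (ger0_norm (mulr_ge0 (ler0n _ 2) (ltW c0))) isT.
  by rewrite expr1 !mulNr normrN => h; apply: (le_trans h); lra.
- have h1 := @B (4 * c ^+ 2) (4 * c ^+ 2) 2%N (ger0_norm (mulr_ge0 (ler0n _ 4) c2)) isT.
  have h2 := @B (2 * c) (2 * c) 0%N (ger0_norm (mulr_ge0 (ler0n _ 2) (ltW c0))) isT.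
  rewrite expr0 mulr1 in h2; rewrite mulrBl; apply: (le_trans (ler_normB _ _)).
  by apply: (le_trans (lerD h1 h2)); lra.
- have h1 := @B (12 * c ^+ 2) (12 * c ^+ 2) 1%N (ger0_norm (mulr_ge0 (ler0n _ 12) c2)) isT.
  have h2 := @B (8 * c ^+ 3) (8 * c ^+ 3) 3%N (ger0_norm (mulr_ge0 (ler0n _ 8) c3)) isT.
  rewrite expr1 in h1; rewrite mulrBl; apply: (le_trans (ler_normB _ _)).
  by apply: (le_trans (lerD h1 h2)); lra.
Qed.

Definition logistic (l x : R) : R := (1 + expR (- (l * x)))^-1.

Lemma logistic_itv l x : 0 < logistic l x < 1.
Proof.
have e0 := expR_gt0 (- (l * x)).
by rewrite invr_gt0 addr_gt0//= invf_lt1 ?addr_gt0// ltrDl.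
Qed.

Lemma is_derive_logistic (l x : R) :
  is_derive x 1 (logistic l) (l * (logistic l x * (1 - logistic l x))).
Proof.
have e0 := expR_gt0 (- (l * x)).
have H : is_derive x 1 (fun y : R => - (l * y)) (- l).
  by apply: is_derive_eq; rewrite /GRing.scale/=; ring.
have H1 : is_derive x 1 (fun y : R => 1 + expR (- (l * y))) (- l * expR (- (l * x))).
  have H2 := @is_derive1_comp _ expR (fun y : R => - (l * y)) x _ _ (is_derive_expR _) H.
  have -> : (fun y : R => 1 + expR (- (l * y))) = (cst 1 + (expR \o (fun y : R => - (l * y)))).
    by apply/funext.
  by apply: is_derive_eq; rewrite add0r mulrC.
have nz : 1 + expR (- (l * x)) != 0 by rewrite gt_eqF// addr_gt0.
have H3 := @is_deriveV _ (fun y : R => 1 + expR (- (l * y))) x _ 1 nz H1.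
by apply: is_derive_eq; rewrite /GRing.scale/= /logistic; field.
Qed.

(** As s' = l s (1 - s), all derivatives are polynomials in s, which stays in (0, 1). The constant
    13 = 1 + 6 + 6 is a crude bound for 1 - 6 s + 6 s^2. *)
Lemma smooth3_logistic (l : R) : 0 < l -> exists f1 f2 f3 K,
  smooth3 (logistic l) f1 f2 f3 K.
Proof.
move=> l0; pose s := logistic l.
have ds (x : R) : is_derive x 1 s (l * (s x * (1 - s x))) by exact: is_derive_logistic.
exists (fun x => l * (s x * (1 - s x))),
  (fun x => l ^+ 2 * (s x * (1 - s x) * (1 - 2 * s x))),
  (fun x => l ^+ 3 * (s x * (1 - s x) * (1 - 6 * s x + 6 * s x ^+ 2))),
  (1 + l + l ^+ 2 + 13 * l ^+ 3); split => //.
- by move=> x; apply: is_derive_eq; rewrite /GRing.scale/=; ring.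
- by move=> x; apply: is_derive_eq; rewrite /GRing.scale/=; ring.
move=> x; have /andP[s0 s1] : 0 < s x < 1 := logistic_itv l x.
have l2 : 0 < l ^+ 2 by rewrite exprn_gt0.
have l3 : 0 < l ^+ 3 by rewrite exprn_gt0.
rewrite -/s; move: (s x) s0 s1 => t t0 t1.
have t2 : 0 <= t ^+ 2 <= t by rewrite sqr_ge0 expr2 ler_piMr// ltW.
have q : 0 <= t * (1 - t) <= 1 by rewrite mulr_ge0 ?subr_ge0 ?ltW//=; nra.
have bd (a b M : R) : 0 < a -> `|b| <= M -> `|a * b| <= a * M.
  by move=> a0 bM; rewrite normrM gtr0_norm// ler_pM2l.
have p1 : `|t * (1 - t)| <= 1 by rewrite ger0_norm; lra.
have p2 : `|t * (1 - t) * (1 - 2 * t)| <= 1.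
  rewrite normrM -[leRHS]mulr1 ler_pM//.
  by rewrite ler_norml; lra.
have p3 : `|t * (1 - t) * (1 - 6 * t + 6 * t ^+ 2)| <= 13.
  rewrite normrM -[leRHS]mul1r ler_pM//.
  by rewrite ler_norml; lra.
split.
- by rewrite ger0_norm; lra.
- by rewrite (le_trans (bd _ _ _ l0 p1))//; lra.
- by rewrite (le_trans (bd _ _ _ l2 p2))//; lra.
- by rewrite (le_trans (bd _ _ _ l3 p3))//; lra.
Qed.

End smooth3.

Section lindeberg.
Context {R : realType}.
Implicit Types mu nu : probability (R * R)%type R.

Lemma integrable_quadratic mu s rho (a b c e f g : R) : std_moments mu s rho ->
  mu.-integrable setT (EFin \o (fun y : R * R => a + b * y.1 + c * y.2 +
    e * y.1 ^+ 2 + f * (y.1 * y.2) + g * y.2 ^+ 2)).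
Proof.
move=> [m3 _ _].
apply: (integrable_moment3 m3 (C := `|a| + `|b| + `|c| + `|e| + `|f| + `|g|)).
  apply: measurable_funD; last by apply: measurable_funM => //; exact: measurable_funX.
  apply: measurable_funD; last by apply: measurable_funM => //; exact: measurable_funM.
  apply: measurable_funD; last by apply: measurable_funM => //; exact: measurable_funX.
  apply: measurable_funD; last exact: measurable_funM.
  by apply: measurable_funD => //; exact: measurable_funM.
move=> y; have [b1 b2 b3 b4 b5] := moment_bounds y.
rewrite !mulrDl; do 5 (apply: (le_trans (ler_normD _ _)); apply: lerD;
  last by rewrite normrM ler_wpM2l).
by rewrite ler_peMr// lerDl exprn_ge0// norm1_ge0.
Qed.

Lemma Rintegral_quadratic mu s rho (a b c e f g : R) : std_moments mu s rho ->
  \int[mu]_y (a + b * y.1 + c * y.2 + e * y.1 ^+ 2 + f * (y.1 * y.2) + g * y.2 ^+ 2)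
  = a + (e + g) * s.
Proof.
move=> H; have [m3 [m1 m2] [m11 m12 m22]] := H.
have int (h : R * R -> R) : measurable_fun setT h ->
    (forall y, `|h y| <= 1 + norm1 y ^+ 3) -> mu.-integrable setT (EFin \o h).
  by move=> mh hC; apply: (integrable_moment3 m3 (C := 1)) => // y; rewrite mul1r.
have i1 : mu.-integrable setT (EFin \o (fun y : R * R => y.1)).
  by apply: int => [|y]; [exact: measurable_fst|have [] := moment_bounds y].
have i2 : mu.-integrable setT (EFin \o (fun y : R * R => y.2)).
  by apply: int => [|y]; [exact: measurable_snd|have [] := moment_bounds y].
have ext (h h' : R * R -> R) : h =1 h' -> mu.-integrable setT (EFin \o h) ->
    mu.-integrable setT (EFin \o h') by move=> /funext ->.
have i11 : mu.-integrable setT (EFin \o (fun y : R * R => y.1 ^+ 2)).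
  by apply: int => [|y]; [exact: measurable_funX|have [] := moment_bounds y].
have i12 : mu.-integrable setT (EFin \o (fun y : R * R => y.1 * y.2)).
  by apply: int => [|y]; [exact: measurable_funM|have [] := moment_bounds y].
have i22 : mu.-integrable setT (EFin \o (fun y : R * R => y.2 ^+ 2)).
  by apply: int => [|y]; [exact: measurable_funX|have [] := moment_bounds y].
have part (p q r t w : R) : mu.-integrable setT (EFin \o (fun y : R * R =>
    p + q * y.1 + r * y.2 + t * y.1 ^+ 2 + w * (y.1 * y.2))).
  by apply: ext (integrable_quadratic p q r t w 0 H) => y; rewrite mul0r addr0.
rewrite RintegralD//; first last.
- by apply: ext (integrable_quadratic 0 0 0 0 0 g H) => y; rewrite !mul0r !add0r.
rewrite RintegralD//; first last.
- by apply: ext (part 0 0 0 0 f) => y; rewrite !mul0r !add0r.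
- by apply: ext (part a b c e 0) => y; rewrite !mul0r !addr0.
rewrite RintegralD//; first last.
- by apply: ext (part 0 0 0 e 0) => y; rewrite !mul0r !add0r addr0.
- by apply: ext (part a b c 0 0) => y; rewrite !mul0r !addr0.
rewrite RintegralD//; first last.
- by apply: ext (part 0 0 c 0 0) => y; rewrite !mul0r !add0r !addr0.
- by apply: ext (part a b 0 0 0) => y; rewrite !mul0r !addr0.
rewrite RintegralD//; first last.
- by apply: ext (part 0 b 0 0 0) => y; rewrite !mul0r !add0r !addr0.
- by apply: ext (part a 0 0 0 0) => y; rewrite !mul0r !addr0.
rewrite !RintegralZl// m1 m2 m11 m12 m22 Rintegral_cst//.
rewrite [X in fine X](_ : _ = 1%E) /=; last exact: probability_setT.
ring.
Qed.

Lemma taylor_product (u u1 u2 u3 : R -> R) K (v v1 v2 v3 : R -> R) L :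
  smooth3 u u1 u2 u3 K -> smooth3 v v1 v2 v3 L -> forall x y : R * R,
  `|u (x.1 + y.1) * v (x.2 + y.2) -
    (u x.1 * v x.2 + u1 x.1 * v x.2 * y.1 + u x.1 * v1 x.2 * y.2 +
     u2 x.1 * v x.2 / 2 * y.1 ^+ 2 + u1 x.1 * v1 x.2 * (y.1 * y.2) +
     u x.1 * v2 x.2 / 2 * y.2 ^+ 2)| <= K * L * norm1 y ^+ 3.
Proof.
move=> su sv [a b] [h k] /=.
have [U1 U2 U3] := smooth3_taylor su a h.
have [V1 V2 V3] := smooth3_taylor sv b k.
have [_ _ _ /(_ (a + h))[U0 _ _ _]] := su.
have [_ _ _ /(_ b)[V00 V01 V02 _]] := sv.
set U := u (a + h) in U0 U1 U2 U3 *; set V := v (b + k) in V1 V2 V3 *.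
(* Each Taylor term of order j in v meets a remainder of order 3 - j in u, so the four products are
   all of third order. *)
rewrite [X in `|X|](_ : _ = U * (V - v b - v1 b * k - v2 b / 2 * k ^+ 2) +
   (U - u a - u1 a * h) * (v1 b * k) + (U - u a) * (v2 b / 2 * k ^+ 2) +
   v b * (U - u a - u1 a * h - u2 a / 2 * h ^+ 2)); last by field.
rewrite /norm1 /=; move: (normr_ge0 h) (normr_ge0 k).
have K0 : 0 <= K by exact: le_trans (normr_ge0 _) U0.
have L0 : 0 <= L by exact: le_trans (normr_ge0 _) V00.
set p := `|h| in U1 U2 U3 *; set q := `|k| in V1 V2 V3 * => p0 q0.
have KL0 : 0 <= K * L by exact: mulr_ge0.
apply: (@le_trans _ _ (K * (L * q ^+ 3) + K * p ^+ 2 * (L * q) +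
    K * p * (L * q ^+ 2) + L * (K * p ^+ 3))).
  apply: (le_trans (ler_normD _ _)); apply: lerD; last by rewrite normrM ler_pM.
  apply: (le_trans (ler_normD _ _)); apply: lerD; last first.
    rewrite normrM ler_pM// normrM normrX -/q ler_wpM2r ?exprn_ge0//.
    rewrite normrM (ger0_norm (_ : 0 <= 2^-1 :> R))//.
    by rewrite ler_pdivrMr// (le_trans V02)// mulr_natr mulr2n lerDl.
  apply: (le_trans (ler_normD _ _)); apply: lerD; first by rewrite normrM ler_pM.
  by rewrite normrM ler_pM// normrM ler_wpM2r.
rewrite -subr_ge0 [leRHS](_ : _ = K * L * (2 * p ^+ 2 * q + 2 * p * q ^+ 2)); last by ring.
by rewrite mulr_ge0// addr_ge0// !mulr_ge0// exprn_ge0.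
Qed.

Lemma measurable_product (u v : R -> R) : continuous u -> continuous v ->
  measurable_fun setT (fun z : R * R => u z.1 * v z.2).
Proof.
move=> cu cv; apply: measurable_funM.
  by apply: measurableT_comp => //; exact: continuous_measurable_fun.
by apply: measurableT_comp => //; exact: continuous_measurable_fun.
Qed.

(** The quadratic Taylor polynomial integrates to a value that depends on the law through [s] only.
    The real-valued [r] lets two laws be compared outside the extended reals. *)
Lemma convol_taylor mu s rho (u u1 u2 u3 : R -> R) K (v v1 v2 v3 : R -> R) L :
  smooth3 u u1 u2 u3 K -> smooth3 v v1 v2 v3 L -> std_moments mu s rho ->
  exists2 r : R -> R -> R, forall x, convol mu (fun z => (u z.1 * v z.2)%:E) x = (r x.1 x.2)%:E &
    forall x, `|r x.1 x.2 - (u x.1 * v x.2 + (u2 x.1 * v x.2 / 2 + u x.1 * v2 x.2 / 2) * s)|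
      <= K * L * rho.
Proof.
move=> su sv H.
have mF := measurable_product (smooth3_continuous su) (smooth3_continuous sv).
have [_ _ _ bu] := su; have [_ _ _ bv] := sv.
have iF x : mu.-integrable setT (EFin \o (fun y : R * R => u (x.1 + y.1) * v (x.2 + y.2))).
  have [m3 _ _] := H; apply: (integrable_moment3 m3 (C := K * L)).
    exact: (measurableT_comp mF (measurable_plane_translate x)).
  move=> y; have [u0 _ _ _] := bu (x.1 + y.1); have [v0 _ _ _] := bv (x.2 + y.2).
  rewrite normrM; apply: (@le_trans _ _ (K * L)); first by rewrite ler_pM.
  have KL0 : 0 <= K * L by apply: mulr_ge0; [exact: le_trans u0|exact: le_trans v0].
  by rewrite ler_peMr// lerDl exprn_ge0// norm1_ge0.
exists (fun a b => \int[mu]_y (u (a + y.1) * v (b + y.2))) => x.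
  by rewrite /convol fineK//; exact: (integrable_fin_num measurableT (iF x)).
set Q := (fun y : R * R => u x.1 * v x.2 + u1 x.1 * v x.2 * y.1 + u x.1 * v1 x.2 * y.2 +
     u2 x.1 * v x.2 / 2 * y.1 ^+ 2 + u1 x.1 * v1 x.2 * (y.1 * y.2) +
     u x.1 * v2 x.2 / 2 * y.2 ^+ 2).
have iQ : mu.-integrable setT (EFin \o Q) by exact: integrable_quadratic H.
rewrite -(Rintegral_quadratic (u x.1 * v x.2) (u1 x.1 * v x.2) (u x.1 * v1 x.2)
  _ (u1 x.1 * v1 x.2) _ H) -/Q -(RintegralB _ (iF x) iQ)//.
rewrite -lee_fin EFin_normr_Rintegral//; last exact: (integrableB _ (iF x) iQ).
have [m3 _ _] := H; have KL0 : 0 <= K * L.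
  have [u0 _ _ _] := bu 0; have [v0 _ _ _] := bv 0.
  by apply: mulr_ge0; [exact: le_trans u0|exact: le_trans v0].
have mD : measurable_fun setT (fun y : R * R => u (x.1 + y.1) * v (x.2 + y.2) - Q y).
  by have /measurable_int/measurable_EFinP := integrableB measurableT (iF x) iQ.
have mn3 : measurable_fun [set: R * R] (fun y => (norm1 y ^+ 3)%:E).
  by apply/measurable_EFinP/measurable_funX; exact: measurable_norm1.
apply: (le_trans (le_abse_integral _ measurableT _)); first exact/measurable_EFinP.
apply: (@le_trans _ _ (\int[mu]_y ((K * L)%:E * (norm1 y ^+ 3)%:E))%E).
  apply: ge0_le_integral => //.
  - by do 2 apply: measurableT_comp => //.
  - exact: measurable_funeM.
  - by move=> y _; rewrite -EFinM abse_EFin lee_fin; exact: (taylor_product su sv x y).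
rewrite ge0_integralZl//; first by rewrite (EFinM (K * L)) lee_wpmul2l// lee_fin.
by move=> y _; rewrite lee_fin exprn_ge0// norm1_ge0.
Qed.

(** One replacement step: laws with the same first and second moments share the quadratic part,
    which leaves the third moments. *)
Lemma convol_compare mu nu s rho rho' (u u1 u2 u3 : R -> R) K (v v1 v2 v3 : R -> R) L :
  smooth3 u u1 u2 u3 K -> smooth3 v v1 v2 v3 L ->
  std_moments mu s rho -> std_moments nu s rho' -> forall x,
  (convol mu (fun z => (u z.1 * v z.2)%:E) x <=
   convol nu (fun z => (u z.1 * v z.2)%:E) x + (K * L * (rho + rho'))%:E)%E.
Proof.
move=> su sv hmu hnu x.
have [r rE rB] := convol_taylor su sv hmu; have [r' rE' rB'] := convol_taylor su sv hnu.
rewrite rE rE' -EFinD lee_fin.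
have := rB x; have := rB' x; rewrite !ler_norml => /andP[a1 a2] /andP[b1 b2].
rewrite mulrDr; lra.
Qed.

End lindeberg.

Section smooth_clt.
Local Open Scope ereal_scope.
Context d (T : measurableType d) (R : realType) (P : probability T R).
Variables (W : nat -> {RV P >-> (R * R)%type}) (rho : R).
Hypotheses (iW : mutually_independent W) (dW : identically_distributed W)
  (mW : std_moments (distribution P (W 0%N)) 1 rho).

Definition normalized_sum n w : R * R :=
  plane_scale (Num.sqrt n%:R)^-1 (rv_sum W n w).

Lemma measurable_normalized_sum n : measurable_fun setT (normalized_sum n).
Proof.
apply: measurableT_comp; first exact: measurable_plane_scale.
exact: measurable_rv_sum.
Qed.

Lemma integral_normalized_sum n (h : R * R -> \bar R) :
  measurable_fun setT h -> (forall x, 0 <= h x) ->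
  \int[P]_w h (normalized_sum n w) =
  iter n (convol (scaled (distribution P (W 0%N)) (Num.sqrt n%:R)^-1)) h 0%R.
Proof.
move=> mh h0; set a := ((Num.sqrt n%:R)^-1)%R.
pose Y := comp_rv W (measurable_plane_scale a).
have YE w : normalized_sum n w = (0 + rv_sum Y n w)%R.
  rewrite add0r /normalized_sum /rv_sum -/a; elim: (n) => [|k IH].
    by rewrite !big_ord0 /plane_scale /= mulr0.
  by rewrite !big_ord_recr /= -IH /plane_scale /= !mulrDr.
under eq_integral do rewrite YE.
rewrite (integral_rv_sum (mutually_independent_comp (measurable_plane_scale a) iW)
  (identically_distributed_comp (measurable_plane_scale a) dW))//.
Qed.

Lemma smooth_clt (u u1 u2 u3 : R -> R) K (v v1 v2 v3 : R -> R) L :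
  smooth3 u u1 u2 u3 K -> smooth3 v v1 v2 v3 L ->
  (forall x, 0 <= u x)%R -> (forall x, 0 <= v x)%R ->
  exists2 C, (0 <= C)%R & forall n,
    let f := fun z : R * R => (u z.1 * v z.2)%:E in
    \int[P]_w f (normalized_sum n.+1 w) <=
      \int[gaussp]_z f z + (C / Num.sqrt n.+1%:R)%:E /\
    \int[gaussp]_z f z <=
      \int[P]_w f (normalized_sum n.+1 w) + (C / Num.sqrt n.+1%:R)%:E.
Proof.
move=> su sv u0 v0.
have [rho' mG] := @gaussp_moments R.
have K0 : (0 <= K)%R by have [_ _ _ /(_ 0%R)[k _ _ _]] := su; exact: le_trans k.
have L0 : (0 <= L)%R by have [_ _ _ /(_ 0%R)[k _ _ _]] := sv; exact: le_trans k.
have rho0 mu s r : @std_moments R mu s r -> (0 <= r)%R.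
  move=> [+ _ _]; rewrite -lee_fin; apply: le_trans; apply: integral_ge0 => y _.
  by rewrite lee_fin exprn_ge0// norm1_ge0.
have r0 := rho0 _ _ _ mW; have r0' := rho0 _ _ _ mG.
exists (K * L * (rho + rho'))%R; first by rewrite !mulr_ge0// addr_ge0.
move=> n f; set a := ((Num.sqrt n.+1%:R)^-1)%R.
have s0 : (0 < Num.sqrt n.+1%:R :> R)%R by rewrite sqrtr_gt0.
have a0 : (0 < a)%R by rewrite invr_gt0.
(* Each of the n + 1 replacements costs a multiple of a^3 with a = (n + 1)^(-1/2), hence a multiple
   of a in total. *)
have a2 : (n.+1%:R * a ^+ 3 = a)%R.
  rewrite /a -[X in (X * _)%R](sqr_sqrtr (ler0n _ n.+1)); field.
  by rewrite gt_eqF.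
have a30 : (0 <= a ^+ 3)%R by rewrite exprn_ge0// ltW.
have C0 (r1 r2 : R) : (0 <= r1 -> 0 <= r2 ->
    0 <= K * L * (a ^+ 3 * r1 + a ^+ 3 * r2))%R.
  move=> h1 h2; exact: (mulr_ge0 (mulr_ge0 K0 L0)
    (addr_ge0 (mulr_ge0 a30 h1) (mulr_ge0 a30 h2))).
have E (r1 r2 : R) : (n.+1%:R * (K * L * (a ^+ 3 * r1 + a ^+ 3 * r2)) =
    K * L * (r1 + r2) * a)%R.
  transitivity (K * L * (r1 + r2) * (n.+1%:R * a ^+ 3))%R; last by rewrite a2.
  by set N := n.+1%:R; ring.
have mf : measurable_fun setT f.
  apply/measurable_EFinP.
  exact: (measurable_product (smooth3_continuous su) (smooth3_continuous sv)).
have f0 x : 0 <= f x by rewrite lee_fin mulr_ge0.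
have sW := scaled_moments (ltW a0) mW; have sG := scaled_moments (ltW a0) mG.
(* The Gaussian steps of scale a compose to one of scale sqrt(n + 1) a = 1: after all replacements
   the law is the limit law itself. *)
have GE : iter n.+1 (convol (scaled gaussp a)) f 0%R = \int[gaussp]_z f z.
  apply: (etrans (congr1 (fun h => h 0%R) (iter_convol_gaussp n a0 mf f0))).
  have -> : (Num.sqrt n.+1%:R * a = 1)%R by apply: mulfV; rewrite gt_eqF.
  have mf0 : measurable_fun setT (fun z : R * R => f (0 + z)%R).
    exact: (measurableT_comp mf (measurable_plane_translate 0%R)).
  apply: (etrans (ge0_integral_scaled gaussp 1 mf0 (fun z => f0 (0 + z)%R))).
  apply: eq_integral => z _; rewrite add0r /plane_scale !mul1r.
  by case: z.
rewrite (integral_normalized_sum n.+1 mf f0) -/a -GE; split.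
- have := iter_convol_swap n.+1 mf f0 (C0 _ _ r0 r0') (convol_compare su sv sW sG) 0%R.
  by rewrite E.
- have := iter_convol_swap n.+1 mf f0 (C0 _ _ r0' r0) (convol_compare su sv sG sW) 0%R.
  by rewrite E (addrC rho').
Qed.

End smooth_clt.

(** * Convergence in law of the half-space statistic *)

Lemma cst_div_sqrtn_le (R : realType) (C e : R) : 0 <= C -> 0 < e ->
  exists N : nat, forall n, (N <= n)%N -> (0 < n)%N /\ C / Num.sqrt n%:R <= e.
Proof.
move=> C0 e0; exists (Num.truncn ((C / e) ^+ 2)).+1 => n Nn.
have n0 : (0 < n)%N by exact: leq_trans Nn.
split => //; rewrite ler_pdivrMr ?sqrtr_gt0 ?ltr0n// mulrC -ler_pdivrMr//.
have Ce0 : 0 <= C / e by rewrite divr_ge0// ltW.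
rewrite -(ger0_norm Ce0) -sqrtr_sqr ler_sqrt ?ler0n//.
apply: (le_trans (ltW (truncnS_gt _)));
  by rewrite ler_nat.
Qed.

Section laplace_clt.
Context {R : realType}.

(* A smooth approximation of expR (- (c * max(x, 0) ^ 2)), in which a steep logistic
   function replaces the indicator function of the positive half-line. *)
Definition smooth_half_gauss (c l x : R) : R :=
  1 - (1 - expR (- (c * x ^+ 2))) * logistic l x.

Lemma smooth_half_gauss_ge0 c l x : 0 <= c -> 0 <= smooth_half_gauss c l x.
Proof.
move=> c0; have /andP[s0 s1] := logistic_itv l x.
have e0 := expR_gt0 (- (c * x ^+ 2)).
have e1 : expR (- (c * x ^+ 2)) <= 1.
  by rewrite -expR0 ler_expR oppr_le0 mulr_ge0// sqr_ge0.
by rewrite subr_ge0 mulr_ile1 ?subr_ge0// ?(ltW s0) ?(ltW s1)// lerBlDr lerDl ltW.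
Qed.

Lemma smooth3_half_gauss c l : 0 < c -> 0 < l -> exists f1 f2 f3 K,
  smooth3 (smooth_half_gauss c l) f1 f2 f3 K.
Proof.
move=> c0 l0; have [g1 [g2 [g3 [K sg]]]] := smooth3_gauss c0.
have [h1 [h2 [h3 [L sh]]]] := smooth3_logistic l0.
by do 4 eexists; exact: smooth3_onem (smooth3M (smooth3_onem sg) sh).
Qed.

(** The error is 1 - exp(- c x^2) <= c x^2 times the distance of the logistic function from the step
    function, which is at most exp(- l |x|); and y^2 exp(- l y) <= 4 / l^2 for y >= 0. *)
Lemma smooth_half_gauss_approx c l x : 0 < c -> 0 < l ->
  `|smooth_half_gauss c l x - expR (- (c * Num.max x 0 ^+ 2))| <= 4 * c / l ^+ 2.
Proof.
move=> c0 l0; rewrite /smooth_half_gauss.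
have e1 : 0 <= 1 - expR (- (c * x ^+ 2)) <= c * x ^+ 2.
  rewrite subr_ge0 -expR0 ler_expR oppr_le0 mulr_ge0 ?sqr_ge0 ?(ltW c0)//=.
  by rewrite lerBlDr -lerBlDl expR0 (le_trans _ (expR_ge1Dx _)).
have dec y : 0 <= y -> c * y ^+ 2 * expR (- (l * y)) <= 4 * c / l ^+ 2.
  move=> y0; have ly : 0 <= l * y by rewrite mulr_ge0// ltW.
  rewrite expRN ler_pdivrMr ?expR_gt0// mulrAC ler_pdivlMr ?exprn_gt0//.
  have := sqr_le_expR ly; rewrite ler_pdivrMr// exprMn => H.
  rewrite [leLHS](_ : _ = c * (l ^+ 2 * y ^+ 2)); last by ring.
  by rewrite [leRHS](_ : _ = c * (expR (l * y) * 4)); [rewrite ler_pM2l|ring].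
have q y : 0 < (1 + expR (- (l * y)))^-1 by rewrite invr_gt0 addr_gt0// expR_gt0.
have [x0|x0] := leP 0 x.
  rewrite [X in `|X|](_ : _ = (1 - expR (- (c * x ^+ 2))) * (1 - logistic l x)); last by ring.
  have -> : 1 - logistic l x = expR (- (l * x)) / (1 + expR (- (l * x))).
    by rewrite /logistic; field; rewrite gt_eqF// addr_gt0// expR_gt0.
  rewrite ger0_norm; last first.
    by rewrite mulr_ge0 ?divr_ge0 ?expR_ge0 ?(andP e1).1// addr_ge0 ?expR_ge0.
  apply: (le_trans _ (dec x x0)); rewrite ler_pM ?(andP e1).1 ?(andP e1).2//.
  by rewrite ler_piMr ?expR_ge0// invf_le1 ?addr_gt0 ?expR_gt0// lerDl expR_ge0.
have -> : expR (- (c * 0 ^+ 2)) = 1 :> R by rewrite expr0n mulr0 oppr0 expR0.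
rewrite addrAC subrr sub0r normrN ger0_norm; last first.
  by rewrite mulr_ge0 ?(ltW (q _))// (andP e1).1.
have := dec (- x); rewrite oppr_ge0 (ltW x0) sqrrN mulrN opprK => /(_ isT).
apply: le_trans; rewrite ler_pM ?(andP e1).1 ?(andP e1).2// ?(ltW (q _))//.
rewrite /logistic expRN -[X in (X + _)^-1](mulVf (lt0r_neq0 (expR_gt0 (l * x)))).
rewrite -[X in (_ + X)^-1]mulr1 -mulrDr invfM invrK.
by rewrite ler_piMr ?expR_ge0// invf_le1 ?addr_gt0 ?expR_gt0// lerDr expR_ge0.
Qed.

Lemma integral_le_cst d (T : measurableType d) (mu : probability T R)
    (f g : T -> R) (k : R) :
  measurable_fun setT f -> measurable_fun setT g -> 0 <= k ->
  (forall x, 0 <= f x) -> (forall x, 0 <= g x) -> (forall x, f x <= g x + k) ->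
  (\int[mu]_x (f x)%:E <= \int[mu]_x (g x)%:E + k%:E)%E.
Proof.
move=> mf mg k0 f0 g0 fg.
rewrite -[X in (_ <= _ + X)%E](integral_cst_probability mu) -ge0_integralD//; last first.
- by apply/measurable_EFinP.
- by move=> x _; rewrite lee_fin.
apply: ge0_le_integral => //.
- by move=> x _; rewrite lee_fin.
- exact/measurable_EFinP.
- by apply/measurable_EFinP; exact: measurable_funD.
- by move=> x _; rewrite -EFinD lee_fin.
Qed.

(** The exponential turns the sum in [chi_stat] into a product of functions of one coordinate, the
    form that [smooth_clt] accepts after smoothing. *)
Definition laplace_kernel (c : R) (z : R * R) : R := expR (- (c * chi_stat z)).

Lemma measurable_laplace_kernel c : measurable_fun setT (laplace_kernel c).
Proof.
apply: measurableT_comp => //; apply: measurableT_comp => //.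
by apply: measurable_funM => //; exact: measurable_chi_stat.
Qed.

Lemma laplace_kernelE c z : laplace_kernel c z =
  expR (- (c * Num.max z.1 0 ^+ 2)) * expR (- (c * z.2 ^+ 2)).
Proof. by rewrite /laplace_kernel /chi_stat mulrDr opprD expRD. Qed.

Lemma EFin_Rintegral_le1 d (T : measurableType d) (mu : probability T R) (h : T -> R) :
  measurable_fun setT h -> (forall x, 0 <= h x) -> (forall x, h x <= 1) ->
  (\int[mu]_x (h x)%:E)%E = (\int[mu]_x h x)%:E.
Proof.
move=> mh h0 h1; rewrite fineK// ge0_fin_numE; last first.
  by apply: integral_ge0 => x _; rewrite lee_fin.
apply: (@le_lt_trans _ _ (\int[mu]_x 1%:E)%E).
  apply: ge0_le_integral => //.
  - by move=> x _; rewrite lee_fin.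
  - exact/measurable_EFinP.
  - by move=> x _; rewrite lee_fin.
by rewrite (integral_cst_probability mu 1%:E) ltry.
Qed.

Lemma laplace_clt d (T : measurableType d) (P : probability T R)
    (W : nat -> {RV P >-> (R * R)%type}) (rho c : R) :
  mutually_independent W -> identically_distributed W ->
  std_moments (distribution P (W 0%N)) 1 rho -> 0 < c ->
  \int[P]_w laplace_kernel c (normalized_sum W n w) @[n --> \oo] -->
  \int[gaussp]_z laplace_kernel c z.
Proof.
move=> iW dW mW c0.
have mF := measurable_laplace_kernel c.
have F0 z : 0 <= laplace_kernel c z by exact: expR_ge0.
have F1 z : laplace_kernel c z <= 1.
  by rewrite -expR0 ler_expR oppr_le0 mulr_ge0 ?(ltW c0)// addr_ge0 ?sqr_ge0.
apply/cvgrPdist_le => e e0.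
(* With q = 16 c / e, 4 c = (e / 4) q and q <= (1 + q)^2. Two smoothing errors of e / 4 and a
   replacement error of e / 2 make up e. *)
have [l l0 le] : exists2 l : R, 0 < l & 4 * c / l ^+ 2 <= e / 4.
  exists (1 + 16 * c / e); first by rewrite ltr_pwDl// divr_ge0 ?mulr_ge0 ?ltW.
  have q0 : 0 < 16 * c / e by rewrite !divr_gt0 ?mulr_gt0.
  rewrite ler_pdivrMr ?exprn_gt0 ?addr_gt0//.
  have -> : 4 * c = e / 4 * (16 * c / e) by field; rewrite gt_eqF.
  rewrite ler_pM2l ?divr_gt0// expr2 mulrDl mul1r.
  by move: (16 * c / e) q0 => q q0; nra.
pose u := smooth_half_gauss c l; pose v x := expR (- (c * x ^+ 2)) : R.
have [u1 [u2 [u3 [K su]]]] := smooth3_half_gauss c0 l0.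
have [v1 [v2 [v3 [L sv]]]] := smooth3_gauss c0.
have u0 x : 0 <= u x by apply: smooth_half_gauss_ge0; exact: ltW.
have v0 x : 0 <= v x by exact: expR_ge0.
have [C C0 H] := smooth_clt iW dW mW su sv u0 v0.
have mf : measurable_fun setT (fun z : R * R => u z.1 * v z.2).
  exact: (measurable_product (smooth3_continuous su) (smooth3_continuous sv)).
have close z : `|u z.1 * v z.2 - laplace_kernel c z| <= e / 4.
  rewrite laplace_kernelE -mulrBl normrM (ger0_norm (v0 _)).
  apply: (@le_trans _ _ (4 * c / l ^+ 2 * 1)); last by rewrite mulr1.
  apply: ler_pM => //; first exact: smooth_half_gauss_approx.
  by rewrite -expR0 ler_expR oppr_le0 mulr_ge0 ?sqr_ge0// ltW.
have e4 : 0 <= e / 4 by rewrite divr_ge0// ltW.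
have c1 z : laplace_kernel c z <= u z.1 * v z.2 + e / 4.
  by have := close z; rewrite ler_norml => /andP[? ?]; lra.
have c2 z : u z.1 * v z.2 <= laplace_kernel c z + e / 4.
  by have := close z; rewrite ler_norml => /andP[? ?]; lra.
have f0 z : 0 <= u z.1 * v z.2 by rewrite mulr_ge0.
have [N CN] := cst_div_sqrtn_le C0 (divr_gt0 e0 (ltr0n _ 2)).
exists N.+1 => //= -[//|n] /= Nn.
have mZ := measurable_normalized_sum W n.+1.
have {CN}[_ CN] := CN n.+1 (ltnW Nn); have [H1 H2] := H n; set r := C / _ in CN H1 H2.
have FE1 := EFin_Rintegral_le1 P (measurableT_comp mF mZ) (fun=> F0 _) (fun=> F1 _).
have FE2 := EFin_Rintegral_le1 gaussp mF F0 F1.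
have a1 := integral_le_cst gaussp mF mf e4 F0 f0 c1.
have a2 := integral_le_cst gaussp mf mF e4 f0 F0 c2.
have a3 := integral_le_cst P (measurableT_comp mF mZ) (measurableT_comp mf mZ) e4
  (fun=> F0 _) (fun=> f0 _) (fun=> c1 _).
have a4 := integral_le_cst P (measurableT_comp mf mZ) (measurableT_comp mF mZ) e4
  (fun=> f0 _) (fun=> F0 _) (fun=> c2 _).
rewrite /= FE1 in a3 a4; rewrite FE2 in a1 a2; move: a1 a2 a3 a4 H1 H2.
set G := (\int[gaussp]_z laplace_kernel c z)%R.
set p := (\int[P]_w laplace_kernel c _)%R => a1 a2 a3 a4 H1 H2.
have b1 : p <= G + e / 4 + r + e / 4.
  rewrite -lee_fin !EFinD; apply: (le_trans a3); apply: leeD => //.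
  by apply: (le_trans H1); exact: leeD.
have b2 : G <= p + e / 4 + r + e / 4.
  rewrite -lee_fin !EFinD; apply: (le_trans a1); apply: leeD => //.
  by apply: (le_trans H2); exact: leeD.
by rewrite ler_norml; apply/andP; split; lra.
Qed.

End laplace_clt.

Section cdf_clt.
Context {R : realType}.

Lemma bernoulli_inequality (a : R) M : 0 <= a <= 1 -> 1 - M%:R * a <= (1 - a) ^+ M.
Proof.
move=> /andP[a0 a1]; elim: M => [|M IH]; first by rewrite mul0r subr0 expr0.
rewrite exprSr; apply: (@le_trans _ _ ((1 - M%:R * a) * (1 - a))); last first.
  by rewrite ler_wpM2r// subr_ge0.
have : 0 <= M%:R * a * a by rewrite !mulr_ge0.
by rewrite -natr1; lra.
Qed.

(* A polynomial close to 1 above 1/2 and to 0 below 1/2, as in Bernstein's or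
   Brosowski and Deutsch's proof of the Stone-Weierstrass theorem. *)
Definition step_poly N : {poly R} := 1 - (1 - 'X^N) ^+ (2 ^ N).

Lemma step_polyE N y : (step_poly N).[y] = 1 - (1 - y ^+ N) ^+ (2 ^ N).
Proof. by rewrite /step_poly !hornerE. Qed.

Lemma step_poly_itv N y : 0 <= y <= 1 -> 0 <= (step_poly N).[y] <= 1.
Proof.
move=> /andP[y0 y1]; rewrite step_polyE.
have yN0 : 0 <= y ^+ N by rewrite exprn_ge0.
have yN1 : y ^+ N <= 1 by rewrite exprn_ile1.
by rewrite subr_ge0 exprn_ile1 ?subr_ge0//= ?lerBlDr ?lerDl// exprn_ge0// subr_ge0.
Qed.

Lemma exponential_step (s r dl : R) : 0 <= s -> s < r -> 0 < dl ->
  exists c, exists2 N, 0 < c & forall x, 0 <= x ->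
    let q := (step_poly N).[expR (- (c * x))] in
    (x <= s -> 1 - dl <= q) /\ (r < x -> q <= dl).
Proof.
(* t is the midpoint of s and r, and the rate c = ln 2 / t gives exp(- c t) = 1/2. Then 2^N y^N =
   exp(N ln 2 (1 - x / t)) is at least exp(N k) for x <= s and at most exp(- N k) for x > r. *)
move=> s0 sr dl0; have [t t0 rE] : exists2 t, 0 < t & r = 2 * t - s.
  by exists ((s + r) / 2); [lra|field].
have l2 : 0 < ln 2 :> R by rewrite ln_gt0// ltr1n.
have [k k0 kE] : exists2 k, 0 < k & k = ln 2 * ((r - s) / (2 * t)).
  by exists (ln 2 * ((r - s) / (2 * t))); rewrite // mulr_gt0// divr_gt0 ?subr_gt0// mulr_gt0.
have [N N0 Nk] : exists2 N, (0 < N)%N & dl^-1 <= N%:R * k.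
  exists (Num.truncn (dl * k)^-1).+1 => //.
  by rewrite -ler_pdivrMr// -invfM; exact/ltW/truncnS_gt.
have Nk0 : 0 < N%:R * k by rewrite mulr_gt0// ltr0n.
have tE (x : R) : ln 2 * (1 - x / t) = k + ln 2 * ((s - x) / t).
  by rewrite kE rE; field; rewrite gt_eqF.
have tE' (x : R) : ln 2 * (1 - x / t) = - k - ln 2 * ((x - r) / t).
  by rewrite kE rE; field; rewrite gt_eqF.
exists (ln 2 / t), N; first by rewrite divr_gt0.
move=> x x0; rewrite /= step_polyE.
set y := expR _; have y01 : 0 <= y ^+ N <= 1.
  rewrite exprn_ge0 ?expR_ge0//= exprn_ile1 ?expR_ge0//.
  by rewrite -expR0 ler_expR oppr_le0 mulr_ge0// divr_ge0// ltW.
have Ma : (2 ^ N)%:R * y ^+ N = expR (N%:R * (ln 2 * (1 - x / t))).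
  rewrite natrX -[X in X ^+ _ * _](@lnK _ 2) ?posrE//.
  by rewrite /y -!expRM_natl -expRD; congr expR; field; rewrite gt_eqF.
split => [xs|rx].
(* With M = 2^N and a = y^N: (1 - a)^M <= exp(- M a), and exp(M a) >= M a >= N k >= 1 / dl. *)
- rewrite lerD2l lerN2; apply: (@le_trans _ _ (expR (- ((2 ^ N)%:R * y ^+ N)))).
    rewrite -mulrN expRM_natl lerXn2r ?nnegrE ?subr_ge0 ?expR_ge0 ?(andP y01).2//.
    exact: expR_ge1Dx.
  rewrite expRN -[leRHS]invrK lef_pV2 ?posrE ?expR_gt0 ?invr_gt0//.
  apply: (le_trans Nk); apply: le_trans (_ : expR (N%:R * k) <= _).
    by apply: le_trans (expR_ge1Dx _); rewrite lerDr.
  apply: (@le_trans _ _ ((2 ^ N)%:R * y ^+ N)).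
    rewrite Ma ler_expR ler_wpM2l// tE lerDl mulr_ge0 ?(ltW l2)//.
    by rewrite divr_ge0 ?subr_ge0// ltW.
  by apply: le_trans (expR_ge1Dx _); rewrite lerDr.
(* By Bernoulli's inequality 1 - (1 - a)^M <= M a, and here M a <= exp(- N k) <= dl. *)
- apply: (@le_trans _ _ ((2 ^ N)%:R * y ^+ N)).
    by have := bernoulli_inequality (2 ^ N) y01; lra.
  rewrite Ma; apply: (@le_trans _ _ (expR (- (N%:R * k)))).
    rewrite ler_expR -[leRHS]mulrN ler_wpM2l// tE' gerDl oppr_le0 mulr_ge0 ?(ltW l2)//.
    by rewrite divr_ge0 ?subr_ge0// ltW.
  rewrite expRN -[leRHS]invrK lef_pV2 ?posrE ?expR_gt0 ?invr_gt0//.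
  by apply: (le_trans Nk); apply: le_trans (expR_ge1Dx _); rewrite lerDr.
Qed.

Lemma integrable_bounded d (T : measurableType d) (mu : probability T R) (f : T -> R) B :
  measurable_fun setT f -> (forall x, `|f x| <= B) -> mu.-integrable setT (EFin \o f).
Proof.
move=> mf fB; apply: measurable_bounded_integrable => //.
  by apply: le_lt_trans (probability_le1 mu measurableT) _; rewrite ltry.
exists B; split; first exact: num_real.
by move=> C BC x _; exact: le_trans (fB x) (ltW BC).
Qed.

Lemma laplace_kernel_itv c (z : R * R) : 0 <= c -> 0 <= laplace_kernel c z <= 1.
Proof.
move=> c0; rewrite expR_ge0/= -expR0 ler_expR oppr_le0 mulr_ge0//.
by rewrite addr_ge0// sqr_ge0.
Qed.

Lemma laplace_kernelX c (z : R * R) k : laplace_kernel c z ^+ k = laplace_kernel (k%:R * c) z.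
Proof. by rewrite /laplace_kernel -expRM_natl mulrN mulrA. Qed.

Section poly.
Context d (T : measurableType d) (P : probability T R).
Variables (W : nat -> {RV P >-> (R * R)%type}) (rho : R).
Hypotheses (iW : mutually_independent W) (dW : identically_distributed W)
  (mW : std_moments (distribution P (W 0%N)) 1 rho).

Lemma measurable_horner (p : {poly R}) : measurable_fun setT (fun y => p.[y]).
Proof. by apply: continuous_measurable_fun; exact: continuous_horner. Qed.

(* The powers of a Laplace kernel are Laplace kernels. *)
Lemma poly_clt c (p : {poly R}) : 0 < c ->
  \int[P]_w p.[laplace_kernel c (normalized_sum W n w)] @[n --> \oo] -->
  \int[gaussp]_z p.[laplace_kernel c z].
Proof.
move=> c0.
have mk (a : R) k : measurable_fun setT (fun z : R * R => a * laplace_kernel c z ^+ k).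
  by apply: measurable_funM => //; apply: measurable_funX; exact: measurable_laplace_kernel.
have ms (a : nat -> R) n : measurable_fun setT
    (fun z : R * R => \sum_(i < n) a i * laplace_kernel c z ^+ i).
  by apply: measurable_sum => i; exact: mk.
have bk (a : R) k z : `|a * laplace_kernel c z ^+ k| <= `|a|.
  have /andP[h0 h1] := laplace_kernel_itv z (ltW c0).
  by rewrite normrM ler_piMr// normrX ger0_norm// exprn_ile1.
have bs (a : nat -> R) n z : `|\sum_(i < n) a i * laplace_kernel c z ^+ i| <=
    \sum_(i < n) `|a i|.
  by apply: (le_trans (ler_norm_sum _ _ _)); apply: ler_sum.
have int d' (T' : measurableType d') (mu : probability T' R) (Z : T' -> R * R)
    (a : nat -> R) k : measurable_fun setT Z ->
    \int[mu]_w (\sum_(i < k) a i * laplace_kernel c (Z w) ^+ i) =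
    \sum_(i < k) a i * \int[mu]_w laplace_kernel (i%:R * c) (Z w).
  move=> mZ; elim: k => [|k IH].
    rewrite big_ord0 (_ : (fun w => _) = cst 0) ?Rintegral_cst ?mul0r//.
    by apply/funext => w; rewrite big_ord0.
  rewrite big_ord_recr/= -IH -RintegralZl//; last first.
    apply: (@integrable_bounded _ _ mu _ 1) => [|w].
      by apply: (measurableT_comp _ mZ); exact: measurable_laplace_kernel.
    have /andP[h0 h1] := laplace_kernel_itv (Z w) (mulr_ge0 (ler0n R k) (ltW c0)).
    by rewrite ger0_norm.
  rewrite -RintegralD//.
  - by apply: eq_Rintegral => w _; rewrite big_ord_recr/= laplace_kernelX.
  - apply: integrable_bounded (fun w => bs a k (Z w)).
    exact: (measurableT_comp (ms a k) mZ).
  - apply: (@integrable_bounded _ _ mu _ `|a k|) => [|w]; last first.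
      by rewrite -laplace_kernelX.
    apply: measurable_funM => //; apply: (measurableT_comp _ mZ).
    exact: measurable_laplace_kernel.
pose a i := p`_i; pose k := size p.
rewrite (_ : (fun n => _) = (fun n => \sum_(i < k) a i *
    \int[P]_w laplace_kernel (i%:R * c) (normalized_sum W n w))); last first.
  apply/funext => n; rewrite -int; last exact: measurable_normalized_sum.
  by apply: eq_Rintegral => w _; rewrite horner_coef.
rewrite (_ : Rintegral _ _ _ = \sum_(i < k) a i *
    \int[gaussp]_z laplace_kernel (i%:R * c) z); last first.
  rewrite -(int _ _ gaussp id a k (@measurable_id _ _ setT)).
  by apply: eq_Rintegral => z _; rewrite horner_coef.
apply: cvg_big; first exact: add_continuous.
(* The constant term is treated apart: [laplace_clt] is for positive rates, and the kernel of rate 0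
   is the constant 1. *)
move=> [[|i] ik] _ /=; last first.
  apply: cvgM; first exact: cvg_cst.
  by apply: laplace_clt iW dW mW _; rewrite mulr_gt0// ltr0n.
have E z : laplace_kernel (0%:R * c) z = 1 :> R.
  by rewrite /laplace_kernel !mul0r oppr0 expR0.
have E1 d' (T' : measurableType d') (mu : probability T' R) (Z : T' -> R * R) :
    \int[mu]_w laplace_kernel (0%:R * c) (Z w) = 1.
  under eq_Rintegral do rewrite E.
  by rewrite Rintegral_cst// mul1r [X in fine X](_ : _ = 1%E)//; exact: probability_setT.
apply: cvgM; first exact: cvg_cst.
rewrite (E1 _ _ gaussp id).
rewrite (_ : (fun n => \int[P]_w _) = (fun=> 1)); last by apply/funext => n; exact: E1.
exact: cvg_cst.
Qed.

(** A function that is almost 1 up to s and almost 0 beyond r has its mean squeezed between the cdf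
    at s and at r; in between, its values in [0, 1] are harmless. *)
Lemma expectation_between d' (T' : measurableType d') (mu : probability T' R)
    (Y f : T' -> R) (s r dl : R) : measurable_fun setT Y -> measurable_fun setT f ->
  0 <= dl -> (forall x, 0 <= f x <= 1) ->
  (forall x, Y x <= s -> 1 - dl <= f x) -> (forall x, r < Y x -> f x <= dl) ->
  (mu [set x | (Y x <= s)%R] <= (\int[mu]_x f x)%R%:E + dl%:E)%E /\
  ((\int[mu]_x f x)%R%:E <= mu [set x | (Y x <= r)%R] + dl%:E)%E.
Proof.
move=> mY mf dl0 f01 fs fr.
have mA t : measurable [set x | Y x <= t].
  rewrite -[X in measurable X]setTI; apply: (mY measurableT [set y | y <= t]).
  rewrite (_ : mkset _ = `]-oo, t]%classic); first exact: measurable_itv.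
  by apply/seteqP; split => y; rewrite /= in_itv.
have f0 x : 0 <= f x by have /andP[] := f01 x.
have iA t : mu [set x | Y x <= t] = (\int[mu]_x (\1_([set x | (Y x <= t)%R]) x : R)%:E)%E.
  by rewrite integral_indic// setIT.
have mi t : measurable_fun setT (\1_([set x | Y x <= t]) : T' -> R).
  exact: measurable_indic.
have i0 t x : 0 <= (\1_([set x | Y x <= t]) x : R) by [].
rewrite -EFin_Rintegral_le1//; last by move=> x; have /andP[] := f01 x.
split; rewrite iA; apply: integral_le_cst => // x; rewrite indicE.
- case: (boolP (_ \in _)) => [/set_mem/= xs|_]; last by rewrite addr_ge0.
  by rewrite -lerBlDr; exact: fs.
- case: (boolP (_ \in _)) => [_|/negP xr]; first by rewrite ler_wpDr//; have /andP[] := f01 x.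
  by rewrite add0r; apply: fr; rewrite ltNge; apply/negP => xr'; apply: xr; exact/mem_set.
Qed.

(** The gap between s and r is where the approximating polynomial falls from 1 to 0. Closing the gap
    is left to the continuity of the limit cdf. *)
Lemma chi_clt (s r e : R) : s < r -> 0 < e -> \forall n \near \oo,
  (P [set w | (chi_stat (normalized_sum W n w) <= s)%R] <=
     gaussp [set z | (chi_stat z <= r)%R] + e%:E)%E /\
  (gaussp [set z | (chi_stat z <= s)%R] <=
     P [set w | (chi_stat (normalized_sum W n w) <= r)%R] + e%:E)%E.
Proof.
move=> sr e0; have chi0 z : 0 <= chi_stat z :> R by rewrite addr_ge0 ?sqr_ge0.
(* For s < 0 the events at level s are empty; [exponential_step] covers s >= 0. *)
have [s0|s0] := ltP s 0.
  have none X (f : X -> R * R) : [set x | chi_stat (f x) <= s] = set0.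
    by apply/seteqP; split => // x /= xs;
      have := le_lt_trans (le_trans (chi0 _) xs) s0; rewrite ltxx.
  have e1 : (0 <= e%:E)%E by rewrite lee_fin ltW.
  apply: nearW => n; split.
    rewrite (none _ (normalized_sum W n)) measure0.
    exact: adde_ge0 (measure_ge0 _ _) e1.
  rewrite (none _ id) measure0.
  exact: adde_ge0 (measure_ge0 _ _) e1.
(* Three errors: the approximation of the indicator function under each of the two laws, and the
   convergence of the mean of the polynomial. *)
have e3 : 0 < e / 3 by rewrite divr_gt0.
have [c [N c0 step]] := exponential_step s0 sr e3.
pose f z := (step_poly N).[laplace_kernel c z].
have f01 z : 0 <= f z <= 1 by apply/step_poly_itv/laplace_kernel_itv/ltW.
have mf : measurable_fun setT f.
  by apply: (measurableT_comp (measurable_horner _)); exact: measurable_laplace_kernel.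
have fs z : chi_stat z <= s -> 1 - e / 3 <= f z by have [] := step _ (chi0 z).
have fr z : r < chi_stat z -> f z <= e / 3 by have [] := step _ (chi0 z).
have [G1 G2] := expectation_between gaussp (@measurable_chi_stat R) mf (ltW e3) f01 fs fr.
have /cvgrPdist_le/(_ _ e3) := @poly_clt c (step_poly N) c0.
apply: filterS => n; rewrite ler_norml => /andP[d1 d2].
have mZ := measurable_normalized_sum W n.
have [P1 P2] := expectation_between P (measurableT_comp (@measurable_chi_stat R) mZ)
  (measurableT_comp mf mZ) (ltW e3) (fun=> f01 _) (fun=> fs _) (fun=> fr _).
split.
- apply: (le_trans P1); apply: (@le_trans _ _ ((\int[gaussp]_z f z)%R%:E + (e / 3 + e / 3)%:E)%E).
    by rewrite -!EFinD lee_fin; rewrite /f /=; lra.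
  apply: (le_trans (leeD2r _ G2)); rewrite -addeA -EFinD leeD2l// lee_fin; lra.
- apply: (le_trans G1); apply: (@le_trans _ _ ((\int[P]_w f (normalized_sum W n w))%R%:E + (e / 3 + e / 3)%:E)%E).
    by rewrite -!EFinD lee_fin; rewrite /f /=; lra.
  apply: (le_trans (leeD2r _ P2)); rewrite -addeA -EFinD leeD2l// lee_fin; lra.
Qed.

End poly.
End cdf_clt.

(** * Expansion of the empirical likelihood *)

Section likelihood_bounds.
Context {R : realType}.

(** The derivative of the difference is x^2 / (1 + x), at most 2 x^2 because 1 + x >= 1/2; the mean
    value theorem does the rest. *)
Lemma ln_taylor2 (r : R) : `|r| <= 1 / 2 -> `|ln (1 + r) - r + r ^+ 2 / 2| <= 2 * `|r| ^+ 3.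
Proof.
move=> r2; pose f x : R := ln (1 + x) - x + x ^+ 2 / 2.
pose f1 x : R := (1 + x)^-1 - 1 + x.
have pos (x : R) : `|x| <= 1 / 2 -> 1 / 2 <= 1 + x.
  by rewrite ler_norml => /andP[? ?]; lra.
have df (x : R) : `|x| <= 1 / 2 -> is_derive x 1 f (f1 x).
  move=> /pos x2; have x0 : 0 < 1 + x by lra.
  have S : is_derive x 1 (fun t : R => 1 + t) 1.
    rewrite (_ : (fun t : R => 1 + t) = (cst 1 + id)); last by apply/funext.
    by apply: is_derive_eq; rewrite add0r.
  have L := @is_derive1_comp _ (@ln R) (fun t => 1 + t) x _ _ (is_derive1_ln x0) S.
  rewrite mulr1 in L.
  rewrite (_ : f = ((@ln R) \o (fun t => 1 + t)) - id + (fun x => 2^-1 * x ^+ 2)); last first.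
    by apply/funext => t; rewrite /f mulrC.
  have Q : is_derive x 1 (fun t : R => 2^-1 * t ^+ 2) x.
    by apply: is_derive_eq; rewrite /GRing.scale/=; field.
  by apply: is_derive_eq; rewrite /f1.
have bd (c : R) : `|c| <= `|r| -> `|f1 c * r| <= 2 * `|r| ^+ 3.
  move=> cr; have /pos c2 := le_trans cr r2; have c0 : 0 < 1 + c by lra.
  have -> : f1 c = c ^+ 2 / (1 + c) by rewrite /f1; field; rewrite gt_eqF.
  rewrite 2!normrM normrX [leRHS](_ : _ = `|r| ^+ 2 * 2 * `|r|); last by ring.
  rewrite ler_wpM2r// ler_pM ?exprn_ge0// ?lerXn2r ?nnegrE//.
  rewrite normfV gtr0_norm// invf_ple ?posrE//; lra.
have cf (x : R) : `|x| <= 1 / 2 -> {for x, continuous f}.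
  move=> x2; apply: differentiable_continuous; apply/derivable1_diffP.
  exact: (@ex_derive _ _ _ _ _ _ _ (df x x2)).
have f0 : f 0 = 0 by rewrite /f addr0 ln1 subrr expr0n/= mul0r addr0.
have [r0|r0] := leP 0 r.
  have [||c + E] := @MVT_segment R f f1 0 r r0.
  - move=> x; rewrite in_itv/= => /andP[x0 xr]; apply: df.
    by rewrite gtr0_norm//; rewrite ger0_norm// in r2; lra.
  - apply: continuous_in_subspaceT => x /set_mem; rewrite /= in_itv/= => /andP[x0 xr]; apply: cf.
    by rewrite ger0_norm//; rewrite ger0_norm// in r2; lra.
  rewrite in_itv/= => /andP[c0 ch]; move: E; rewrite f0 !subr0 -/(f r) => ->.
  by apply: bd; rewrite !ger0_norm.
have [||c + E] := @MVT_segment R f f1 r 0 (ltW r0).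
- move=> x; rewrite in_itv/= => /andP[x0 xr]; apply: df.
  by rewrite ltr0_norm//; rewrite ltr0_norm// in r2; lra.
- apply: continuous_in_subspaceT => x /set_mem; rewrite /= in_itv/= => /andP[x0 xr]; apply: cf.
  by rewrite ler0_norm//; rewrite ltr0_norm// in r2; lra.
rewrite in_itv/= => /andP[hc c0]; move: E; rewrite f0 !sub0r mulrN => /oppr_inj E.
rewrite -/(f r) E.
by apply: bd; rewrite !ler0_norm ?lerN2// ltW.
Qed.

Lemma prod_lnE n (t : 'I_n -> R) : (forall i, 0 < 1 + t i) ->
  \prod_(i < n) (1 + t i) = expR (\sum_(i < n) ln (1 + t i)).
Proof.
by move=> t0; rewrite expR_sum; apply: eq_bigr => i _; rewrite lnK ?posrE.
Qed.

Lemma sum_ln_ge n (t : 'I_n -> R) : (forall i, `|t i| <= 1 / 2) ->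
  \sum_(i < n) t i - (\sum_(i < n) t i ^+ 2) / 2 - 2 * (\sum_(i < n) `|t i| ^+ 3)
  <= \sum_(i < n) ln (1 + t i).
Proof.
move=> t2; rewrite mulr_suml mulr_sumr -!sumrB; apply: ler_sum => i _.
by have := ln_taylor2 (t2 i); rewrite ler_norml => /andP[? ?]; lra.
Qed.

(* Lagrange multipliers bound the likelihood from above: this is the inequality of
   arithmetic and geometric means for the n p_i (1 + r_i). *)
Lemma prod_weights_le n (p r : 'I_n -> R) : (0 < n)%N ->
  (forall i, 0 <= p i) -> \sum_(i < n) p i = 1 -> (forall i, 0 < 1 + r i) ->
  \sum_(i < n) p i * r i <= 0 ->
  \prod_(i < n) (n%:R * p i) <= (\prod_(i < n) (1 + r i))^-1.
Proof.
move=> n0 p0 p1 r0 pr.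
have P0 : 0 < \prod_(i < n) (1 + r i) by apply: prodr_gt0.
rewrite -[leRHS]div1r ler_pdivlMr//.
pose E (i : 'I_n) := p i * (1 + r i).
have E0 : {in 'I_n, forall i, 0 <= E i *+ #|'I_n|}.
  by move=> i _; rewrite mulrn_wge0// mulr_ge0// ltW.
have := (leif_AGM_scaled E0).1.
rewrite (_ : \prod_(i in 'I_n) (E i *+ #|'I_n|) =
    \prod_(i < n) (n%:R * p i) * \prod_(i < n) (1 + r i)); last first.
  rewrite -big_split/=; apply: eq_bigr => i _.
  by rewrite /E card_ord -mulr_natl mulrA.
move=> H; apply: (le_trans H); apply: exprn_ile1.
  by apply: sumr_ge0 => i _; rewrite mulr_ge0// ltW.
rewrite (_ : \sum_(i in 'I_n) E i = 1 + \sum_(i < n) p i * r i); first by rewrite gerDl.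
by rewrite -p1 -big_split/=; apply: eq_bigr => i _; rewrite /E mulrDr mulr1.
Qed.

End likelihood_bounds.

Section likelihood_expansion.
Context {R : realType}.

Section centered.
Variable n : nat.
Hypothesis n0 : (0 < n)%N.
Implicit Types a b : 'I_n -> R.

Let nR0 : n%:R != 0 :> R. Proof. by rewrite pnatr_eq0 -lt0n. Qed.

(** Perturbations built from centered vectors have sum zero, so they keep the total weight 1. *)
Definition centered a i := a i - (\sum_(j < n) a j) / n%:R.

Lemma sum_centered a : \sum_(i < n) centered a i = 0.
Proof.
by rewrite /centered sumrB sumr_const card_ord -[X in _ - X]mulr_natr divfK// subrr.
Qed.

Lemma sum_centeredM a b : \sum_(i < n) centered a i * b i =
  \sum_(i < n) a i * b i - (\sum_(i < n) a i) * (\sum_(i < n) b i) / n%:R.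
Proof.
rewrite [X in _ - X]mulrAC mulr_sumr -sumrB; apply: eq_bigr => i _; exact: mulrBl.
Qed.

End centered.

(** Cramer's rule for the Gram matrix of the centered coordinates, whose determinant is at least 1 -
    4 dl >= 1/2. The last bound controls the squared length of the perturbation in
    [primal_bound]. *)
Lemma near_identity_solution (A B C dl M y1 y2 : R) : 0 < dl -> 8 * dl <= 1 ->
  `|A - 1| <= 2 * dl -> `|B| <= 2 * dl -> `|C - 1| <= 2 * dl ->
  `|y1| <= M -> `|y2| <= M -> exists e1 e2,
  [/\ e1 * A + e2 * B = y1, e1 * B + e2 * C = y2, `|e1| <= 3 * M, `|e2| <= 3 * M &
      e1 * y1 + e2 * y2 <= y1 ^+ 2 + y2 ^+ 2 + 32 * (M ^+ 2 * dl)].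
Proof.
move=> dl0 dl8 A1 B1 C1 y1M y2M.
have M0 : 0 <= M by exact: le_trans y1M.
have M2_0 : 0 <= M ^+ 2 by exact: sqr_ge0.
have [D defD] : exists x, x = A * C - B ^+ 2 by eexists.
have D1 : 1 - 4 * dl <= D.
  have B2 : B ^+ 2 <= (2 * dl) ^+ 2.
    by rewrite -real_normK ?num_real// lerXn2r ?nnegrE// mulr_ge0// ltW.
  have AC : (1 - 2 * dl) * (1 - 2 * dl) <= A * C.
    move: A1 C1; rewrite !ler_norml => /andP[? ?] /andP[? ?].
    by rewrite ler_pM//; have := dl0; lra.
  by move: B2 AC; rewrite defD !expr2; lra.
have D0 : 0 < D by have := dl0; lra.
have Dn0 : D != 0 by rewrite gt_eqF.
have [e1 def1] : exists x, x = (C * y1 - B * y2) / D by eexists.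
have [e2 def2] : exists x, x = (A * y2 - B * y1) / D by eexists.
have E1 : e1 * A + e2 * B = y1 by move: Dn0; rewrite def1 def2 defD => Dn0; field.
have E2 : e1 * B + e2 * C = y2 by move: Dn0; rewrite def1 def2 defD => Dn0; field.
have eM (x y z w : R) : `|x - 1| <= 2 * dl -> `|y| <= 2 * dl -> `|z| <= M -> `|w| <= M ->
    `|(x * z - y * w) / D| <= 3 * M.
  move=> x1 yd zM wM; rewrite normrM normfV (gtr0_norm D0) ler_pdivrMr//.
  apply: (@le_trans _ _ ((1 + 2 * dl) * M + 2 * dl * M)).
    apply: (le_trans (ler_normB _ _)); apply: lerD; rewrite normrM ler_pM//.
    by move: x1; rewrite !ler_norml => /andP[? ?]; have := dl0; lra.
  rewrite [leLHS](_ : _ = M * (1 + 4 * dl)); last by ring.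
  rewrite [leRHS](_ : _ = M * (3 * D)); last by ring.
  rewrite ler_wpM2l//; move: D1 dl8; lra.
have e1M : `|e1| <= 3 * M by rewrite def1; exact: eM.
have e2M : `|e2| <= 3 * M by rewrite def2; exact: eM.
have ey : e1 * y1 + e2 * y2 <= y1 ^+ 2 + y2 ^+ 2 + 32 * (M ^+ 2 * dl).
  have -> : e1 * y1 + e2 * y2 =
      (y1 ^+ 2 + y2 ^+ 2 + (C - 1) * y1 * y1 - 2 * (B * y1 * y2) + (A - 1) * y2 * y2) / D.
    by rewrite def1 def2; field.
  have yy (x y z : R) : `|x| <= 2 * dl -> `|y| <= M -> `|z| <= M ->
      `|x * y * z| <= 2 * (M ^+ 2 * dl).
    move=> xd yM zM; rewrite 2!normrM [leRHS](_ : _ = 2 * dl * M * M); last by ring.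
    by rewrite !ler_pM ?mulr_ge0.
  have ysq (y : R) : `|y| <= M -> y ^+ 2 <= M ^+ 2.
    by move=> yM; rewrite -real_normK ?num_real// lerXn2r ?nnegrE.
  have N : y1 ^+ 2 + y2 ^+ 2 + (C - 1) * y1 * y1 - 2 * (B * y1 * y2) + (A - 1) * y2 * y2 <=
      y1 ^+ 2 + y2 ^+ 2 + 8 * (M ^+ 2 * dl).
    move: (yy _ _ _ C1 y1M y1M) (yy _ _ _ B1 y1M y2M) (yy _ _ _ A1 y2M y2M).
    by rewrite !ler_norml => /andP[_ ?] /andP[? _] /andP[_ ?]; lra.
  rewrite ler_pdivrMr//; apply: (le_trans N).
  have Y := lerD (ysq _ y1M) (ysq _ y2M).
  have Y0 : 0 <= y1 ^+ 2 + y2 ^+ 2 by rewrite addr_ge0 ?sqr_ge0.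
  move: (y1 ^+ 2 + y2 ^+ 2) Y Y0 => Y YM Y0; move: (M ^+ 2) M2_0 YM => m m0 Ym.
  (* With Y <= 2 m and 8 dl <= 1 the factor 1 - 4 dl takes away at most 8 m dl + 16 m dl, and 32 -
     24 = 8 is what the numerator requires. *)
  apply: (@le_trans _ _ ((Y + 32 * (m * dl)) * (1 - 4 * dl))); last first.
    by rewrite ler_wpM2l// addr_ge0// !mulr_ge0// ltW.
  have h1 : 0 <= (2 * m - Y) * dl by rewrite mulr_ge0 ?(ltW dl0)//; lra.
  have h2 : 0 <= m * dl * (1 - 8 * dl) by rewrite !mulr_ge0 ?(ltW dl0)//; lra.
  by lra.
by exists e1, e2.
Qed.

(** The constants of [primal_bound]: the errors are at most 32 / 2 + 2 * 9 * 108 = 1960 times X,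
    while h / 2 is at least 4000 X. *)
Lemma log_likelihood_arith (X Y S3 E q h : R) : E <= q + 32 * Y -> S3 <= 9 * (108 * X) ->
  Y <= X -> 20 * (20 * (20 * X)) <= h -> 0 < X -> - (q + h) / 2 <= 0 - E / 2 - 2 * S3.
Proof. lra. Qed.

Lemma centered_cubes n (w t : 'I_n -> R) (M dl : R) : (0 < n)%N -> 1 <= M ->
  0 < dl -> 8 * dl <= 1 -> (forall i, 0 <= w i) ->
  (forall i, `|t i| <= 3 * M * (w i + 2 * M / n%:R)) ->
  \sum_(i < n) w i ^+ 3 <= dl -> M ^+ 2 <= dl * n%:R ->
  \sum_(i < n) `|t i| ^+ 3 <= 9 * (108 * (M ^+ 3 * dl)).
Proof.
move=> n0 M1 dl0 dl8 w0 tw cubes Mn.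
have M0 : 0 <= M by exact: le_trans M1.
have nR0 : 0 < n%:R :> R by rewrite ltr0n.
have nR : n%:R != 0 :> R by rewrite gt_eqF.
(* 108 = 4 * 3^3, again from (x + q)^3 <= 4 (x^3 + q^3). *)
have t3w i : `|t i| ^+ 3 <= 108 * M ^+ 3 * (w i ^+ 3 + (2 * M / n%:R) ^+ 3).
  have q0 : 0 <= 2 * M / n%:R by rewrite !mulr_ge0 ?invr_ge0 ?ler0n.
  apply: (@le_trans _ _ ((3 * M * (w i + 2 * M / n%:R)) ^+ 3)).
    by rewrite lerXn2r// nnegrE// !mulr_ge0// addr_ge0.
  move: (2 * M / n%:R) q0 (w i) (w0 i) => q q0 x x0.
  rewrite -subr_ge0 [leRHS](_ : _ = 81 * M ^+ 3 * ((x + q) * (x - q) ^+ 2)); last by ring.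
  apply: mulr_ge0; first by apply: mulr_ge0; [exact: ler0n|exact: exprn_ge0].
  by apply: mulr_ge0; [exact: addr_ge0|exact: sqr_ge0].
apply: (le_trans (ler_sum _ (fun i _ => t3w i))).
rewrite -mulr_sumr big_split/= sumr_const card_ord -[X in _ + X]mulr_natr.
(* M^3 / n^2 <= (M^2 / n)^2 <= dl^2 <= dl, the first inequality because M >= 1. *)
have q : (2 * M / n%:R) ^+ 3 * n%:R <= 8 * dl.
  rewrite [leLHS](_ : _ = 8 * (M ^+ 3 / n%:R ^+ 2)); last by field.
  rewrite ler_pM2l//; apply: (@le_trans _ _ (dl ^+ 2)).
    rewrite ler_pdivrMr ?exprn_gt0// -exprMn.
    apply: (@le_trans _ _ ((M ^+ 2) ^+ 2)); first by rewrite -exprM ler_weXn2l.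
    by rewrite lerXn2r// nnegrE ?sqr_ge0// mulr_ge0 ?ler0n// ltW.
  by rewrite expr2 ler_piMl ?(ltW dl0)//; have := dl0; lra.
have cq := lerD cubes q.
rewrite [leRHS](_ : _ = 108 * M ^+ 3 * (dl + 8 * dl)); last by ring.
by rewrite ler_wpM2l// mulr_ge0// exprn_ge0.
Qed.

Section quantitative.
Variables (n : nat) (a b : 'I_n -> R) (M dl eta : R).
Let Z1 := \sum_(i < n) a i.
Let Z2 := \sum_(i < n) b i.
Hypotheses (n0 : (0 < n)%N) (M1 : 1 <= M) (dl0 : 0 < dl) (Mdl : 20 * (20 * (20 * (M ^+ 3 * dl))) <= eta) (eta1 : eta <= 1).
Hypotheses (Z1M : `|Z1| <= M) (Z2M : `|Z2| <= M).
Hypotheses (aa : `|\sum_(i < n) a i * a i - 1| <= dl) (ab : `|\sum_(i < n) a i * b i| <= dl)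
  (bb : `|\sum_(i < n) b i * b i - 1| <= dl).
Hypotheses (cubes : \sum_(i < n) (`|a i| + `|b i|) ^+ 3 <= dl) (Mn : M ^+ 2 <= dl * n%:R).

Let M0 : 0 <= M. Proof. exact: le_trans M1. Qed.
Let M3 : 1 <= M ^+ 3. Proof. exact: exprn_ege1. Qed.
Let M2 : M ^+ 2 <= M ^+ 3. Proof. by rewrite ler_weXn2l. Qed.
Let M2_0 : 0 <= M ^+ 2. Proof. exact: sqr_ge0. Qed.
Let M3dl : 0 < M ^+ 3 * dl. Proof. by rewrite mulr_gt0// (lt_le_trans ltr01). Qed.
Let M2dl : M ^+ 2 * dl <= M ^+ 3 * dl. Proof. by rewrite ler_wpM2r// ltW. Qed.
Let dlM3 : dl <= M ^+ 3 * dl. Proof. by rewrite ler_peMl// ltW. Qed.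

Let cube_half (x : R) : `|x| ^+ 3 <= 1 / 8 -> `|x| <= 1 / 2.
Proof.
have -> : 1 / 8 = (1 / 2) ^+ 3 :> R by field.
by rewrite ler_pXn2r// nnegrE.
Qed.

Let term_le (f : 'I_n -> R) (c : R) i : (forall i, 0 <= f i) -> \sum_(j < n) f j <= c -> f i <= c.
Proof. by move=> f0; apply: le_trans; rewrite (bigD1 i)//= lerDl sumr_ge0. Qed.

Let normM2 (x y z : R) : `|x| <= M -> `|y| <= M -> `|z| <= dl -> `|x * y * z| <= M ^+ 2 * dl.
Proof. by move=> xM yM zd; rewrite 2!normrM expr2 !ler_pM ?mulr_ge0. Qed.

(** [prod_weights_le] with multiplier y, followed by the quadratic expansion of ln(1 + r_i). A sign
    condition in place of an equation makes room for the half-plane constraint. *)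
Lemma weak_duality_bound (p : 'I_n -> R) (y1 y2 : R) : `|y1| <= M -> `|y2| <= M ->
  (forall i, 0 <= p i) -> \sum_(i < n) p i = 1 ->
  \sum_(i < n) p i * (y1 * a i + y2 * b i) <= 0 ->
  \prod_(i < n) (n%:R * p i) <=
  expR (- (2 * (y1 * Z1 + y2 * Z2) - (y1 ^+ 2 + y2 ^+ 2) - eta) / 2).
Proof.
move=> y1M y2M p0 p1 pr; pose r i := y1 * a i + y2 * b i.
have rw i : `|r i| ^+ 3 <= M ^+ 3 * (`|a i| + `|b i|) ^+ 3.
  rewrite -exprMn lerXn2r ?nnegrE ?mulr_ge0 ?addr_ge0//.
  by rewrite (le_trans (ler_normD _ _))// !normrM mulrDr lerD// ler_wpM2r.
have r3 : \sum_(i < n) `|r i| ^+ 3 <= M ^+ 3 * dl.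
  apply: le_trans (_ : M ^+ 3 * (\sum_(i < n) (`|a i| + `|b i|) ^+ 3) <= _).
    by rewrite mulr_sumr; apply: ler_sum.
  by rewrite ler_wpM2l// exprn_ge0.
(* A small sum of cubes makes every single term small: M^3 dl <= 1/8000. *)
have r2 i : `|r i| <= 1 / 2.
  apply: cube_half; apply: (@le_trans _ _ (M ^+ 3 * dl)); last by move: Mdl M3dl eta1; lra.
  by apply: (@term_le (fun i => `|r i| ^+ 3) _ i _ r3) => j; rewrite exprn_ge0.
have r0 i : 0 < 1 + r i by have := r2 i; rewrite ler_norml => /andP[? ?]; lra.
apply: (le_trans (prod_weights_le n0 p0 p1 r0 pr)).
rewrite prod_lnE// -expRN ler_expR mulNr lerN2.
apply: le_trans (sum_ln_ge r2).
have -> : \sum_(i < n) r i = y1 * Z1 + y2 * Z2.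
  by rewrite /Z1 /Z2 !mulr_sumr -big_split.
have -> : \sum_(i < n) r i ^+ 2 = y1 * y1 * (\sum_(i < n) a i * a i) +
    2 * (y1 * y2 * (\sum_(i < n) a i * b i)) + y2 * y2 * (\sum_(i < n) b i * b i).
  by rewrite !mulr_sumr -!big_split/=; apply: eq_bigr => i _; rewrite /r; ring.
have := normM2 y1M y1M aa; have := normM2 y1M y2M ab; have := normM2 y2M y2M bb.
rewrite !ler_norml !mulrBr !mulr1 => /andP[_ h1] /andP[_ h2] /andP[_ h3].
move: h1 h2 h3 M2dl Mdl M3dl r3; rewrite -!expr2; lra.
Qed.

(* The optimal weights are (1 + t_i) / n up to higher order terms, where t is the
   shortest vector with the prescribed products with a and b. *)
Lemma primal_bound (y1 y2 : R) : `|y1| <= M -> `|y2| <= M ->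
  exists p : 'I_n -> R, [/\ forall i, 0 <= p i, \sum_(i < n) p i = 1,
    \sum_(i < n) p i * a i = (Z1 - y1) / n%:R,
    \sum_(i < n) p i * b i = (Z2 - y2) / n%:R &
    expR (- (y1 ^+ 2 + y2 ^+ 2 + eta) / 2) <= \prod_(i < n) (n%:R * p i)].
Proof.
move=> y1M y2M; have nR0 : 0 < n%:R :> R by rewrite ltr0n.
have nR : n%:R != 0 :> R by rewrite gt_eqF.
have dl8 : 8 * dl <= 1 by move: dlM3 Mdl eta1; lra.
have small (x y : R) : `|x| <= M -> `|y| <= M -> `|x * y / n%:R| <= dl.
  move=> xM yM; rewrite 2!normrM normfV (gtr0_norm nR0) ler_pdivrMr//.
  by apply: le_trans Mn; rewrite expr2 ler_pM.
have [A defA] : exists x, x = \sum_(i < n) a i * a i - Z1 * Z1 / n%:R by eexists.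
have [B defB] : exists x, x = \sum_(i < n) a i * b i - Z1 * Z2 / n%:R by eexists.
have [C defC] : exists x, x = \sum_(i < n) b i * b i - Z2 * Z2 / n%:R by eexists.
have A1 : `|A - 1| <= 2 * dl.
  move: aa (small _ _ Z1M Z1M); rewrite defA !ler_norml => /andP[? ?] /andP[? ?]; lra.
have B1 : `|B| <= 2 * dl.
  move: ab (small _ _ Z1M Z2M); rewrite defB !ler_norml => /andP[? ?] /andP[? ?]; lra.
have C1 : `|C - 1| <= 2 * dl.
  move: bb (small _ _ Z2M Z2M); rewrite defC !ler_norml => /andP[? ?] /andP[? ?]; lra.
have [e1 [e2 [E1 E2 e1M e2M ey]]] := near_identity_solution dl0 dl8 A1 B1 C1 y1M y2M.
(* The Gram system was solved so that t has products - y1 and - y2 with a and b. The weights (1 +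
   t_i) / n thus move the weighted sums from Z / n to (Z - y) / n. *)
pose t i := - e1 * centered a i - e2 * centered b i.
have t1 : \sum_(i < n) t i = 0.
  by rewrite /t sumrB -!mulr_sumr !sum_centered// !mulr0 subr0.
have ta : \sum_(i < n) t i * a i = - y1.
  transitivity (- e1 * (\sum_(i < n) centered a i * a i) - e2 * (\sum_(i < n) centered b i * a i)).
    by rewrite !mulr_sumr -sumrB; apply: eq_bigr => i _; rewrite /t; ring.
  rewrite !sum_centeredM -/Z1 -/Z2 -defA.
  under [X in _ - e2 * (X - _)]eq_bigr do rewrite mulrC.
  by rewrite (mulrC Z2) -defB -E1; ring.
have tb : \sum_(i < n) t i * b i = - y2.
  transitivity (- e1 * (\sum_(i < n) centered a i * b i) - e2 * (\sum_(i < n) centered b i * b i)).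
    by rewrite !mulr_sumr -sumrB; apply: eq_bigr => i _; rewrite /t; ring.
  by rewrite !sum_centeredM -/Z1 -/Z2 -defB -defC -E2; ring.
(* The squared length of t is e . y, close to |y|^2 since the Gram matrix is close to the identity:
   this is the source of the exponent. *)
have tt : \sum_(i < n) t i ^+ 2 = e1 * y1 + e2 * y2.
  transitivity (- e1 * (\sum_(i < n) t i * a i) + e1 * (Z1 / n%:R) * (\sum_(i < n) t i) -
      e2 * (\sum_(i < n) t i * b i) + e2 * (Z2 / n%:R) * (\sum_(i < n) t i)).
    rewrite !mulr_sumr -big_split -sumrB -big_split/=; apply: eq_bigr => i _.
    by rewrite expr2 {1}/t /centered -/Z1 -/Z2; ring.
  by rewrite t1 ta tb; ring.
pose w i := `|a i| + `|b i|.
have w0 i : 0 <= w i by rewrite addr_ge0.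
have tw i : `|t i| <= 3 * M * (w i + 2 * M / n%:R).
  have cen (x z : R) : `|z| <= M -> `|x - z / n%:R| <= `|x| + M / n%:R.
    move=> zM; apply: (le_trans (ler_normB _ _)); rewrite lerD2l normrM normfV.
    by rewrite (gtr0_norm nR0) ler_pM2r ?invr_gt0.
  apply: (le_trans (ler_normB _ _)); rewrite !normrM normrN.
  rewrite [leRHS](_ : _ = 3 * M * (`|a i| + M / n%:R) + 3 * M * (`|b i| + M / n%:R)); last first.
    by rewrite /w; ring.
  by rewrite lerD// ler_pM// cen.
have t3 := centered_cubes n0 M1 dl0 dl8 w0 tw cubes Mn.
have t2 i : `|t i| <= 1 / 2.
  apply: cube_half; apply: (@le_trans _ _ (9 * (108 * (M ^+ 3 * dl)))); last first.
    by move: Mdl M3dl eta1; lra.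
  by apply: (@term_le (fun i => `|t i| ^+ 3) _ i _ t3) => j; rewrite exprn_ge0.
have t0 i : 0 < 1 + t i by have := t2 i; rewrite ler_norml => /andP[? ?]; lra.
exists (fun i => (1 + t i) / n%:R); split.
- by move=> i; rewrite divr_ge0 ?ler0n// ltW.
- rewrite -mulr_suml big_split/= t1 addr0 sumr_const card_ord -mulr_natr mul1r divff//.
- rewrite -ta /Z1 -big_split/= mulr_suml; apply: eq_bigr => i _; ring.
- rewrite -tb /Z2 -big_split/= mulr_suml; apply: eq_bigr => i _; ring.
rewrite [leRHS](_ : _ = \prod_(i < n) (1 + t i)); last first.
  by apply: eq_bigr => i _; field.
rewrite prod_lnE// ler_expR; apply: le_trans (sum_ln_ge t2).
rewrite t1 tt.
exact: log_likelihood_arith ey t3 M2dl Mdl M3dl.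
Qed.

End quantitative.
End likelihood_expansion.

Section constrained_likelihood.
Context {R : realType}.

(* Decorrelating coordinates: the first one is, up to scale, the signed distance to
   the boundary of the half-plane x.1 <= x.2. *)
Definition whiten (m sg tau be : R) (x : R * R) : R * R :=
  ((x.2 - x.1) / sg, (x.2 - m - be * (x.2 - x.1)) / tau).

Lemma fst_sum I (r : seq I) (F : I -> R * R) : (\sum_(i <- r) F i).1 = \sum_(i <- r) (F i).1.
Proof. by apply: (big_morph fst). Qed.

Lemma snd_sum I (r : seq I) (F : I -> R * R) : (\sum_(i <- r) F i).2 = \sum_(i <- r) (F i).2.
Proof. by apply: (big_morph snd). Qed.

Lemma log_ratio_bound (p q r L S h : R) : - (p + r + h) / 2 <= L -> L <= - (p + r - h) / 2 ->
  - (q + h) / 2 <= S -> S <= - (q - h) / 2 ->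
  `|- (2 * (L - S)) - (p + r - q)| <= 2 * h.
Proof. by move=> ? ? ? ?; rewrite ler_norml; apply/andP; split; lra. Qed.

Variables (n : nat) (x : nat -> R * R) (m sg tau be M dl eta : R).
Let s : R := (Num.sqrt n%:R)^-1.
Let a (i : 'I_n) := s * (whiten m sg tau be (x i)).1.
Let b (i : 'I_n) := s * (whiten m sg tau be (x i)).2.
Let Z := (\sum_(i < n) a i, \sum_(i < n) b i).
Let Theta := [set mu : R * R | mu.1 <= mu.2].

Hypotheses (sg0 : 0 < sg) (tau0 : 0 < tau).
Hypotheses (n0 : (0 < n)%N) (M1 : 1 <= M) (dl0 : 0 < dl)
  (Mdl : 20 * (20 * (20 * (M ^+ 3 * dl))) <= eta) (eta1 : eta <= 1).
Hypotheses (Z1M : `|Z.1| <= M) (Z2M : `|Z.2| <= M).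
Hypotheses (aa : `|\sum_(i < n) a i * a i - 1| <= dl) (ab : `|\sum_(i < n) a i * b i| <= dl)
  (bb : `|\sum_(i < n) b i * b i - 1| <= dl).
Hypotheses (cubes : \sum_(i < n) (`|a i| + `|b i|) ^+ 3 <= dl) (Mn : M ^+ 2 <= dl * n%:R).

Let s0 : 0 < s. Proof. by rewrite invr_gt0 sqrtr_gt0 ltr0n. Qed.

Let gap (p : 'I_n -> R) : \sum_(i < n) p i * ((x i).2 - (x i).1) =
  sg / s * \sum_(i < n) p i * a i.
Proof.
by rewrite mulr_sumr; apply: eq_bigr => i _; rewrite /a /=; field; rewrite !gt_eqF.
Qed.

Let second (p : 'I_n -> R) : \sum_(i < n) p i * ((x i).2 - m) =
  tau / s * (\sum_(i < n) p i * b i) + be * (\sum_(i < n) p i * ((x i).2 - (x i).1)).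
Proof.
rewrite !mulr_sumr -big_split/=; apply: eq_bigr => i _; rewrite /b /=; field.
by rewrite !gt_eqF.
Qed.

Lemma weights_meanE (p : 'I_n -> R) : \sum_(i < n) p i *: (x i - (m, m)) = 0 <->
  \sum_(i < n) p i * a i = 0 /\ \sum_(i < n) p i * b i = 0.
Proof.
set S := \sum_(i < n) _.
have S1 : S.1 = \sum_(i < n) p i * ((x i).1 - m) by rewrite fst_sum.
have S2 : S.2 = \sum_(i < n) p i * ((x i).2 - m) by rewrite snd_sum.
have G : S.2 - S.1 = sg / s * \sum_(i < n) p i * a i.
  by rewrite -gap S1 S2 -sumrB; apply: eq_bigr => i _; ring.
have H : S.2 = tau / s * (\sum_(i < n) p i * b i) + be * (S.2 - S.1).
  by rewrite G -gap -second.
have c1 : sg / s != 0 by rewrite gt_eqF// divr_gt0.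
have c2 : tau / s != 0 by rewrite gt_eqF// divr_gt0.
split=> [S0|[pa pb]].
- move: G H; rewrite S0 /= subrr mulr0 addr0 => /esym/eqP + /esym/eqP.
  rewrite mulf_eq0 (negbTE c1)/= => /eqP->.
  by rewrite mulf_eq0 (negbTE c2)/= => /eqP->.
- move: H; rewrite G pa pb !mulr0 addr0 => S20; move: G; rewrite S20 pa mulr0 sub0r.
  by move/eqP; rewrite oppr_eq0 => /eqP S10; rewrite [S]surjective_pairing S10 S20.
Qed.

(** For weights of sum 1 the only candidate [nu] is the weighted mean, so the union over Theta of
    the constraint sets is cut out by one linear inequality. *)
Lemma weights_ThetaE (p : 'I_n -> R) : \sum_(i < n) p i = 1 ->
  (exists2 nu, Theta nu & \sum_(i < n) p i *: (x i - nu) = 0) <->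
  0 <= \sum_(i < n) p i * a i.
Proof.
move=> p1.
have gapE : sg / s * (\sum_(i < n) p i * a i) =
    \sum_(i < n) p i * (x i).2 - \sum_(i < n) p i * (x i).1.
  by rewrite -gap -sumrB; apply: eq_bigr => i _; rewrite mulrBr.
have c1 : 0 < sg / s by rewrite divr_gt0.
rewrite -(pmulr_rge0 _ c1) gapE subr_ge0; split=> [[nu nuT S0]|xx].
- have E1 : \sum_(i < n) p i * (x i).1 = nu.1.
    apply/eqP; rewrite -subr_eq0 -[nu.1]mul1r -p1 mulr_suml -sumrB.
    apply/eqP; apply: etrans (congr1 fst S0); rewrite fst_sum.
    by apply: eq_bigr => i _; exact: (esym (mulrBr _ _ _)).
  have E2 : \sum_(i < n) p i * (x i).2 = nu.2.
    apply/eqP; rewrite -subr_eq0 -[nu.2]mul1r -p1 mulr_suml -sumrB.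
    apply/eqP; apply: etrans (congr1 snd S0); rewrite snd_sum.
    by apply: eq_bigr => i _; exact: (esym (mulrBr _ _ _)).
  by rewrite E1 E2.
- exists (\sum_(i < n) p i * (x i).1, \sum_(i < n) p i * (x i).2) => //.
  set S := \sum_(i < n) _.
  have -> : S = (S.1, S.2) by case: S.
  rewrite fst_sum snd_sum /=.
  have z (y : 'I_n -> R) : \sum_(i < n) p i * (y i - \sum_(j < n) p j * y j) = 0.
    by under eq_bigr do rewrite mulrBr; rewrite sumrB -mulr_suml p1 mul1r subrr.
  by congr pair; [exact: (z (fun i => (x i).1))|exact: (z (fun i => (x i).2))].
Qed.

(** The vector (q, 0) is the shortest y for which Z - y lies in the half-plane z1 >= 0. As a
    multiplier q has the right sign, and q Z1 = q^2 is complementary slackness. *)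
Let q := Num.min Z.1 0.

Let qM : `|q| <= M.
Proof.
rewrite /q; case: (leP Z.1 0) => _ //.
by rewrite normr0 (le_trans _ M1).
Qed.

Let combine (p : 'I_n -> R) (y1 y2 : R) :
  \sum_(i < n) p i * (y1 * a i + y2 * b i) =
  y1 * (\sum_(i < n) p i * a i) + y2 * (\sum_(i < n) p i * b i).
Proof.
rewrite !mulr_sumr -big_split; apply: eq_bigr => i _.
by move: (a i) (b i) => u v /=; ring.
Qed.

(** The choice y = Z serves both bounds: the primal weights then have mean [(m, m)], and the dual
    exponent is governed by 2 |Z|^2 - |Z|^2. *)
Lemma EL_mean_bounds :
  expR (- (Z.1 ^+ 2 + Z.2 ^+ 2 + eta) / 2) <= EL n x (m, m) <=
  expR (- (Z.1 ^+ 2 + Z.2 ^+ 2 - eta) / 2).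
Proof.
have [p [p0 p1 pa pb pP]] :=
  primal_bound n0 M1 dl0 Mdl eta1 Z1M Z2M aa ab bb cubes Mn Z1M Z2M.
have wp : @EL_weights R n x (m, m) p.
  by split=> //; apply/weights_meanE; rewrite pa pb !subrr !mul0r.
apply/andP; split.
  by apply: (le_trans pP); apply: ub_le_sup; [exact: EL_has_ubound|exists p].
apply: ge_sup; first by eexists; exists p.
move=> _ [r [r0 r1 /weights_meanE[ra rb]] <-].
apply: (le_trans (weak_duality_bound n0 M1 dl0 Mdl eta1 aa ab bb cubes Z1M Z2M r0 r1 _)).
  by rewrite combine ra rb !mulr0 addr0.
by rewrite ler_expR; rewrite -/Z /Z /=; lra.
Qed.

Lemma EL_sup_bounds :
  expR (- (q ^+ 2 + eta) / 2) <= EL_sup n x Theta <= expR (- (q ^+ 2 - eta) / 2).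
Proof.
have z0 : `|0 : R| <= M by rewrite normr0 (le_trans _ M1).
have [p [p0 p1 pa pb pP]] :=
  primal_bound n0 M1 dl0 Mdl eta1 Z1M Z2M aa ab bb cubes Mn qM z0.
have [nu nuT wnu] : exists2 nu, Theta nu & \sum_(i < n) p i *: (x i - nu) = 0.
  apply/weights_ThetaE => //; rewrite pa divr_ge0 ?ler0n// subr_ge0.
  by rewrite /q ge_min lexx.
have wp : @EL_weights R n x nu p by split.
have pEL : \prod_(i < n) (n%:R * p i) <= EL n x nu.
  by apply: ub_le_sup; [exact: EL_has_ubound|exists p].
have le_sup : EL n x nu <= EL_sup n x Theta.
  by apply: ub_le_sup; [exact: EL_sup_has_ubound|exists nu].
apply/andP; split.
  by apply: le_trans (le_trans (le_trans pP pEL) le_sup); rewrite expr0n addr0.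
apply: ge_sup; first by exists (EL n x nu); exists nu.
(* A point of Theta without admissible weights contributes the supremum of the empty set, 0. *)
move=> _ [mu muT <-]; rewrite /EL; have [->|/set0P ne] := eqVneq
  [set \prod_(i < n) (n%:R * p i) | p in @EL_weights R n x mu] set0.
  by rewrite sup0 expR_ge0.
apply: ge_sup => // _ [r [r0 r1 r2] <-].
have ra : 0 <= \sum_(i < n) r i * a i by apply/weights_ThetaE => //; exists mu.
apply: (le_trans (weak_duality_bound n0 M1 dl0 Mdl eta1 aa ab bb cubes qM z0 r0 r1 _)).
  by rewrite combine mul0r addr0 mulr_le0_ge0// /q ge_min lexx orbT.
rewrite ler_expR mul0r expr0n !addr0.
have -> : q * \sum_(i < n) a i = q ^+ 2.
  rewrite expr2 /q -[\sum_(i < n) a i]/(Z.1); case: (leP Z.1 0) => // _.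
  by rewrite !mul0r.
by lra.
Qed.

Lemma ell_constr_approx : exists2 l : R,
  ell_constr Theta n x (m, m) = l%:E & `|l - chi_stat Z| <= 2 * eta.
Proof.
have /andP[L1 L2] := EL_mean_bounds; have /andP[S1 S2] := EL_sup_bounds.
have L0 : 0 < EL n x (m, m) by exact: lt_le_trans (expR_gt0 _) L1.
have S0 : 0 < EL_sup n x Theta by exact: lt_le_trans (expR_gt0 _) S1.
exists (- (2 * (ln (EL n x (m, m)) - ln (EL_sup n x Theta)))).
  by rewrite /ell_constr S0 lne_EFin ?divr_gt0// ln_div ?posrE// -EFinM -EFinN.
have {}L1 : - (Z.1 ^+ 2 + Z.2 ^+ 2 + eta) / 2 <= ln (EL n x (m, m)).
  by rewrite -ler_expR lnK ?posrE.
have {}L2 : ln (EL n x (m, m)) <= - (Z.1 ^+ 2 + Z.2 ^+ 2 - eta) / 2.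
  by rewrite -ler_expR lnK ?posrE.
have {}S1 : - (q ^+ 2 + eta) / 2 <= ln (EL_sup n x Theta).
  by rewrite -ler_expR lnK ?posrE.
have {}S2 : ln (EL_sup n x Theta) <= - (q ^+ 2 - eta) / 2.
  by rewrite -ler_expR lnK ?posrE.
have -> : chi_stat Z = Z.1 ^+ 2 + Z.2 ^+ 2 - q ^+ 2.
  rewrite /chi_stat /q; case: (leP Z.1 0) => _; rewrite ?expr0n/= ?subr0 ?add0r//.
  by rewrite addrAC subrr add0r.
exact: log_ratio_bound L1 L2 S1 S2.
Qed.

End constrained_likelihood.

(** * Laws of large numbers *)

(** Plain second-order expansion costs y^2 / (2 s) <= r^4 / (2 a), at most r^3 / sqrt a as long as r
    <= 2 sqrt a. For larger r the function is 1-Lipschitz and the linear term is at most |y|, so the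
    error 2 r^2 is again below r^3 / sqrt a. A third moment of r is thus enough. *)
Lemma hypot_expansion (R : rcfType) (a x y r : R) : 0 < a -> 1 <= r -> `|y| <= r ^+ 2 ->
  Num.sqrt (a ^+ 2 + (x + y) ^+ 2) <=
  Num.sqrt (a ^+ 2 + x ^+ 2) + x / Num.sqrt (a ^+ 2 + x ^+ 2) * y + r ^+ 3 / Num.sqrt a.
Proof.
move=> a0 r1 yr; set s := Num.sqrt (a ^+ 2 + x ^+ 2).
have r0 : 0 <= r by exact: le_trans r1.
have q0 : 0 < Num.sqrt a by rewrite sqrtr_gt0.
have s2 : s ^+ 2 = a ^+ 2 + x ^+ 2 by rewrite sqr_sqrtr// addr_ge0// sqr_ge0.
have a2s : a ^+ 2 <= s ^+ 2 by rewrite s2 lerDl sqr_ge0.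
have s_ge0 : 0 <= s by exact: sqrtr_ge0.
have as_ : a <= s by rewrite -(@ler_pXn2r _ 2)// nnegrE// ltW.
have s0 : 0 < s by exact: lt_le_trans as_.
have xs : `|x| <= s.
  by rewrite -(@ler_pXn2r _ 2) ?nnegrE// real_normK ?num_real// s2 lerDr sqr_ge0.
have sqrt_le (u v : R) : 0 <= v -> u <= v ^+ 2 -> Num.sqrt u <= v.
  by move=> v0 uv; rewrite -(ger0_norm v0) -sqrtr_sqr ler_wsqrtr.
have [rs|rs] := leP r (2 * Num.sqrt a).
  pose t := 2 * x * y + y ^+ 2.
  have tE : a ^+ 2 + (x + y) ^+ 2 = s ^+ 2 + t by rewrite s2 /t; ring.
  apply: (@le_trans _ _ (s + t / (2 * s))).
    apply: sqrt_le.
      have : 0 <= s ^+ 2 + t by rewrite -tE addr_ge0 ?sqr_ge0.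
      have -> : s + t / (2 * s) = (s ^+ 2 + t + s ^+ 2) / (2 * s).
        by field; rewrite gt_eqF.
      by move=> h; rewrite divr_ge0 ?mulr_ge0// addr_ge0// sqr_ge0.
    rewrite tE -subr_ge0 [leRHS](_ : _ = (t / (2 * s)) ^+ 2) ?sqr_ge0//.
    by field; rewrite gt_eqF.
  have -> : t / (2 * s) = x / s * y + y ^+ 2 / (2 * s) by rewrite /t; field; rewrite gt_eqF.
  rewrite addrA lerD2l; apply: (@le_trans _ _ (r ^+ 4 / (2 * a))).
    rewrite ler_pM ?sqr_ge0// ?invr_ge0 ?mulr_ge0//.
      rewrite -real_normK ?num_real// (_ : 4 = 2 * 2)%N// exprM.
      by rewrite lerXn2r ?nnegrE// sqr_ge0.
    by rewrite lef_pV2 ?posrE ?mulr_gt0// ler_pM2l.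
  have aq : a = Num.sqrt a ^+ 2 by rewrite sqr_sqrtr// ltW.
  have -> : r ^+ 4 / (2 * a) = r ^+ 3 / Num.sqrt a * (r / (2 * Num.sqrt a)).
    by rewrite [in LHS]aq; field; rewrite gt_eqF.
  rewrite ler_piMr ?divr_ge0 ?exprn_ge0 ?(ltW q0)//.
  by rewrite ler_pdivrMr ?mul1r// mulr_gt0.
apply: (@le_trans _ _ (s + `|y|)).
  apply: sqrt_le; first by rewrite addr_ge0.
  rewrite -subr_ge0 [leRHS](_ : _ = 2 * (s * `|y| - x * y) + (`|y| ^+ 2 - y ^+ 2) + (s ^+ 2 - (a ^+ 2 + x ^+ 2))); last by ring.
  rewrite s2 subrr addr0 real_normK ?num_real// subrr addr0 mulr_ge0// subr_ge0.
  by rewrite (le_trans (ler_norm _))// normrM ler_wpM2r.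
rewrite -addrA lerD2l -lerBlDl.
have h1 : `|x / s * y| <= `|y|.
  by rewrite normrM ler_piMl// normrM normfV (gtr0_norm s0) ler_pdivrMr// mul1r.
have h2 : 2 * r ^+ 2 <= r ^+ 3 / Num.sqrt a.
  rewrite ler_pdivlMr// (exprSr r 2) [leLHS](_ : _ = r ^+ 2 * (2 * Num.sqrt a)); last by ring.
  by rewrite ler_wpM2l ?sqr_ge0// ltW.
move: h1; rewrite ler_norml => /andP[h1 _]; lra.
Qed.


Section good_event.
Local Open Scope ereal_scope.
Context d (T : measurableType d) (R : realType) (P : probability T R).

Lemma measurable_lt_set (h : T -> R) (c : R) : measurable_fun setT h ->
  measurable [set x | (c < h x)%R].
Proof.
move=> mh; rewrite -[X in measurable X]setTI.
apply: (mh measurableT [set y | (c < y)%R]).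
rewrite (_ : mkset _ = `]c, +oo[%classic); first exact: measurable_itv.
by apply/seteqP; split => y; rewrite /= in_itv/= andbT.
Qed.

Lemma markov_bound (h : T -> R) (c k : R) : measurable_fun setT h ->
  (forall x, 0 <= h x)%R -> (0 < c)%R -> \int[P]_x (h x)%:E <= k%:E ->
  P [set x | (c < h x)%R] <= (k / c)%:E.
Proof.
move=> mh h0 c0 hk; rewrite EFinM lee_pdivlMr// muleC; apply: le_trans hk.
have := @markov _ _ _ P (mfun_of mh) id c c0 (@measurable_id _ _ setT) (fun _ => id)
  (fun _ _ _ _ => id).
rewrite unlock => E; apply: le_trans (le_trans E _); last first.
  by rewrite le_eqVlt; apply/orP; left; apply/eqP/eq_integral => w _ /=; rewrite ger0_norm.
rewrite lee_wpmul2l ?lee_fin ?(ltW c0)//; apply: le_measure; rewrite ?inE.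
- exact: measurable_lt_set.
- rewrite -[X in measurable X]setTI; apply: emeasurable_fun_c_infty => //.
  by apply/measurable_EFinP; exact: measurableT_comp.
- by move=> w /= ch; rewrite lee_fin (le_trans (ltW ch))// ler_norm.
Qed.

Variables (W : nat -> {RV P >-> (R * R)%type}) (rho : R).
Hypotheses (iW : mutually_independent W) (dW : identically_distributed W)
  (mW : std_moments (distribution P (W 0%N)) 1 rho).

Let quad_convol (mu : probability (R * R)%type R) (s r a b : R) : std_moments mu s r ->
  (a ^+ 2 + b ^+ 2 = 1)%R -> forall x : R * R,
  convol mu (fun z => ((a * z.1 + b * z.2) ^+ 2)%:E) x = ((a * x.1 + b * x.2) ^+ 2 + s)%:E.
Proof.
move=> H ab1 x; set p := (a * x.1 + b * x.2)%R.
have E (y : R * R) : ((a * (x + y)%R.1 + b * (x + y)%R.2) ^+ 2 = p ^+ 2 +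
    2 * p * a * y.1 + 2 * p * b * y.2 + a ^+ 2 * y.1 ^+ 2 + 2 * a * b * (y.1 * y.2) +
    b ^+ 2 * y.2 ^+ 2)%R by rewrite /p /=; ring.
rewrite /convol; under eq_integral do rewrite E.
rewrite -[LHS]fineK; last first.
  exact: (integrable_fin_num measurableT (integrable_quadratic _ _ _ _ _ _ H)).
congr EFin; apply: etrans (Rintegral_quadratic _ _ _ _ _ _ H) _.
by rewrite ab1 mul1r.
Qed.

(** Each summand raises the mean of the square by 1 / n, so the second moment is at most 1; then
    Chebyshev's inequality. *)
Lemma normalized_sum_tight (a b : R) n (M : R) : (a ^+ 2 + b ^+ 2 = 1)%R -> (0 < n)%N -> (0 < M)%R ->
  P [set w | (M < `|a * (normalized_sum W n w).1 + b * (normalized_sum W n w).2|)%R]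
    <= (M ^- 2)%:E.
Proof.
move=> ab1 n0 M0; pose q (z : R * R) := ((a * z.1 + b * z.2) ^+ 2)%R.
have mq : measurable_fun [set: R * R] q.
  by apply: measurable_funX; apply: measurable_funD; exact: measurable_funM.
have s0 : (0 < Num.sqrt n%:R :> R)%R by rewrite sqrtr_gt0 ltr0n.
have q0 z : (0 <= q z)%R by exact: sqr_ge0.
have qE : \int[P]_w (q (normalized_sum W n w))%:E <= 1%:E.
  rewrite (@integral_normalized_sum _ _ _ _ W iW dW n (EFin \o q)); last 2 first.
  - exact/measurable_EFinP.
  - by move=> x; rewrite lee_fin.
  have s1 : (0 <= (Num.sqrt n%:R)^-1 :> R)%R by rewrite invr_ge0 ltW.
  have sW := scaled_moments s1 mW.
  have := @iter_convol_le _ (scaled (distribution P (W 0%N)) (Num.sqrt n%:R)^-1)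
    (EFin \o q) ((Num.sqrt n%:R)^-1 ^+ 2 * 1)%R n.
  have -> : (n%:R * ((Num.sqrt n%:R)^-1 ^+ 2 * 1) = 1 :> R)%R.
    by rewrite mulr1 exprVn sqr_sqrtr ?ler0n// divff// pnatr_eq0 -lt0n.
  move=> H; apply: (le_trans (H _ _ _ _ 0%R)).
  - exact/measurable_EFinP.
  - by move=> x; rewrite lee_fin.
  - by rewrite mulr1 sqr_ge0.
  - by move=> x; rewrite (quad_convol sW ab1 x).
  - have -> : (EFin \o q) 0%R = 0.
      by change ((q (0, 0))%:E = 0); rewrite /q /= !mulr0 addr0 expr0n.
    by rewrite add0e.
have := markov_bound (measurableT_comp mq (measurable_normalized_sum W n)) (fun=> q0 _)
  (exprn_gt0 2 M0) qE.
rewrite mul1r; apply: le_trans; rewrite le_eqVlt; apply/orP; left; apply/eqP.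
congr (P _); apply: eq_set => w; congr is_true.
by rewrite /= /q -[X in _ = (_ < X)%R]real_normK ?num_real// ltr_pXn2r ?nnegrE// ltW.
Qed.

(* Only the moment of order 3/2 of xi is available.  The increments of the smooth
   surrogate sqrt(n^2 + z^2) - n of |z| are of order n^(-1/2) on average. *)
Lemma weak_law (xi : R * R -> R) (dl : R) : measurable_fun setT xi ->
  (forall y, `|xi y| <= (1 + norm1 y) ^+ 2)%R ->
  (\int[distribution P (W 0%N)]_y xi y = 0)%R -> (0 < dl)%R ->
  exists2 C, (0 <= C)%R & forall n, (0 < n)%N ->
  P [set w | (dl < `|(\sum_(i < n) xi (W i w)) / n%:R|)%R] <= (C / Num.sqrt n%:R)%:E.
Proof.
move=> mxi xib xi0 dl0; set mu := distribution P (W 0%N).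
have [m3 _ _] := mW; pose r (y : R * R) := (1 + norm1 y)%R.
have r1 y : (1 <= r y)%R by rewrite lerDl norm1_ge0.
have r0 y : (0 <= r y)%R by exact: le_trans (r1 y).
have mr : measurable_fun setT (fun y => r y ^+ 3)%R.
  apply: measurable_funX; apply: measurable_funD => //; exact: measurable_norm1.
have r3 y : (r y ^+ 3 <= 4 * (1 + norm1 y ^+ 3))%R.
  rewrite /r; move: (norm1 y) (norm1_ge0 y) => p p0; rewrite -subr_ge0.
  rewrite (_ : _ - _ = 3 * (1 + p) * (1 - p) ^+ 2)%R; last by ring.
  by rewrite mulr_ge0 ?sqr_ge0// mulr_ge0// addr_ge0.
have ir : mu.-integrable setT (EFin \o (fun y => r y ^+ 3)%R).
  apply: (integrable_moment3 m3 mr (C := 4%R)) => y.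
  by rewrite ger0_norm ?exprn_ge0.
have ixi : mu.-integrable setT (EFin \o xi).
  apply: (integrable_moment3 m3 mxi (C := 4%R)) => y; apply: le_trans (r3 y).
  by apply: (le_trans (xib y)); rewrite -/(r y) ler_weXn2l.
set k := (\int[mu]_y (r y ^+ 3))%R.
have k0 : (0 <= k)%R by apply: Rintegral_ge0 => y _; rewrite exprn_ge0.
(* n c is the value of the surrogate at |z| = n dl, which is the level used in Markov's
   inequality. *)
have c0 : (0 < Num.sqrt (1 + dl ^+ 2) - 1)%R.
  rewrite subr_gt0 -[ltLHS]sqrtr1 ltr_sqrt ?ltrDl ?exprn_gt0//.
  by rewrite addr_gt0// exprn_gt0.
set c := (Num.sqrt (1 + dl ^+ 2) - 1)%R in c0 *.
exists (k / c)%R; first by rewrite divr_ge0// ltW.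
move=> n n0; have nR0 : (0 < n%:R :> R)%R by rewrite ltr0n.
have q0 : (0 < Num.sqrt n%:R :> R)%R by rewrite sqrtr_gt0.
(* The scalar summands are placed on the first axis, so that the results on sums in the plane
   apply. *)
pose G (z : R * R) : R * R := (xi z, 0%R).
have mG : measurable_fun setT G by exact: measurable_fun_pair.
pose Y := comp_rv W mG.
have SE w : ((rv_sum Y n w).1 = \sum_(i < n) xi (W i w))%R by rewrite /rv_sum fst_sum.
pose g (z : R * R) := (Num.sqrt (n%:R ^+ 2 + z.1 ^+ 2) - n%:R)%R.
have mg : measurable_fun setT g.
  apply: measurable_funB => //; apply: measurableT_comp; last first.
    by apply: measurable_funD => //; exact: measurable_funX.
  by apply: continuous_measurable_fun; exact: sqrt_continuous.
have g0 z : (0 <= g z)%R.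
  rewrite subr_ge0 -[leLHS](ger0_norm (ltW nR0)) -sqrtr_sqr ler_wsqrtr//.
  by rewrite lerDl sqr_ge0.
(* [hypot_expansion] with a = n: the linear term has mean zero, and the remainder costs k / sqrt n
   at every starting point. *)
have step x : convol (distribution P (Y 0%N)) (EFin \o g) x <=
    (EFin \o g) x + (k / Num.sqrt n%:R)%:E.
  have -> : convol (distribution P (Y 0%N)) (EFin \o g) x =
      \int[mu]_y (g (x + G y)%R)%:E.
    have mgx : measurable_fun setT (fun y : R * R => (g (x + y)%R)%:E).
      apply/measurable_EFinP; apply: (measurableT_comp mg).
      exact: measurable_plane_translate.
    have gx0 (y : R * R) : 0 <= (g (x + y)%R)%:E by rewrite lee_fin.
    have mgG : measurable_fun setT (fun y : R * R => (g (x + G y)%R)%:E).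
      exact: (measurableT_comp mgx mG).
    transitivity (\int[P]_w (g (x + Y 0%N w)%R)%:E).
      exact: (ge0_integral_distribution (Y 0%N) mgx gx0).
    exact: (esym (ge0_integral_distribution (W 0%N) mgG (fun y => gx0 (G y)))).
  set s := Num.sqrt (n%:R ^+ 2 + x.1 ^+ 2).
  pose h y := (g x + x.1 / s * xi y + r y ^+ 3 / Num.sqrt n%:R)%R.
  have i1 : mu.-integrable setT (EFin \o (fun=> g x)).
    exact: (@integrable_bounded _ _ _ mu (fun=> g x) `|g x|%R).
  have i2 : mu.-integrable setT (EFin \o (fun y => x.1 / s * xi y)%R).
    have := integrableZl measurableT (x.1 / s) ixi.
    by apply: eq_integrable => // y _.
  have i3 : mu.-integrable setT (EFin \o (fun y => r y ^+ 3 / Num.sqrt n%:R)%R).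
    have := integrableZr measurableT (Num.sqrt n%:R)^-1 ir.
    by apply: eq_integrable => // y _.
  have i12 : mu.-integrable setT (EFin \o (fun y => g x + x.1 / s * xi y)%R).
    have := integrableD measurableT i1 i2.
    by apply: eq_integrable => // y _.
  have ih : mu.-integrable setT (EFin \o h).
    have := integrableD measurableT i12 i3.
    by apply: eq_integrable => // y _.
  apply: (@le_trans _ _ (\int[mu]_y (h y)%:E)).
    apply: ge0_le_integral => //.
    - by move=> y _; rewrite lee_fin.
    - apply/measurable_EFinP; apply: (measurableT_comp mg).
      apply: (measurableT_comp (measurable_plane_translate x)).
      exact: measurable_fun_pair.
    - exact: (measurable_int _ ih).
    - move=> y _; rewrite lee_fin /g /h /g /=.
      have := hypot_expansion x.1 nR0 (r1 y) (xib y); rewrite -/s; lra.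
  have -> : \int[mu]_y (h y)%:E = (\int[mu]_y h y)%R%:E.
    by rewrite fineK//; exact: (integrable_fin_num measurableT ih).
  rewrite /h RintegralD// RintegralD// RintegralZl// xi0 mulr0 addr0.
  rewrite RintegralZr// Rintegral_cst//.
  rewrite [X in fine X](_ : _ = 1%E)/=; last exact: probability_setT.
  by rewrite mulr1 EFinD.
have gE : \int[P]_w (g (rv_sum Y n w))%:E <= (n%:R * (k / Num.sqrt n%:R))%:E.
  have := @integral_rv_sum _ _ _ _ Y (mutually_independent_comp mG iW)
    (identically_distributed_comp mG dW) n (EFin \o g) 0%R.
  move=> H; have mg' : measurable_fun setT (EFin \o g) by exact/measurable_EFinP.
  have g0' z : 0 <= (EFin \o g) z by rewrite lee_fin.
  have {}H := H mg' g0'; under eq_integral do rewrite -[rv_sum _ _ _]add0r.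
  have K0 : (0 <= k / Num.sqrt n%:R)%R by rewrite divr_ge0// ltW.
  rewrite H; apply: (le_trans (iter_convol_le n mg' g0' K0 step 0%R)).
  have -> : (EFin \o g) 0%R = 0.
    change ((g (0, 0))%:E = 0); rewrite /g /= expr0n/= addr0 sqrtr_sqr.
    by rewrite ger0_norm ?subrr// ltW.
  by rewrite add0e.
have nc0 : (0 < n%:R * c)%R by rewrite mulr_gt0.
have mS := measurable_rv_sum Y n.
have M1 := markov_bound (measurableT_comp mg mS) (fun=> g0 _) nc0 gE.
have -> : (k / c / Num.sqrt n%:R = n%:R * (k / Num.sqrt n%:R) / (n%:R * c))%R.
  by field; rewrite !gt_eqF.
apply: le_trans M1; apply: le_measure; rewrite ?inE.
- apply: measurable_lt_set; apply: measurableT_comp => //.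
  apply: measurable_funM => //.
  rewrite (_ : (fun w => _) = (fun w => (rv_sum Y n w).1)); last by apply/funext.
  exact: measurableT_comp.
- by apply: measurable_lt_set; exact: measurableT_comp.
- move=> w /= H; rewrite /g SE; set S := (\sum_(i < n) _)%R in H *.
  rewrite /c mulrBr mulr1 ltrD2r -[X in (X * _ < _)%R](ger0_norm (ltW nR0)) -sqrtr_sqr.
  rewrite -sqrtrM ?sqr_ge0// ltr_sqrt; last by rewrite ltr_pwDl ?sqr_ge0// exprn_gt0.
  rewrite mulrDr mulr1 ltrD2l -exprMn -[ltRHS]real_normK ?num_real//.
  rewrite ltr_pXn2r ?nnegrE ?mulr_ge0 ?(ltW nR0) ?(ltW dl0)//.
  by move: H; rewrite normrM normfV (gtr0_norm nR0) ltr_pdivlMr// mulrC.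
Qed.

(** Each of the n terms has mean at most n^(-3/2) [rho]; then Markov's inequality. *)
Lemma cubes_small (dl : R) n : (0 < dl)%R -> (0 < n)%N ->
  P [set w | (dl < \sum_(i < n) (`|(Num.sqrt n%:R)^-1 * (W i w).1| +
    `|(Num.sqrt n%:R)^-1 * (W i w).2|) ^+ 3)%R] <= (rho / dl / Num.sqrt n%:R)%:E.
Proof.
move=> dl0 n0; have [m3 _ _] := mW.
have q0 : (0 < Num.sqrt n%:R :> R)%R by rewrite sqrtr_gt0 ltr0n.
set s := ((Num.sqrt n%:R)^-1)%R; have s0 : (0 < s)%R by rewrite invr_gt0.
pose f w := (\sum_(i < n) s ^+ 3 * norm1 (W i w) ^+ 3)%R.
have mWi i : measurable_fun setT (fun w => norm1 (W i w) ^+ 3)%R.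
  by apply: measurable_funX; apply: measurableT_comp; [exact: measurable_norm1|].
have mf : measurable_fun setT f.
  by apply: measurable_sum => i; exact: measurable_funM.
have f0 w : (0 <= f w)%R.
  by apply: sumr_ge0 => i _; rewrite mulr_ge0 ?exprn_ge0 ?(ltW s0)// norm1_ge0.
rewrite [X in P X](_ : _ = [set w | (dl < f w)%R]); last first.
  apply: eq_set => w; congr (is_true (_ < _)%R); apply: eq_bigr => i _.
  by rewrite !normrM (gtr0_norm s0) -mulrDr exprMn.
have -> : (rho / dl / Num.sqrt n%:R = rho / Num.sqrt n%:R / dl)%R by rewrite mulrAC.
apply: markov_bound => //; rewrite /f.
under eq_integral do rewrite -sumEFin.
rewrite ge0_integral_sum//; last 2 first.
- by move=> i; apply/measurable_EFinP; exact: measurable_funM.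
- by move=> i w _; rewrite lee_fin mulr_ge0 ?exprn_ge0 ?(ltW s0)// norm1_ge0.
have E i : \int[P]_w (s ^+ 3 * norm1 (W i w) ^+ 3)%:E <= (s ^+ 3 * rho)%:E.
  have m3n : measurable_fun [set: R * R] (fun y => (norm1 y ^+ 3)%:E).
    by apply/measurable_EFinP; apply: measurable_funX; exact: measurable_norm1.
  have n3 y : 0 <= (norm1 y ^+ 3)%:E :> \bar R by rewrite lee_fin exprn_ge0// norm1_ge0.
  under eq_integral do rewrite EFinM.
  rewrite ge0_integralZl//; last 2 first.
  - exact/measurable_EFinP.
  - by rewrite lee_fin exprn_ge0// ltW.
  rewrite (EFinM (s ^+ 3) rho) lee_wpmul2l ?lee_fin ?exprn_ge0 ?(ltW s0)//.
  apply: le_trans m3; rewrite le_eqVlt; apply/orP; left; apply/eqP.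
  rewrite -(ge0_integral_distribution (W i) m3n n3).
  by apply: eq_measure_integral => A mA _; exact: dW.
apply: (@le_trans _ _ (\sum_(k < n) (s ^+ 3 * rho)%:E)).
  by apply: lee_sum => k _; exact: E.
rewrite sumEFin lee_fin sumr_const card_ord -[(_ *+ n)%R]mulr_natr.
rewrite le_eqVlt; apply/orP; left; apply/eqP; rewrite /s.
have := sqr_sqrtr (ler0n R n); move: (Num.sqrt n%:R) q0 => q q0 <-.
by field; rewrite gt_eqF.
Qed.

(** M is chosen from [ka] by tightness, dl from [eta] and M, and only then is n taken large. *)
Lemma good_event (eta ka : R) : (0 < eta)%R -> (0 < ka)%R ->
  exists M dl : R, [/\ (1 <= M)%R, (0 < dl)%R, (20 * (20 * (20 * (M ^+ 3 * dl))) <= eta)%R &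
    exists N, forall n, (N <= n)%N -> [/\ (0 < n)%N, (M ^+ 2 <= dl * n%:R)%R &
    exists A, [/\ measurable A, P A <= ka%:E & forall w, ~ A w ->
      let a (i : 'I_n) := ((Num.sqrt n%:R)^-1 * (W i w).1)%R in
      let b (i : 'I_n) := ((Num.sqrt n%:R)^-1 * (W i w).2)%R in
      [/\ (`|\sum_(i < n) a i| <= M)%R /\ (`|\sum_(i < n) b i| <= M)%R,
          (`|\sum_(i < n) a i * a i - 1| <= dl)%R,
          (`|\sum_(i < n) a i * b i| <= dl)%R,
          (`|\sum_(i < n) b i * b i - 1| <= dl)%R &
          (\sum_(i < n) (`|a i| + `|b i|) ^+ 3 <= dl)%R]]]].
Proof.
(* M^(-2) <= 1 / M <= ka / 6; the exceptional event is a union of six, each of probability at most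
   ka / 6. *)
move=> eta0 ka0; pose M := (1 + 6 / ka)%R.
have k6 : (0 < 6 / ka)%R by rewrite divr_gt0.
have M1 : (1 <= M)%R by rewrite lerDl ltW.
have M0 : (0 < M)%R by exact: lt_le_trans M1.
have MV : (M ^- 2 <= ka / 6)%R.
  rewrite -[leRHS]invrK lef_pV2 ?posrE ?exprn_gt0 ?invr_gt0 ?divr_gt0//.
  rewrite invf_div; apply: (@le_trans _ _ M); first by rewrite lerDr.
  by rewrite expr2 ler_peMl// ltW.
pose dl := (eta / (20 * (20 * (20 * M ^+ 3))))%R.
have D0 : (0 < 20 * (20 * (20 * M ^+ 3)))%R by rewrite !mulr_gt0// exprn_gt0.
have dl0 : (0 < dl)%R by rewrite divr_gt0.
have dlE : (20 * (20 * (20 * (M ^+ 3 * dl))) = eta)%R.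
  by rewrite -[RHS](divfK (lt0r_neq0 D0)) -/dl; ring.
clearbody dl; exists M, dl; split => //; first by rewrite dlE.
(* The coefficient - c - e cancels the mean under identity covariance; the centered squares and the
   product of the coordinates are instances. *)
have Q0 (c e f : R) : (\int[distribution P (W 0%N)]_y
    (c + 0 * y.1 + 0 * y.2 + e * y.1 ^+ 2 + f * (y.1 * y.2) + (- c - e) * y.2 ^+ 2) = 0)%R.
  by rewrite (Rintegral_quadratic _ _ _ _ _ _ mW); ring.
have bnd (y : R * R) : (`|y.1| <= norm1 y /\ `|y.2| <= norm1 y)%R.
  by rewrite /norm1 lerDl lerDr !normr_ge0.
have sq1 (x p : R) : (0 <= p -> `|x| <= p -> `|x ^+ 2 - 1| <= (1 + p) ^+ 2)%R.
  move=> p0 xp; apply: (le_trans (ler_normB _ _)); rewrite normr1 normrX.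
  have : (`|x| ^+ 2 <= p ^+ 2)%R by rewrite lerXn2r// nnegrE.
  by rewrite sqrrD; lra.
have [C1 C10 H1] : exists2 C, (0 <= C)%R & forall n, (0 < n)%N ->
    P [set w | (dl < `|(\sum_(i < n) ((W i w).1 ^+ 2 - 1)) / n%:R|)%R] <= (C / Num.sqrt n%:R)%:E.
  apply: (@weak_law (fun y => y.1 ^+ 2 - 1)%R) => //.
  - by apply: measurable_funB => //; exact: measurable_funX.
  - by move=> y; apply: sq1 (norm1_ge0 y) _; have [] := bnd y.
  - apply: etrans (Q0 (- 1) 1 0)%R; apply: eq_Rintegral => y _; ring.
have [C2 C20 H2] : exists2 C, (0 <= C)%R & forall n, (0 < n)%N ->
    P [set w | (dl < `|(\sum_(i < n) ((W i w).1 * (W i w).2)) / n%:R|)%R] <= (C / Num.sqrt n%:R)%:E.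
  apply: (@weak_law (fun y => y.1 * y.2)%R) => //.
  - exact: measurable_funM.
  - move=> y; have [y1 y2] := bnd y; rewrite normrM.
    apply: (@le_trans _ _ (norm1 y ^+ 2)%R); first by rewrite expr2 ler_pM.
    by rewrite lerXn2r ?nnegrE ?addr_ge0 ?norm1_ge0// lerDr.
  - apply: etrans (Q0 0 0 1)%R; apply: eq_Rintegral => y _; ring.
have [C3 C30 H3] : exists2 C, (0 <= C)%R & forall n, (0 < n)%N ->
    P [set w | (dl < `|(\sum_(i < n) ((W i w).2 ^+ 2 - 1)) / n%:R|)%R] <= (C / Num.sqrt n%:R)%:E.
  apply: (@weak_law (fun y => y.2 ^+ 2 - 1)%R) => //.
  - by apply: measurable_funB => //; exact: measurable_funX.
  - by move=> y; apply: sq1 (norm1_ge0 y) _; have [] := bnd y.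
  - apply: etrans (Q0 (- 1) 0 0)%R; apply: eq_Rintegral => y _; ring.
have rho0 : (0 <= rho)%R.
  have [+ _ _] := mW; rewrite -lee_fin; apply: le_trans; apply: integral_ge0 => y _.
  by rewrite lee_fin exprn_ge0// norm1_ge0.
(* Each constant is at most the sum, so one threshold for n serves the four bounds of order
   n^(-1/2). *)
have C0 : (0 <= C1 + C2 + C3 + rho / dl)%R.
  by rewrite !addr_ge0// divr_ge0// ltW.
have k60 : (0 < ka / 6)%R by rewrite divr_gt0.
have [N HN] := cst_div_sqrtn_le C0 k60.
exists (maxn N (Num.truncn (M ^+ 2 / dl)).+1) => n; rewrite geq_max => /andP[nN nM].
have [n0 Cn] := HN n nN.
have q0 : (0 < Num.sqrt n%:R :> R)%R by rewrite sqrtr_gt0 ltr0n.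
split => //.
  rewrite mulrC -ler_pdivrMr//; apply: (le_trans (ltW (truncnS_gt _))).
  by rewrite ler_nat.
have small (C : R) : (C <= C1 + C2 + C3 + rho / dl -> C / Num.sqrt n%:R <= ka / 6)%R.
  by move=> CC; apply: le_trans Cn; rewrite ler_pM2r ?invr_gt0.
have r0 : (0 <= rho / dl)%R by rewrite divr_ge0// ltW.
set s := ((Num.sqrt n%:R)^-1)%R.
have s2 : (s ^+ 2 = n%:R^-1)%R by rewrite exprVn sqr_sqrtr// ler0n.
pose A1 := [set w | (M < `|1 * (normalized_sum W n w).1 + 0 * (normalized_sum W n w).2|)%R].
pose A2 := [set w | (M < `|0 * (normalized_sum W n w).1 + 1 * (normalized_sum W n w).2|)%R].
pose A3 := [set w | (dl < `|(\sum_(i < n) ((W i w).1 ^+ 2 - 1)) / n%:R|)%R].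
pose A4 := [set w | (dl < `|(\sum_(i < n) ((W i w).1 * (W i w).2)) / n%:R|)%R].
pose A5 := [set w | (dl < `|(\sum_(i < n) ((W i w).2 ^+ 2 - 1)) / n%:R|)%R].
pose A6 := [set w | (dl < \sum_(i < n) (`|s * (W i w).1| + `|s * (W i w).2|) ^+ 3)%R].
have mW1 i : measurable_fun setT (fun w => (W i w).1) by exact: measurableT_comp.
have mW2 i : measurable_fun setT (fun w => (W i w).2) by exact: measurableT_comp.
have mZ1 : measurable_fun setT (fun w => (normalized_sum W n w).1).
  by apply: measurableT_comp => //; exact: measurable_normalized_sum.
have mZ2 : measurable_fun setT (fun w => (normalized_sum W n w).2).
  by apply: measurableT_comp => //; exact: measurable_normalized_sum.
have mA1 : measurable A1.
  apply: measurable_lt_set; apply: measurableT_comp => //.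
  by apply: measurable_funD; exact: measurable_funM.
have mA2 : measurable A2.
  apply: measurable_lt_set; apply: measurableT_comp => //.
  by apply: measurable_funD; exact: measurable_funM.
have mA3 : measurable A3.
  apply: measurable_lt_set; apply: measurableT_comp => //; apply: measurable_funM => //.
  by apply: measurable_sum => i; apply: measurable_funB => //; exact: measurable_funX.
have mA4 : measurable A4.
  apply: measurable_lt_set; apply: measurableT_comp => //; apply: measurable_funM => //.
  by apply: measurable_sum => i; exact: measurable_funM.
have mA5 : measurable A5.
  apply: measurable_lt_set; apply: measurableT_comp => //; apply: measurable_funM => //.
  by apply: measurable_sum => i; apply: measurable_funB => //; exact: measurable_funX.
have mA6 : measurable A6.
  apply: measurable_lt_set; apply: measurable_sum => i; apply: measurable_funX.
  by apply: measurable_funD; apply: measurableT_comp => //; exact: measurable_funM.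
have P1 : P A1 <= (ka / 6)%:E.
  apply: (le_trans (normalized_sum_tight _ n0 M0)); last by rewrite lee_fin.
  by rewrite expr1n expr0n addr0.
have P2 : P A2 <= (ka / 6)%:E.
  apply: (le_trans (normalized_sum_tight _ n0 M0)); last by rewrite lee_fin.
  by rewrite expr1n expr0n add0r.
have P3 : P A3 <= (ka / 6)%:E.
  by apply: (le_trans (H1 n n0)); rewrite lee_fin small//; lra.
have P4 : P A4 <= (ka / 6)%:E.
  by apply: (le_trans (H2 n n0)); rewrite lee_fin small//; lra.
have P5 : P A5 <= (ka / 6)%:E.
  by apply: (le_trans (H3 n n0)); rewrite lee_fin small//; lra.
have P6 : P A6 <= (ka / 6)%:E.
  by apply: (le_trans (cubes_small dl0 n0)); rewrite lee_fin small//; lra.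
have m12 := measurableU _ _ mA1 mA2; have m13 := measurableU _ _ m12 mA3.
have m14 := measurableU _ _ m13 mA4; have m15 := measurableU _ _ m14 mA5.
exists (A1 `|` A2 `|` A3 `|` A4 `|` A5 `|` A6); split.
- exact: measurableU.
- have U (A B : set T) (p q : R) : measurable A -> measurable B -> P A <= p%:E ->
      P B <= q%:E -> P (A `|` B) <= (p + q)%:E.
    by move=> mA mB pA pB; rewrite EFinD (le_trans (measureU2 _ _ _))// leeD.
  rewrite [X in X%:E](_ : _ = ka / 6 + ka / 6 + ka / 6 + ka / 6 + ka / 6 + ka / 6)%R; last by field.
  exact: (U _ _ _ _ m15 mA6 (U _ _ _ _ m14 mA5 (U _ _ _ _ m13 mA4 (U _ _ _ _ m12 mA3
    (U _ _ _ _ mA1 mA2 P1 P2) P3) P4) P5) P6).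
- move=> w nA a b.
  have nlt (x y : R) (B : set T) : (B w <-> (x < y)%R) -> ~ B w -> (y <= x)%R.
    by move=> BE nB; rewrite leNgt; apply/negP => xy; apply: nB; apply/BE.
  have n15 H := nA (or_introl H); have nA6 H := nA (or_intror H).
  have n14 H := n15 (or_introl H); have nA5 H := n15 (or_intror H).
  have n13 H := n14 (or_introl H); have nA4 H := n14 (or_intror H).
  have n12 H := n13 (or_introl H); have nA3 H := n13 (or_intror H).
  have nA1 H := n12 (or_introl H); have nA2 H := n12 (or_intror H).
  have one : (\sum_(i < n) n%:R^-1 = 1 :> R)%R.
    by rewrite sumr_const card_ord -[(_ *+ _)%R]mulr_natr mulVf// pnatr_eq0 -lt0n.
  have sE (x y : R) : (s * x * (s * y) = n%:R^-1 * (x * y))%R.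
    by rewrite mulrACA -expr2 s2.
  have E3 : (\sum_(i < n) a i * a i - 1 = (\sum_(i < n) ((W i w).1 ^+ 2 - 1)) / n%:R)%R.
    rewrite mulr_suml -[X in (_ - X = _)%R]one -sumrB; apply: eq_bigr => i _.
    by rewrite sE mulrBl mul1r mulrC expr2.
  have E4 : (\sum_(i < n) a i * b i = (\sum_(i < n) ((W i w).1 * (W i w).2)) / n%:R)%R.
    by rewrite mulr_suml; apply: eq_bigr => i _; rewrite sE mulrC.
  have E5 : (\sum_(i < n) b i * b i - 1 = (\sum_(i < n) ((W i w).2 ^+ 2 - 1)) / n%:R)%R.
    rewrite mulr_suml -[X in (_ - X = _)%R]one -sumrB; apply: eq_bigr => i _.
    by rewrite sE mulrBl mul1r mulrC expr2.
  rewrite E3 E4 E5; split; [split|..].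
  + apply: nlt nA1; rewrite /A1 /= mul1r mul0r addr0 /normalized_sum /plane_scale /= fst_sum.
    by rewrite -/s mulr_sumr.
  + apply: nlt nA2; rewrite /A2 /= mul1r mul0r add0r /normalized_sum /plane_scale /= snd_sum.
    by rewrite -/s mulr_sumr.
  + exact: nlt nA3.
  + exact: nlt nA4.
  + exact: nlt nA5.
  + exact: nlt nA6.
Qed.

End good_event.

(** * Measurability of the likelihood ratio *)

Section row_continuity.
Context {R : realType} (n : nat).
Implicit Types f g : 'rV[R]_n -> R.

Lemma continuous_add f g : continuous f -> continuous g -> continuous (fun p => f p + g p).
Proof.
move=> cf cg p; have : {for p, continuous (fun p => f p + g p)}; last exact.
by apply: continuousD; [exact: cf|exact: cg].
Qed.

Lemma continuous_mul f g : continuous f -> continuous g -> continuous (fun p => f p * g p).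
Proof.
move=> cf cg p; have : {for p, continuous (fun p => f p * g p)}; last exact.
by apply: continuousM; [exact: cf|exact: cg].
Qed.

Lemma continuous_abs f : continuous f -> continuous (fun p => `|f p|).
Proof.
move=> cf p; have : {for p, continuous (fun r => `|f r|)}; last exact.
by apply: (@continuous_comp _ _ _ f Num.norm); [exact: cf|exact: norm_continuous].
Qed.

Lemma continuous_negative_part f : continuous f -> continuous (fun p => `|f p| - f p).
Proof.
move=> cf p; have cn := @continuous_abs f cf p; have cp := cf p.
by have : {for p, continuous (fun p => `|f p| - f p)} by exact: continuousB.
Qed.

Lemma continuous_sum I (r : seq I) (F : I -> 'rV[R]_n -> R) :
  (forall i, continuous (F i)) -> continuous (fun p => \sum_(i <- r) F i p).
Proof. by move=> cF; apply: continuous_big => //; exact: add_continuous. Qed.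

Lemma continuous_prod I (r : seq I) (F : I -> 'rV[R]_n -> R) :
  (forall i, continuous (F i)) -> continuous (fun p => \prod_(i <- r) F i p).
Proof. by move=> cF; apply: continuous_big => //; exact: mul_continuous. Qed.

End row_continuity.

Section compact_minimum.
Context {R : realType} (n : nat).
Implicit Types (h : 'rV[R]_n -> R) (p : 'rV[R]_n).

(** A cube with a margin around [0, 1]^n: rational points close to feasible weights may leave
    [0, 1]^n. *)
Let box : set 'rV[R]_n := [set p | forall i, p ord0 i \in `[(- 2), 2]].

Let compact_box : compact box.
Proof.
have := @rV_compact R n (fun=> `[(- 2), 2]%classic) (fun=> @segment_compact _ _ _).
by congr compact.
Qed.

Lemma approximate_zero h : continuous h -> (forall p, 0 <= h p) ->
  (forall k : nat, exists2 p, box p & h p < k.+1%:R^-1) -> exists p, h p = 0.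
Proof.
move=> ch h0 H; have box0 : box !=set0 by have [p bp _] := H 0; exists p.
have [c cb cmin] := EVT_min_rV box0 compact_box (continuous_subspaceT ch).
exists c; apply/eqP; rewrite eq_le h0 andbT leNgt; apply/negP => c0.
have [p bp] := H (Num.truncn (h c)^-1); apply/negP; rewrite -leNgt.
apply: le_trans (cmin p _); last by rewrite inE.
by rewrite invf_ple ?posrE ?invr_gt0//; exact/ltW/truncnS_gt.
Qed.

Lemma rational_approximation h p (e : R) : continuous h -> h p < e ->
  (forall i, 0 <= p ord0 i <= 1) ->
  exists2 q : 'rV[rat]_n, box (map_mx ratr q) & h (map_mx ratr q) < e.
Proof.
move=> ch hp p01.
have /nbhs_ballP[d /= d0 dP] : nbhs p (h @^-1` [set y | y < e]).
  by apply: ch; exact: lt_nbhsl.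
have pd i : p ord0 i < p ord0 i + Num.min d 1 by rewrite ltrDl lt_min d0 ltr01.
pose q := \row_i projT1 (cid (rat_in_itvoo (pd i))).
have qP i : p ord0 i < ratr (q ord0 i) < p ord0 i + Num.min d 1.
  by rewrite mxE; case: cid => r /=; rewrite in_itv.
exists q => [i|].
  rewrite mxE in_itv/=; have /andP[q1 q2] := qP i; have /andP[p0 p1] := p01 i.
  have m1 : Num.min d 1 <= 1 by rewrite ge_min lexx orbT.
  by apply/andP; split; lra.
apply: dP; split=> // i j; rewrite /ball/= !ord1 mxE; have /andP[q1 q2] := qP j.
rewrite ltr0_norm ?subr_lt0// opprB ltrBlDl (lt_le_trans q2)// lerD2l.
by rewrite ge_min lexx.
Qed.

(** By compactness a zero exists iff every level 1 / (k + 1) is undercut somewhere in the box, and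
    by continuity rational points suffice. The event is thus a countable combination of measurable
    ones. *)
Lemma measurable_exists_zero d (T : measurableType d) (H : T -> 'rV[R]_n -> R) :
  (forall w, continuous (H w)) -> (forall p, measurable_fun setT (H^~ p)) ->
  (forall w p, 0 <= H w p) ->
  (forall w p, H w p = 0 -> forall i, 0 <= p ord0 i <= 1) ->
  measurable [set w | exists p, H w p = 0].
Proof.
move=> cH mH H0 H01.
rewrite (_ : mkset _ = \bigcap_k \bigcup_(q : 'rV[rat]_n)
    [set w | box (map_mx ratr q) /\ H w (map_mx ratr q) < k.+1%:R^-1]).
  apply: bigcapT_measurable => k; apply: countable_bigcupT_measurable.
    exact: countableP.
  move=> q; have [bq|nbq] := pselect (box (map_mx ratr q)); last first.
    by rewrite (_ : mkset _ = set0)//; apply/seteqP; split => // w [].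
  rewrite (_ : mkset _ = setT `&` H^~ (map_mx ratr q) @^-1` `]-oo, k.+1%:R^-1[%classic).
    by apply: mH => //; exact: measurable_itv.
  rewrite setTI; apply/seteqP; split => w /=; rewrite in_itv/=; first by case.
  by [].
apply/seteqP; split => w /=.
- move=> [p Hp] k _; have [|q bq Hq] := @rational_approximation (H w) p k.+1%:R^-1 (cH w) _ (H01 w p Hp).
    by rewrite Hp invr_gt0 ltr0n.
  by exists q.
- move=> Hw; apply: approximate_zero => // k.
  by have [q _ [bq Hq]] := Hw k I; exists (map_mx ratr q).
Qed.

(* The supremum of a constrained maximization problem depends measurably on the
   constraint: it is at least c > 0 iff, by compactness, c is reached. *)
Lemma measurable_sup_constrained d (T : measurableType d) (G : T -> 'rV[R]_n -> R)
    (obj : 'rV[R]_n -> R) (B : R) :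
  (forall w, continuous (G w)) -> (forall p, measurable_fun setT (G^~ p)) ->
  (forall w p, 0 <= G w p) ->
  (forall w p, G w p = 0 -> forall i, 0 <= p ord0 i <= 1) ->
  continuous obj -> (forall w p, G w p = 0 -> 0 <= obj p <= B) ->
  measurable_fun setT (fun w => sup [set obj p | p in [set p | G w p = 0]]).
Proof.
move=> cG mG G0 G01 co o0; set V := fun w => _.
have V0 w : 0 <= V w.
  rewrite /V; have [->|/set0P[_ [p Gp _]]] := eqVneq
    [set obj p | p in [set p | G w p = 0]] set0; first by rewrite sup0.
  have /andP[op _] := o0 _ _ Gp; apply: (le_trans op).
  by apply: ub_le_sup; [exists B => _ [r Gr <-]; have /andP[] := o0 _ _ Gr|exists p].
apply: (measurability (@RGenCInfty.G R)) => [|/= _ [_] [c] -> <-].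
  exact: RGenCInfty.measurableE.
apply: measurableI => //.
(* For c <= 0 the event is the whole space: the supremum is nonnegative, with value 0 when nothing
   is feasible. *)
have [c0|c0] := leP c 0.
  rewrite (_ : _ @^-1` _ = setT)//; apply/seteqP; split => // w _.
  by rewrite /= in_itv/= andbT (le_trans c0).
(* Feasibility and c <= obj p together become the vanishing of one continuous nonnegative
   function. *)
pose H w p := G w p + (`|obj p - c| - (obj p - c)).
have H0 w p : 0 <= H w p by rewrite addr_ge0// subr_ge0 ler_norm.
have cH w : continuous (H w).
  exact: (continuous_add (cG w)
    (continuous_negative_part (continuous_add co (@cst_continuous _ _ (- c))))).
have HP w p : H w p = 0 <-> G w p = 0 /\ c <= obj p.
  rewrite /H; split=> [/eqP|[-> cp]]; last by rewrite ger0_norm ?subr_ge0// subrr addr0.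
  rewrite paddr_eq0// ?subr_ge0 ?ler_norm// => /andP[/eqP -> E]; split=> //.
  by rewrite -subr_ge0 ger0_def -subr_eq0.
rewrite (_ : _ @^-1` _ = [set w | exists p, H w p = 0]).
  apply: measurable_exists_zero => //.
  - by move=> p; apply: measurable_funD.
  - by move=> w p /HP[Gp _]; exact: G01 Gp.
apply/seteqP; split => w /=; rewrite in_itv/= andbT.
- move=> cV; apply: approximate_zero => // k.
  have Vc : c - k.+1%:R^-1 / 2 < V w.
    by apply: lt_le_trans cV; rewrite ltrBlDr ltrDl divr_gt0// invr_gt0 ltr0n.
  have S0 : [set obj p | p in [set p | G w p = 0]] !=set0.
    apply/set0P; apply/eqP => S0; move: cV; rewrite /V S0 sup0 leNgt c0//.
  have [_ [p Gp <-] cp] := sup_gt S0 Vc; exists p.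
    move=> i; have /andP[? ?] := G01 _ _ Gp i; rewrite in_itv/=.
    by apply/andP; split; lra.
  have k0 : 0 < k.+1%:R^-1 :> R by rewrite invr_gt0 ltr0n.
  rewrite /H Gp add0r; have [cq|cq] := leP c (obj p).
    by rewrite ger0_norm ?subr_ge0// subrr.
  rewrite ltr0_norm ?subr_lt0//; move: cp; move: (obj p) (k.+1%:R^-1 : R) => y t; lra.
- move=> [p /HP[Gp cp]]; apply: (le_trans cp).
  by apply: ub_le_sup; [exists B => _ [r Gr <-]; have /andP[] := o0 _ _ Gr|exists p].
Qed.

End compact_minimum.

Section measurable_likelihood.
Context d (T : measurableType d) (R : realType) (n : nat).
Implicit Types (p : 'rV[R]_n) (q : 'I_n -> R).

(** Equality and sign constraints are encoded as the zero set of a continuous nonnegative function,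
    the form that [measurable_sup_constrained] takes. *)
Definition simplex_defect q := `|\sum_(i < n) q i - 1| + \sum_(i < n) (`|q i| - q i).

Lemma simplex_defect_ge0 q : 0 <= simplex_defect q.
Proof. by rewrite addr_ge0// sumr_ge0// => i _; rewrite subr_ge0 ler_norm. Qed.

Lemma simplex_defect_eq0 q : simplex_defect q = 0 <->
  (forall i, 0 <= q i) /\ \sum_(i < n) q i = 1.
Proof.
have n0 i : true -> 0 <= `|q i| - q i by rewrite subr_ge0 ler_norm.
rewrite /simplex_defect; split=> [/eqP|[q0 q1]].
  rewrite paddr_eq0 ?sumr_ge0// normr_eq0 subr_eq0 => /andP[/eqP q1].
  rewrite psumr_eq0// => /allP q0; split=> // i.
  by rewrite ger0_def -subr_eq0; exact: (q0 i (mem_index_enum i)).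
by rewrite q1 subrr normr0 add0r big1// => i _; rewrite ger0_norm// subrr.
Qed.

Let continuous_entry i : continuous (fun p => p ord0 i).
Proof. exact: coord_continuous. Qed.

Lemma continuous_simplex_defect : continuous (fun p => simplex_defect (p ord0)).
Proof.
apply: continuous_add.
  apply: continuous_abs; apply: continuous_add; last exact: cst_continuous.
  exact: continuous_sum.
by apply: continuous_sum => i; exact: continuous_negative_part.
Qed.

(** Weights pass from functions to row vectors, where compactness is used; [K] carries the part of
    the constraint that depends on the sample. *)
Lemma measurable_likelihood_sup (K : T -> ('I_n -> R) -> R) :
  (forall w, continuous (fun p => K w (p ord0))) ->
  (forall q, measurable_fun setT (K^~ q)) -> (forall w q, 0 <= K w q) ->
  measurable_fun setT (fun w => sup [set \prod_(i < n) (n%:R * q i) |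
    q in [set q | [/\ forall i, 0 <= q i, \sum_(i < n) q i = 1 & K w q = 0]]]).
Proof.
move=> cK mK K0.
pose G w p := simplex_defect (p ord0) + K w (p ord0).
have GP w p : G w p = 0 <-> simplex_defect (p ord0) = 0 /\ K w (p ord0) = 0.
  split=> [/eqP|[G1 G2]]; last by rewrite /G G1 G2 addr0.
  by rewrite paddr_eq0 ?simplex_defect_ge0// => /andP[/eqP ? /eqP ?].
have itv w p : G w p = 0 -> forall i, 0 <= p ord0 i <= 1.
  move=> /GP[/simplex_defect_eq0[p0 p1] _] i; rewrite p0/= -p1 (bigD1 i)//= lerDl.
  by rewrite sumr_ge0.
pose obj p := \prod_(i < n) (n%:R * p ord0 i).
have := @measurable_sup_constrained R n _ T G obj (\prod_(i < n) n%:R).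
have -> : (fun w => sup [set obj p | p in [set p | G w p = 0]]) =
    (fun w => sup [set \prod_(i < n) (n%:R * q i) |
    q in [set q | [/\ forall i, 0 <= q i, \sum_(i < n) q i = 1 & K w q = 0]]]).
  apply/funext => w; congr sup; apply/seteqP; split.
    by move=> _ [p /GP[/simplex_defect_eq0[p0 p1] Kp] <-]; exists (p ord0).
  move=> _ [p [p0 p1 Kp] <-]; have rE : (\row_i p i) ord0 = p by apply/funext => i; rewrite mxE.
  exists (\row_i p i); last by rewrite /obj rE.
  by apply/GP; rewrite rE; split=> //; exact/simplex_defect_eq0.
apply.
- by move=> w; apply: continuous_add => //; exact: continuous_simplex_defect.
- by move=> p; apply: measurable_funD.
- by move=> w p; rewrite addr_ge0// simplex_defect_ge0.
- exact: itv.
- apply: continuous_prod => i; apply: continuous_mul => //; exact: cst_continuous.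
- move=> w p Gp; have h := itv w p Gp; apply/andP; split.
    by apply: prodr_ge0 => i _; rewrite mulr_ge0//; have /andP[] := h i.
  apply: ler_prod => i _; have /andP[h0 h1] := h i.
  by rewrite mulr_ge0//= ler_piMr.
Qed.

End measurable_likelihood.

Section measurable_statistic.
Context d (T : measurableType d) (R : realType) (n : nat) (m : R).
Variable X : nat -> T -> R * R.
Hypotheses (n0 : (0 < n)%N) (mX : forall i, measurable_fun setT (X i)).
Let Theta := [set mu : R * R | mu.1 <= mu.2].
Let s : R := (Num.sqrt n%:R)^-1.
(** Every nondegenerate [whiten] describes the same constraints and measurability involves no
    moments, so the parameters are the simplest ones. *)
Let u w (i : 'I_n) := s * (whiten m 1 1 0 (X i w)).1.
Let v w (i : 'I_n) := s * (whiten m 1 1 0 (X i w)).2.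

Let mu_ i : measurable_fun setT (u^~ i).
Proof.
apply: measurable_funM => //; apply: measurable_funM => //; apply: measurable_funB.
  exact: measurableT_comp (mX i).
exact: measurableT_comp (mX i).
Qed.

Let mv_ i : measurable_fun setT (v^~ i).
Proof.
apply: measurable_funM => //; apply: measurable_funM => //; apply: measurable_funB.
  by apply: measurable_funB => //; exact: measurableT_comp (mX i).
apply: measurable_funM => //; apply: measurable_funB.
  exact: measurableT_comp (mX i).
exact: measurableT_comp (mX i).
Qed.

Let dot (y : T -> 'I_n -> R) w (q : 'I_n -> R) := \sum_(i < n) q i * y w i.

Let continuous_dot (y : T -> 'I_n -> R) w : continuous (fun p : 'rV[R]_n => dot y w (p ord0)).
Proof.
apply: continuous_sum => i; apply: continuous_mul; last exact: cst_continuous.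
exact: coord_continuous.
Qed.

Let measurable_dot (y : T -> 'I_n -> R) q : (forall i, measurable_fun setT (y^~ i)) ->
  measurable_fun setT (dot y ^~ q).
Proof. by move=> my; apply: measurable_sum => i; exact: measurable_funM. Qed.

Lemma measurable_EL : measurable_fun setT (fun w => EL n (X^~ w) (m, m)).
Proof.
have := @measurable_likelihood_sup _ T R n (fun w q => `|dot u w q| + `|dot v w q|).
have -> : (fun w => EL n (X^~ w) (m, m)) = (fun w => sup [set \prod_(i < n) (n%:R * q i) |
    q in [set q | [/\ forall i, 0 <= q i, \sum_(i < n) q i = 1 &
      `|dot u w q| + `|dot v w q| = 0]]]).
  apply/funext => w; rewrite /EL; congr (sup (image _ _)).
  apply/seteqP; split=> q /= [q0 q1].
    move=> /(@weights_meanE R n (X^~ w) m 1 1 0 ltr01 ltr01 n0)[qa qb].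
    split=> //; rewrite /dot (_ : \sum_(i < n) _ = 0)// normr0 add0r.
    by rewrite (_ : \sum_(i < n) _ = 0)// normr0.
  move/eqP; rewrite paddr_eq0// !normr_eq0 => /andP[/eqP qa /eqP qb]; split=> //.
  exact/(@weights_meanE R n (X^~ w) m 1 1 0 ltr01 ltr01 n0).
apply.
- move=> w; apply: continuous_add; apply: continuous_abs; exact: continuous_dot.
- move=> q; apply: measurable_funD; apply: measurableT_comp => //; exact: measurable_dot.
- by move=> w q; rewrite addr_ge0.
Qed.

(** By [weights_ThetaE] the iterated supremum, over [nu] and then over weights, is a single one.
    Empty feasible sets, with supremum 0, are treated apart on both sides. *)
Lemma measurable_EL_sup : measurable_fun setT (fun w => EL_sup n (X^~ w) Theta).
Proof.
have := @measurable_likelihood_sup _ T R n (fun w q => `|dot u w q| - dot u w q).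
have -> : (fun w => EL_sup n (X^~ w) Theta) = (fun w => sup [set \prod_(i < n) (n%:R * q i) |
    q in [set q | [/\ forall i, 0 <= q i, \sum_(i < n) q i = 1 &
      `|dot u w q| - dot u w q = 0]]]).
  apply/funext => w.
  have E q : \sum_(i < n) q i = 1 ->
      (exists2 nu, Theta nu & \sum_(i < n) q i *: (X i w - nu) = 0) <->
      `|dot u w q| - dot u w q = 0.
    move=> q1; apply: (iff_trans (@weights_ThetaE R n (X^~ w) m 1 1 0 ltr01 n0 q q1)).
    rewrite ger0_def; split=> [/eqP->|/eqP]; first by rewrite subrr.
    by rewrite subr_eq0.
  set A := [set q | _]; set S := sup _.
  have ubA : has_ubound [set \prod_(i < n) (n%:R * q i) | q in A].
    exists (n%:R ^+ n) => _ [q [q0 q1 /(E _ q1)[nu _ qnu]] <-].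
    by apply: (@EL_ub R n (X^~ w) nu); split.
  have memS nu q : Theta nu -> @EL_weights R n (X^~ w) nu q ->
      \prod_(i < n) (n%:R * q i) <= S.
    move=> nuT [q0 q1 qnu]; apply: ub_le_sup => //; exists q => //; split=> //.
    by apply/E => //; exists nu.
  have S0 : 0 <= S.
    rewrite /S; have [->|/set0P[_ [q Aq _]]] := eqVneq
      [set \prod_(i < n) (n%:R * q i) | q in A] set0; first by rewrite sup0.
    have [q0 _ _] := Aq; apply: (@le_trans _ _ (\prod_(i < n) (n%:R * q i))).
      by apply: prodr_ge0 => i _; rewrite mulr_ge0.
    by apply: ub_le_sup => //; exists q.
  apply/eqP; rewrite eq_le; apply/andP; split.
    apply: ge_sup; first by exists (EL n (X^~ w) (m, m)); exists (m, m) => //; exact: lexx.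
    move=> _ [nu nuT <-]; rewrite /EL; have [->|/set0P ne] := eqVneq
      [set \prod_(i < n) (n%:R * p i) | p in @EL_weights R n (X^~ w) nu] set0.
      by rewrite sup0.
    by apply: ge_sup => // _ [q qw <-]; exact: memS qw.
  have L0 : 0 <= EL_sup n (X^~ w) Theta.
    apply: le_trans (EL_ge0 n (X^~ w) (m, m)) _; apply: ub_le_sup.
      exact: EL_sup_has_ubound.
    by exists (m, m) => //; exact: lexx.
  rewrite /S; have [->|/set0P ne] := eqVneq
      [set \prod_(i < n) (n%:R * q i) | q in A] set0; first by rewrite sup0.
  apply: ge_sup => // _ [q [q0 q1 /(E _ q1)[nu nuT qnu]] <-].
  apply: (@le_trans _ _ (EL n (X^~ w) nu)).
    by apply: ub_le_sup; [exact: EL_has_ubound|exists q].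
  by apply: ub_le_sup; [exact: EL_sup_has_ubound|exists nu].
apply.
- by move=> w; apply: continuous_negative_part; exact: continuous_dot.
- move=> q; apply: measurable_funB; last exact: measurable_dot.
  by apply: measurableT_comp => //; exact: measurable_dot.
- by move=> w q; rewrite subr_ge0 ler_norm.
Qed.

Lemma measurable_ell_constr_le (t : R) :
  measurable [set w | (ell_constr Theta n (X^~ w) (m, m) <= t%:E)%E].
Proof.
have mle (f : T -> R) : measurable_fun setT f -> measurable [set w | 0 <= f w].
  move=> mf; rewrite -[X in measurable X]setTI.
  apply: (mf measurableT [set y | 0 <= y]).
  rewrite (_ : mkset _ = `[0, +oo[%classic); first exact: measurable_itv.
  by apply/seteqP; split => y; rewrite /= in_itv/= andbT.
rewrite (_ : mkset _ =
   ([set w | 0 <= - EL_sup n (X^~ w) Theta] `&` [set _ | 0 <= t]) `|`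
   (~` [set w | 0 <= - EL_sup n (X^~ w) Theta] `&`
    [set w | 0 <= EL n (X^~ w) (m, m) - EL_sup n (X^~ w) Theta * expR (- t / 2)])).
  have m1 : measurable [set w | 0 <= - EL_sup n (X^~ w) Theta].
    by apply: mle; apply: measurableT_comp => //; exact: measurable_EL_sup.
  apply: measurableU.
    apply: measurableI => //; case: (boolP (0 <= t)) => t0.
      by rewrite (_ : mkset _ = setT)//; apply/seteqP; split.
    by rewrite (_ : mkset _ = set0)//; apply/seteqP; split.
  apply: measurableI; first exact: measurableC.
  apply: mle; apply: measurable_funB; first exact: measurable_EL.
  by apply: measurable_funM => //; exact: measurable_EL_sup.
(* The event is expressed by the two likelihoods. If only the one at [(m, m)] vanishes, the
   statistic is +oo and the inequality on the right fails too. *)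
have key w : (ell_constr Theta n (X^~ w) (m, m) <= t%:E)%E =
    if 0 < EL_sup n (X^~ w) Theta
    then EL_sup n (X^~ w) Theta * expR (- t / 2) <= EL n (X^~ w) (m, m) else 0 <= t.
  rewrite /ell_constr; case: ifPn => S0; last by rewrite lee_fin.
  have := EL_ge0 n (X^~ w) (m, m); rewrite le_eqVlt => /predU1P[L0|L0].
    rewrite -L0 mul0r le0_lneNy// mulrNy gtr0_sg// mul1e /=.
    by rewrite leye_eq/= leNgt mulr_gt0// expR_gt0.
  rewrite lne_EFin ?divr_gt0// -EFinM -EFinN lee_fin [X in _ = (X <= _)]mulrC -ler_pdivlMr//.
  rewrite -[X in _ = (_ <= X)]lnK ?posrE ?divr_gt0// ler_expR.
  by apply/idP/idP => ?; lra.
apply/seteqP; split=> w /=; rewrite key oppr_ge0 subr_ge0.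
- case: (ltP 0 (EL_sup n (X^~ w) Theta)) => S0 H; [right|by left].
  by split=> // S1; have := lt_le_trans S0 S1; rewrite ltxx.
- by case: (ltP 0 (EL_sup n (X^~ w) Theta)) => S0 [] [].
Qed.

End measurable_statistic.

(** * Standardization and convergence in distribution *)

Section linear_image_moments.
Context d (T : measurableType d) (R : realType) (P : probability T R).
Variables (Y : T -> R * R) (s11 s12 s22 : R).
Hypotheses (mY : measurable_fun setT Y)
  (Y3 : P.-integrable setT (EFin \o (fun w => norm1 (Y w) ^+ 3)))
  (Y1 : \int[P]_w (Y w).1 = 0) (Y2 : \int[P]_w (Y w).2 = 0)
  (Y11 : \int[P]_w ((Y w).1 * (Y w).1) = s11) (Y12 : \int[P]_w ((Y w).1 * (Y w).2) = s12)
  (Y22 : \int[P]_w ((Y w).2 * (Y w).2) = s22).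

Let integrable_poly (f : T -> R) (C : R) : measurable_fun setT f ->
  (forall w, `|f w| <= C * (1 + norm1 (Y w) ^+ 3)) -> P.-integrable setT (EFin \o f).
Proof.
move=> mf fC.
have i1 : P.-integrable setT (EFin \o (fun=> 1)).
  by apply: (@integrable_bounded _ _ _ P (fun=> 1) 1) => // w; rewrite normr1.
have := integrableZl measurableT C (integrableD measurableT i1 Y3).
apply: le_integrable => //; first exact/measurable_EFinP.
move=> w _; change (`|(f w)%:E| <= `|C%:E * (1%:E + (norm1 (Y w) ^+ 3)%:E)|)%E.
by rewrite -EFinD -EFinM !abse_EFin lee_fin (le_trans (fC w))// ler_norm.
Qed.

Let mY1 : measurable_fun setT (fun w => (Y w).1).
Proof. exact: measurableT_comp measurable_fst mY. Qed.
Let mY2 : measurable_fun setT (fun w => (Y w).2).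
Proof. exact: measurableT_comp measurable_snd mY. Qed.

Let b1 w : [/\ `|(Y w).1| <= 1 + norm1 (Y w) ^+ 3, `|(Y w).2| <= 1 + norm1 (Y w) ^+ 3,
  `|(Y w).1 * (Y w).1| <= 1 + norm1 (Y w) ^+ 3,
  `|(Y w).1 * (Y w).2| <= 1 + norm1 (Y w) ^+ 3 &
  `|(Y w).2 * (Y w).2| <= 1 + norm1 (Y w) ^+ 3].
Proof. by have := moment_bounds (Y w); rewrite !expr2. Qed.

Let lin (a b : R) w := a * (Y w).1 + b * (Y w).2.

Let int1 (f : T -> R) : measurable_fun setT f -> (forall w, `|f w| <= 1 + norm1 (Y w) ^+ 3) ->
  P.-integrable setT (EFin \o f).
Proof. by move=> mf fb; apply: (@integrable_poly f 1) => // w; rewrite mul1r. Qed.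

Let intZ (a : R) (f : T -> R) : P.-integrable setT (EFin \o f) ->
  P.-integrable setT (EFin \o (fun w => a * f w)).
Proof. by move=> /(integrableZl measurableT a); apply: eq_integrable. Qed.

Let intD (f g : T -> R) : P.-integrable setT (EFin \o f) -> P.-integrable setT (EFin \o g) ->
  P.-integrable setT (EFin \o (fun w => f w + g w)).
Proof. by move=> i j; have := integrableD measurableT i j; apply: eq_integrable. Qed.

Let iY1 : P.-integrable setT (EFin \o (fun w => (Y w).1)).
Proof. by apply: int1 => // w; have [] := b1 w. Qed.
Let iY2 : P.-integrable setT (EFin \o (fun w => (Y w).2)).
Proof. by apply: int1 => // w; have [] := b1 w. Qed.
Let iY11 : P.-integrable setT (EFin \o (fun w => (Y w).1 * (Y w).1)).
Proof. by apply: int1 => [|w]; [exact: measurable_funM|have [] := b1 w]. Qed.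
Let iY12 : P.-integrable setT (EFin \o (fun w => (Y w).1 * (Y w).2)).
Proof. by apply: int1 => [|w]; [exact: measurable_funM|have [] := b1 w]. Qed.
Let iY22 : P.-integrable setT (EFin \o (fun w => (Y w).2 * (Y w).2)).
Proof. by apply: int1 => [|w]; [exact: measurable_funM|have [] := b1 w]. Qed.

Let integrable_lin a b : P.-integrable setT (EFin \o lin a b).
Proof. by apply: intD; exact: intZ. Qed.

Let Rintegral_lin a b : \int[P]_w lin a b w = 0.
Proof.
rewrite /lin RintegralD//; [|exact: intZ|exact: intZ].
by rewrite !RintegralZl// Y1 Y2 !mulr0 addr0.
Qed.

Let bilinE a b c e w : lin a b w * lin c e w = (a * c) * ((Y w).1 * (Y w).1) +
  (a * e + b * c) * ((Y w).1 * (Y w).2) + (b * e) * ((Y w).2 * (Y w).2).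
Proof. by rewrite /lin; ring. Qed.

Let integrable_bilin a b c e : P.-integrable setT (EFin \o (fun w => lin a b w * lin c e w)).
Proof.
have : P.-integrable setT (EFin \o (fun w => (a * c) * ((Y w).1 * (Y w).1) +
  (a * e + b * c) * ((Y w).1 * (Y w).2) + (b * e) * ((Y w).2 * (Y w).2))).
  by apply: intD; [apply: intD|]; exact: intZ.
by apply: eq_integrable => // w _; rewrite /= bilinE.
Qed.

Let Rintegral_bilin a b c e : \int[P]_w (lin a b w * lin c e w) =
  a * c * s11 + (a * e + b * c) * s12 + b * e * s22.
Proof.
under eq_Rintegral do rewrite bilinE.
rewrite RintegralD//; [|apply: intD; exact: intZ|exact: intZ].
rewrite RintegralD//; [|exact: intZ|exact: intZ].
by rewrite !RintegralZl// Y11 Y12 Y22.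
Qed.

(** The three equations say that the linear map with rows (a, b) and (c, e) turns the covariance
    matrix into the identity. The third moment survives because the sum of the moduli of the entries
    bounds the map with respect to [norm1]. *)
Lemma linear_image_moments (W : {RV P >-> (R * R)%type}) (a b c e : R) :
  (forall w, W w = (a * (Y w).1 + b * (Y w).2, c * (Y w).1 + e * (Y w).2)) ->
  a * a * s11 + (a * b + b * a) * s12 + b * b * s22 = 1 ->
  a * c * s11 + (a * e + b * c) * s12 + b * e * s22 = 0 ->
  c * c * s11 + (c * e + e * c) * s12 + e * e * s22 = 1 ->
  exists rho, std_moments (distribution P W) 1 rho.
Proof.
move=> WE E1 E2 E3.
have W1 w : (W w).1 = lin a b w by rewrite WE.
have W2 w : (W w).2 = lin c e w by rewrite WE.
have push (f : R * R -> R) (g : T -> R) : measurable_fun setT f ->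
    (forall w, f (W w) = g w) -> P.-integrable setT (EFin \o g) ->
    \int[distribution P W]_y f y = \int[P]_w g w.
  move=> mf fg ig; rewrite /Rintegral integral_distribution//.
  - by congr fine; apply: eq_integral => w _; rewrite /= fg.
  - exact/measurable_EFinP.
  - by apply: eq_integrable ig => // w _; rewrite /= fg.
have mn : measurable_fun [set: R * R] (fun y => (norm1 y ^+ 3)%:E).
  by apply/measurable_EFinP; apply: measurable_funX; exact: measurable_norm1.
have n0 (y : R * R) : (0 <= (norm1 y ^+ 3)%:E)%E by rewrite lee_fin exprn_ge0// norm1_ge0.
pose K := (`|a| + `|b| + `|c| + `|e|) ^+ 3.
have i3 : P.-integrable setT (EFin \o (fun w => norm1 (W w) ^+ 3)).
  apply: (@integrable_poly _ K).
    apply: measurable_funX; apply: measurableT_comp; last by [].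
    exact: measurable_norm1.
  move=> w; rewrite normrX ger0_norm ?norm1_ge0//.
  apply: (@le_trans _ _ (K * norm1 (Y w) ^+ 3)); last first.
    by rewrite ler_wpM2l ?exprn_ge0 ?addr_ge0// lerDr.
  rewrite -exprMn lerXn2r ?nnegrE ?norm1_ge0 ?mulr_ge0 ?addr_ge0 ?norm1_ge0//.
  rewrite /norm1 W1 W2 /lin.
  have L (p q y z : R) : `|p * y + q * z| <= (`|p| + `|q|) * (`|y| + `|z|).
    apply: (le_trans (ler_normD _ _)); rewrite !normrM mulrDl !mulrDr.
    by rewrite lerD// ?lerDl ?lerDr mulr_ge0.
  apply: (le_trans (lerD (L a b _ _) (L c e _ _))).
  by rewrite -mulrDl addrA.
have E : (\int[distribution P W]_y (norm1 y ^+ 3)%:E < +oo)%E.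
  rewrite (ge0_integral_distribution W mn n0).
  have /integrableP[_] := i3; apply: le_lt_trans.
  rewrite le_eqVlt; apply/orP; left; apply/eqP.
  by apply: eq_integral => w _; rewrite /= ger0_norm ?exprn_ge0 ?norm1_ge0.
exists (fine (\int[distribution P W]_y (norm1 y ^+ 3)%:E)); split.
- by rewrite fineK// ge0_fin_numE// integral_ge0.
- split.
  + exact: etrans (push fst _ measurable_fst W1 (integrable_lin a b)) (Rintegral_lin a b).
  + exact: etrans (push snd _ measurable_snd W2 (integrable_lin c e)) (Rintegral_lin c e).
- split.
  + rewrite (push (fun y => y.1 ^+ 2) (fun w => lin a b w * lin a b w)) ?Rintegral_bilin//.
      by apply: measurable_funX; exact: measurable_fst.
    by move=> w; rewrite W1 expr2.
  + rewrite (push (fun y => y.1 * y.2) (fun w => lin a b w * lin c e w)) ?Rintegral_bilin//.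
      exact: measurable_funM measurable_fst measurable_snd.
    by move=> w; rewrite W1 W2.
  + rewrite (push (fun y => y.2 ^+ 2) (fun w => lin c e w * lin c e w)) ?Rintegral_bilin//.
      by apply: measurable_funX; exact: measurable_snd.
    by move=> w; rewrite W2 expr2.
Qed.

End linear_image_moments.

Lemma quadratic_form2_gt0 (R : realType) (A : 'M[R]_2) (p q : R) : posdefmx A ->
  (p != 0) || (q != 0) ->
  0 < p * p * A ord0 ord0 + (p * q + q * p) * A ord0 ord_max + q * q * A ord_max ord_max.
Proof.
move=> [As A0] pq; pose v : 'rV[R]_2 := \row_j (if j == ord0 then p else q).
have v0 : v != 0.
  apply: contraTneq pq => /rowP v0.
  by have := v0 ord0; have := v0 ord_max; rewrite !mxE /= => -> ->; rewrite eqxx.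
have A10 : A ord_max ord0 = A ord0 ord_max by rewrite -[in LHS]As mxE.
have := A0 v v0; rewrite !mxE !big_ord_recr !big_ord0 /= !mxE.
rewrite !big_ord_recr !big_ord0 /= !mxE !add0r.
have -> : widen_ord (leqnSn 1) ord_max = ord0 :> 'I_2 by exact/val_inj.
rewrite /= A10; move: (A _ _) => a; move: (A _ _) => b; move: (A _ _) => c.
by congr (0 < _); ring.
Qed.

Section standardization.
Context d (T : measurableType d) (R : realType) (P : probability T R) (m : R).
Variable X : {RV P >-> (R * R)%type}.
Hypotheses (X1 : 'E_P[fst \o X]%E = m%:E) (X2 : 'E_P[snd \o X]%E = m%:E)
  (varX : posdefmx (covariance_mx X))
  (mom3X : ('E_P[fun w => (enorm (X w - (m, m)) ^+ 3)%R] < +oo)%E).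

Let Y w := X w - (m, m).

Let mY : measurable_fun setT Y.
Proof.
apply/measurable_fun_pairP; split.
  by apply: measurable_funB => //; exact: measurableT_comp measurable_fst _.
by apply: measurable_funB => //; exact: measurableT_comp measurable_snd _.
Qed.

Let mnorm1Y : measurable_fun setT (fun w => norm1 (Y w) ^+ 3).
Proof. by apply: measurable_funX; exact: measurableT_comp (@measurable_norm1 R) mY. Qed.

Let Y3 : P.-integrable setT (EFin \o (fun w => norm1 (Y w) ^+ 3)).
Proof.
have menorm : measurable_fun setT (fun w => enorm (Y w)).
  have msqrt := continuous_measurable_fun (@sqrt_continuous R).
  change (measurable_fun setT (Num.sqrt \o (fun w => (Y w).1 ^+ 2 + (Y w).2 ^+ 2))).
  apply: (measurableT_comp msqrt).
  apply: measurable_funD; apply: measurable_funX.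
    exact: measurableT_comp measurable_fst mY.
  exact: measurableT_comp measurable_snd mY.
have enorm0 w : 0 <= enorm (Y w) by exact: sqrtr_ge0.
have i3 : P.-integrable setT (EFin \o (fun w => enorm (Y w) ^+ 3)).
  apply/integrableP; split; first by apply/measurable_EFinP; exact: measurable_funX.
  apply: le_lt_trans mom3X; rewrite unlock le_eqVlt; apply/orP; left; apply/eqP.
  by apply: eq_integral => w _; rewrite /= ger0_norm// exprn_ge0.
have := integrableZl measurableT (2 ^+ 3) i3.
apply: le_integrable => //; first exact/measurable_EFinP.
move=> w _; change (`|(norm1 (Y w) ^+ 3)%:E| <= `|(2 ^+ 3)%:E * (enorm (Y w) ^+ 3)%:E|)%E.
rewrite -EFinM !abse_EFin lee_fin -exprMn !ger0_norm ?exprn_ge0 ?norm1_ge0 ?mulr_ge0//.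
rewrite lerXn2r ?nnegrE ?norm1_ge0 ?mulr_ge0// /norm1 mulr_natl mulr2n lerD//.
  by rewrite -sqrtr_sqr /enorm ler_sqrt ?lerDl ?sqr_ge0// addr_ge0 ?sqr_ge0.
by rewrite -sqrtr_sqr /enorm ler_sqrt ?lerDr ?sqr_ge0// addr_ge0 ?sqr_ge0.
Qed.

Let center (f : R * R -> R) : measurable_fun setT f -> f (m, m) = m ->
  (forall w, f (Y w) = f (X w) - m) -> (forall z, `|f z| <= norm1 z) ->
  'E_P[f \o X]%E = m%:E -> \int[P]_w (f (Y w)) = 0.
Proof.
move=> mf fm fY f1 EX.
have ic : P.-integrable setT (EFin \o (fun=> m)).
  by apply: (@integrable_bounded _ _ _ P (fun=> m) `|m|).
have iY : P.-integrable setT (EFin \o (fun w => f (Y w))).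
  have i1 : P.-integrable setT (EFin \o (fun=> 1)).
    by apply: (@integrable_bounded _ _ _ P (fun=> 1) 1) => // w; rewrite normr1.
  have := integrableD measurableT i1 Y3.
  apply: le_integrable => //.
    by apply/measurable_EFinP; exact: measurableT_comp mf mY.
  move=> w _; change (`|(f (Y w))%:E| <= `|1%:E + (norm1 (Y w) ^+ 3)%:E|)%E.
  rewrite -EFinD !abse_EFin lee_fin (le_trans (f1 _))//.
  rewrite [leRHS]ger0_norm ?addr_ge0 ?exprn_ge0 ?norm1_ge0//.
  have := norm1_ge0 (Y w); move: (norm1 _) => r r0.
  have [r1|/ltW r1] := leP r 1; first by rewrite (le_trans r1)// lerDl exprn_ge0.
  by rewrite (@le_trans _ _ (r ^+ 3)) ?lerDr// -[leLHS]expr1 ler_weXn2l.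
have : \int[P]_w (f (Y w) + m) = m.
  move: EX; rewrite unlock => EX; rewrite -[RHS]/(fine m%:E) -EX /Rintegral.
  by congr fine; apply: eq_integral => w _; rewrite fY subrK.
rewrite RintegralD// /Rintegral.
rewrite [X in _ + X](_ : _ = m); last first.
  by rewrite integral_cst//; rewrite (_ : (_ * _)%E = m%:E)// -[RHS]mule1; congr mule; exact: probability_setT.
lra.
Qed.

(** Gram-Schmidt orthogonalization that starts from x2 - x1: [be] is the coefficient of the
    regression of x2 on x2 - x1, and sg^2 and tau^2 are the variances of x2 - x1 and of the
    residual. *)
Lemma exists_whitening : exists sg tau be : R, [/\ 0 < sg, 0 < tau &
  forall W : {RV P >-> (R * R)%type}, (forall w, W w = whiten m sg tau be (X w)) ->
  exists rho, std_moments (distribution P W) 1 rho].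
Proof.
pose A := covariance_mx X.
have EX (i : 'I_2) : fine 'E_P[Defs.coord i \o X]%E = m.
  by rewrite -[RHS]/(fine m%:E) /Defs.coord; case: (i == ord0); [rewrite -X1|rewrite -X2].
have coordY (i : 'I_2) w : Defs.coord i (Y w) = Defs.coord i (X w) - m by rewrite /Defs.coord; case: ifP.
have covE (i j : 'I_2) : \int[P]_w (Defs.coord i (Y w) * Defs.coord j (Y w)) = A i j.
  rewrite /A mxE covariance.unlock !EX unlock /Rintegral; congr fine.
  by apply: eq_integral => w _; rewrite !coordY.
have A11 : \int[P]_w ((Y w).1 * (Y w).1) = A ord0 ord0 by rewrite -covE.
have A12 : \int[P]_w ((Y w).1 * (Y w).2) = A ord0 ord_max by rewrite -covE.
have A22 : \int[P]_w ((Y w).2 * (Y w).2) = A ord_max ord_max by rewrite -covE.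
have Y1 : \int[P]_w (Y w).1 = 0.
  by apply: (center (f := fst)) => // z; rewrite /norm1 lerDl.
have Y2 : \int[P]_w (Y w).2 = 0.
  by apply: (center (f := snd)) => // z; rewrite /norm1 lerDr.
have quad p q := @quadratic_form2_gt0 R A p q varX.
set s11 := A ord0 ord0 in A11 quad; set s12 := A ord0 ord_max in A12 quad.
set s22 := A ord_max ord_max in A22 quad.
pose V := (-1) * (-1) * s11 + (-1 * 1 + 1 * -1) * s12 + 1 * 1 * s22.
have V0 : 0 < V by apply: quad; rewrite oner_eq0 orbT.
pose be := (s22 - s12) / V.
have orth : be * (s11 - s12) = (1 - be) * (s22 - s12).
  have : be * V = s22 - s12 by rewrite divfK// gt_eqF.
  by rewrite /V; move: (be) => c; lra.
pose U := be * be * s11 + (be * (1 - be) + (1 - be) * be) * s12 + (1 - be) * (1 - be) * s22.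
(* The residual is be x1 + (1 - be) x2 up to a constant, and its two coefficients cannot both
   vanish. *)
have U0 : 0 < U.
  apply: quad; rewrite -negb_and; apply/negP => /andP[/eqP-> ]; rewrite subr0 oner_eq0//.
have sV : 0 < Num.sqrt V by rewrite sqrtr_gt0.
have sU : 0 < Num.sqrt U by rewrite sqrtr_gt0.
have sVE : Num.sqrt V * Num.sqrt V = V by rewrite -expr2 sqr_sqrtr// ltW.
have sUE : Num.sqrt U * Num.sqrt U = U by rewrite -expr2 sqr_sqrtr// ltW.
exists (Num.sqrt V), (Num.sqrt U), be; split => // W WE.
move: sV sU sVE sUE WE; move: (Num.sqrt V) (Num.sqrt U) => g h g0 h0 gE hE WE.
have g1 : g != 0 by rewrite gt_eqF.
have h1 : h != 0 by rewrite gt_eqF.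
apply: (linear_image_moments mY Y3 Y1 Y2 A11 A12 A22 (a := - g^-1) (b := g^-1)
  (c := be / h) (e := (1 - be) / h)).
- move=> w; rewrite WE /whiten /Y /=; by congr pair; field.
- transitivity (V / (g * g)); first by rewrite /V; field.
  by rewrite gE divff// gt_eqF.
- transitivity ((- (be * (s11 - s12)) + (1 - be) * (s22 - s12)) / (g * h)).
    by field; apply/andP.
  by rewrite orth addNr mul0r.
- transitivity (U / (h * h)); first by rewrite /U; field.
  by rewrite hE divff// gt_eqF.
Qed.

End standardization.

Section constrained_likelihood_limit.
Context d (T : measurableType d) (R : realType) (P : probability T R) (m : R).
Variables (X : nat -> {RV P >-> (R * R)%type}) (sg tau be rho : R).
Let Theta := [set mu : R * R | mu.1 <= mu.2].

Lemma measurable_whiten : measurable_fun setT (whiten m sg tau be).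
Proof.
have mgap : measurable_fun setT (fun x : R * R => x.2 - x.1).
  exact: measurable_funB measurable_snd measurable_fst.
apply/measurable_fun_pairP; split; apply: measurable_funM => //.
by apply: measurable_funB; [exact: measurable_funB measurable_snd _|exact: measurable_funM].
Qed.

Let W := comp_rv X measurable_whiten.
Hypotheses (sg0 : 0 < sg) (tau0 : 0 < tau) (iX : mutually_independent X)
  (dX : identically_distributed X) (mW : std_moments (distribution P (W 0%N)) 1 rho).

Let iW : mutually_independent W. Proof. exact: mutually_independent_comp. Qed.
Let dW : identically_distributed W. Proof. exact: identically_distributed_comp. Qed.

Let ell_cdf t n := P [set w | (ell_constr Theta n (fun i => X i w) (m, m) <= t%:E)%E].

Lemma ell_constr_approx_prob (eta ka : R) : 0 < eta -> eta <= 1 -> 0 < ka ->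
  \forall n \near \oo, exists A, [/\ measurable A, (P A <= ka%:E)%E & forall w, ~ A w ->
    exists2 l, ell_constr Theta n (fun i => X i w) (m, m) = l%:E &
      `|l - chi_stat (normalized_sum W n w)| <= 2 * eta].
Proof.
move=> eta0 eta1 ka0.
have [M [dl [M1 dl0 Mdl [N HN]]]] := good_event iW dW mW eta0 ka0.
exists N => // n Nn; have [n0 Mn [A [mA PA HA]]] := HN _ Nn.
exists A; split => // w /HA[[z1 z2] aa ab bb cubes].
rewrite (_ : normalized_sum W n w = (\sum_(i < n) (Num.sqrt n%:R)^-1 * (W i w).1,
    \sum_(i < n) (Num.sqrt n%:R)^-1 * (W i w).2)); last first.
  by rewrite /normalized_sum /plane_scale /rv_sum fst_sum snd_sum !mulr_sumr.
exact: (@ell_constr_approx R n (fun i => X i w) m sg tau be M dl eta).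
Qed.

Let mell n t : (0 < n)%N ->
  measurable [set w | (ell_constr Theta n (fun i => X i w) (m, m) <= t%:E)%E].
Proof.
by move=> n0; apply: (@measurable_ell_constr_le _ _ _ n m (fun i => X i : T -> R * R)).
Qed.

Let mchi n s : measurable [set w | (chi_stat (normalized_sum W n w) <= s)%R].
Proof.
rewrite -[X in measurable X]setTI.
have mc : measurable_fun setT (fun w => chi_stat (normalized_sum W n w)).
  by apply: measurableT_comp; [exact: measurable_chi_stat|exact: measurable_normalized_sum].
have := mc measurableT _ (measurable_itv `]-oo, s]).
by congr measurable; apply/seteqP; split => w /=; rewrite in_itv.
Qed.

Let Q s : \bar R := chi2bar12 `]-oo, s]%classic.

Let QE s : Q s = gaussp [set z | (chi_stat z <= s)%R].
Proof. exact: chi2bar12_cdf. Qed.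

(** The statistic is within 2 eta of [chi_stat], and widening to 3 eta supplies the gap that
    [chi_clt] asks for. One e pays for the exceptional event, the other for [chi_clt]. *)
Lemma ell_constr_cdf_approx (t eta e : R) : 0 < eta -> eta <= 1 -> 0 < e ->
  \forall n \near \oo, (ell_cdf t n <= Q (t + 3 * eta)%R + (e + e)%R%:E)%E /\
    (Q (t - 3 * eta)%R <= ell_cdf t n + (e + e)%R%:E)%E.
Proof.
move=> eta0 eta1 e0.
have H := ell_constr_approx_prob eta0 eta1 e0.
have lt1 : t + 2 * eta < t + 3 * eta by rewrite ltrD2l ltr_pM2r// ltr_nat.
have lt2 : t - 3 * eta < t - 2 * eta by rewrite ltrD2l ltrN2 ltr_pM2r// ltr_nat.
have C1 := chi_clt iW dW mW lt1 e0; have C2 := chi_clt iW dW mW lt2 e0.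
near=> n.
have n0 : (0 < n)%N by near: n; exact: nbhs_infty_gt.
have [A [mA PA HA]] : exists A, [/\ measurable A, (P A <= e%:E)%E & forall w, ~ A w ->
    exists2 l, ell_constr Theta n (fun i => X i w) (m, m) = l%:E &
      `|l - chi_stat (normalized_sum W n w)| <= 2 * eta] by near: n.
have [c1 _] : (P [set w | (chi_stat (normalized_sum W n w) <= t + 2 * eta)%R] <=
    gaussp [set z | (chi_stat z <= t + 3 * eta)%R] + e%:E)%E /\
   (gaussp [set z | (chi_stat z <= t + 2 * eta)%R] <=
    P [set w | (chi_stat (normalized_sum W n w) <= t + 3 * eta)%R] + e%:E)%E by near: n.
have [_ c2] : (P [set w | (chi_stat (normalized_sum W n w) <= t - 3 * eta)%R] <=
    gaussp [set z | (chi_stat z <= t - 2 * eta)%R] + e%:E)%E /\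
   (gaussp [set z | (chi_stat z <= t - 3 * eta)%R] <=
    P [set w | (chi_stat (normalized_sum W n w) <= t - 2 * eta)%R] + e%:E)%E by near: n.
have union (B C : set T) : measurable B -> measurable C -> (forall w, B w -> ~ A w -> C w) ->
    (P B <= P C + e%:E)%E.
  move=> mB mC BC; apply: (@le_trans _ _ (P (C `|` A))).
    apply: le_measure; rewrite ?inE//; first exact: measurableU.
    by move=> w Bw; have [|/(BC _ Bw)] := pselect (A w); [right|left].
  by apply: (le_trans (@measureU2 _ _ _ P _ _ mC mA)); rewrite leeD2l.
rewrite !QE; split.
- apply: (@le_trans _ _ (P [set w | (chi_stat (normalized_sum W n w) <= t + 2 * eta)%R] + e%:E)%E).
    apply: union => [||w /= + /HA[l lE]]; [exact: mell|exact: mchi|].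
    by rewrite lE lee_fin ler_norml => lt /andP[? ?]; lra.
  by rewrite EFinD addeA leeD2r.
- apply: (le_trans c2); rewrite EFinD addeA leeD2r//.
  apply: union => [||w /= + /HA[l lE]]; [exact: mchi|exact: mell|].
  by rewrite lE lee_fin ler_norml => lt /andP[? ?]; lra.
Unshelve. all: by end_near. Qed.

Lemma ell_constr_cvg_in_distribution :
  cvg_in_distribution P (fun n w => ell_constr Theta n (fun i => X i w) (m, m)) chi2bar12.
Proof.
move=> t ct.
have Qfin s : Q s = (fine (Q s))%:E.
  by rewrite fineK//; exact: fin_num_measure.
have : Q s @[s --> t] --> Q t by exact: ct.
rewrite -/(Q t) [X in _ --> X -> _]Qfin => /fine_cvgP[_ Ft].
rewrite [X in _ --> X]Qfin; apply/fine_cvgP; split.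
  near=> n; apply: fin_num_measure; apply: mell.
  by near: n; exact: nbhs_infty_gt.
apply/cvgrPdist_le => e e0.
have e4 : 0 < e / 4 by rewrite divr_gt0.
(* Continuity of the limit cdf at t absorbs the shifts of 3 eta < del: e / 4 for a shift and 2 (e /
   4) from [ell_constr_cdf_approx] stay below e. *)
have /cvgrPdist_lt/(_ _ e4)/nbhs_ballP[del /= del0 Hdel] := Ft.
pose eta := Num.min 1 (del / 4).
have eta0 : 0 < eta by rewrite lt_min ltr01 divr_gt0.
have eta1 : eta <= 1 by rewrite ge_min lexx.
have etad : 3 * eta < del.
  have : eta <= del / 4 by rewrite ge_min lexx orbT.
  by move: del0 eta0; move: (eta) => y ? ?; lra.
have H := ell_constr_cdf_approx t eta0 eta1 e4.
have F1 : `|fine (Q t) - fine (Q (t + 3 * eta)%R)| < e / 4.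
  apply: Hdel; rewrite /ball /= opprD addNKr normrN ger0_norm// mulr_ge0// ltW//.
have F2 : `|fine (Q t) - fine (Q (t - 3 * eta)%R)| < e / 4.
  by apply: Hdel; rewrite /ball /= subKr ger0_norm// mulr_ge0// ltW.
near=> n.
have n0 : (0 < n)%N by near: n; exact: nbhs_infty_gt.
have : (ell_cdf t n <= Q (t + 3 * eta)%R + (e / 4 + e / 4)%R%:E)%E /\
    (Q (t - 3 * eta)%R <= ell_cdf t n + (e / 4 + e / 4)%R%:E)%E by near: n.
rewrite /= -/(ell_cdf t n).
have -> : ell_cdf t n = (fine (ell_cdf t n))%:E.
  by rewrite fineK//; apply: fin_num_measure; exact: mell.
rewrite (Qfin (t + _)) (Qfin (t - _)) -!EFinD !lee_fin.
move: F1 F2; rewrite !ltr_norml ler_norml /=.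
move: (fine _) (fine _) (fine _) (fine _) => p q r s /andP[? ?] /andP[? ?] [? ?].
by apply/andP; split; lra.
Unshelve. all: by end_near. Qed.

End constrained_likelihood_limit.

Theorem theorem2p6 (R : realType) (d : measure_display) (T : measurableType d)
  (P : probability T R) (m : R) (mu0 : R * R)
  (X : nat -> {RV P >-> (R * R)%type})
  (hmu0 : mu0 = (m, m))
  (hindep : mutually_independent X)
  (hid : identically_distributed X)
  (hmean : forall i, 'E_P[fst \o X i]%E = mu0.1%:E /\
                     'E_P[snd \o X i]%E = mu0.2%:E)
  (hvar : forall i, posdefmx (covariance_mx (X i)))
  (hmom3 : forall i, ('E_P[fun w => (enorm (X i w - mu0) ^+ 3)%R] < +oo)%E)
  (hhull : forall M : R,
     P [set w | [set mu0 + (Num.sqrt n%:R)^-1 *: h | h in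
                   [set h : R * R | enorm h <= M]] `<=`
                interior (conv_hull [set X i w | i in `I_n])]
     @[n --> \oo] --> 1%E) :
  let Theta := [set mu : R * R | mu.1 <= mu.2] in
  cvg_in_distribution P
    (fun n w => ell_constr Theta n (fun i => X i w) mu0)
    chi2bar12.
Proof.
move=> Theta; subst mu0.
have [X1 X2] := hmean 0%N.
have [sg [tau [be [sg0 tau0 HW]]]] := exists_whitening X1 X2 (hvar 0%N) (hmom3 0%N).
have [rho mW] := HW (comp_rv X (measurable_whiten m sg tau be) 0%N) (fun=> erefl).
exact: (ell_constr_cvg_in_distribution sg0 tau0 hindep hid mW).
Qed.
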